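(* Let $\Xi=(\mathbb{X},\rho,\mu^*,\{\lambda_k\}_{k=0}^\infty,\{\phi_k\}_{k=0}^\infty)$ be a data-defined space with exponent $q$. Let $1\le p\le\infty$ and $\gamma>q/p$. There is a constant $c>0$ (independent of $n$, $\nu$, $A$ and $f$) such that the following holds. Let $n\ge 1$, let $\nu\in\mathcal{M}$ be a $1/n$-regular measure with $|\nu|(\mathbb{X})<\infty$, and suppose that for some constant $A>0$ $$\left|\int_{\mathbb{X}}P\,d\mu^*-\int_{\mathbb{X}}P\,d\nu\right|\le A\,\frac{\|P\|_{H_\gamma^p}}{n^\gamma},\qquad P\in\Pi_n .$$ Then for every $f\in H_\gamma^p$, $$\left|\int_{\mathbb{X}}f\,d\mu^*-\int_{\mathbb{X}}f\,d\nu\right|\le c\left(A+|\!|\!|\nu|\!|\!|_{R,1/n}^{1/p}\,(|\nu|(\mathbb{X}))^{1/p'}\right)\frac{\|f\|_{H_\gamma^p}}{n^\gamma}.$$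
   Context: Data-defined space. $\mathbb{X}$ is a non-empty set with a quasi-metric $\rho$: $\rho\ge0$, $\rho(x,y)=0$ iff $x=y$, $\rho(x,y)=\rho(y,x)$, and $\rho(x,y)\le\kappa_1(\rho(x,z)+\rho(z,y))$ for a constant $\kappa_1\ge1$. The sets $\{y:\rho(x,y)<r\}$ ($x\in\mathbb{X}$, $r>0$) form a basis of the topology of $\mathbb{X}$. Write $\mathbb{B}(x,r)=\{y\in\mathbb{X}:\rho(x,y)\le r\}$. $\mu^*$ is a probability measure on $\mathbb{X}$; $\{\lambda_k\}_{k\ge0}$ is a non-decreasing sequence with $\lambda_0=0$, $\lambda_k\uparrow\infty$; $\{\phi_k\}_{k\ge 0}$ are continuous, bounded, integrable real-valued functions, orthonormal in $L^2(\mu^* )$, with $\phi_0\equiv1$. The system is a data-defined space if: (1) every ball $\mathbb{B}(x,r)$ is compact; (2) there are $q>0,\kappa_2>0$ with $\mu^*(\mathbb{B}(x,r))\le\kappa_2r^q$ for all $x\in\mathbb{X}$, $r>0$; (3) the series $K_t(x,y)=\sum_{k=0}^\infty \exp(-\lambda_k^2t)\phi_k(x)\phi_k(y)$ converges for all $t\in(0,1]$, $x,y\in\mathbb{X}$, and there are $\kappa_3,\kappa_4>0$ with $|K_t(x,y)|\le\kappa_3t^{-q/2}\exp(-\kappa_4\rho(x,y)^2/t)$ for all $x,y\in\mathbb{X}$, $0<t\le1$ (same $q$). The number $q$ is the exponent. Measures. $\mathcal{M}$ is the set of all signed (finite total variation) or positive, complete, sigma-finite Borel measures on $\mathbb{X}$;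 $|\nu|$ is the total variation measure of $\nu$. For $d>0$, $\nu\in\mathcal{M}$ is $d$-regular if there is a constant $C$ with $|\nu|(\mathbb{B}(x,d))\le Cd^q$ for all $x\in\mathbb{X}$; the infimum of all such $C$ is $|\!|\!|\nu|\!|\!|_{R,d}$. Function spaces. $\Pi_n=\mathrm{span}\{\phi_j:\lambda_j<n\}$; elements of $\bigcup_n\Pi_n$ are diffusion polynomials. $L^p=L^p(\mu^* )$ with norm $\|\cdot\|_p$; $X^p$ is the $L^p$-closure of the set of diffusion polynomials; $p'=p/(p-1)$ ($1'=\infty$, $\infty'=1$). $\hat f(k)=\int f\phi_k\,d\mu^*$. For $r>0$, $W_r^p$ is the set of $f\in X^p$ for which there is $\Delta^rf\in X^p$ with $\widehat{\Delta^rf}(k)=(\lambda_k+1)^r\hat f(k)$ for all $k$. For $f\in X^p$, $\delta>0$, $\omega_r(p;f,\delta)=\inf\{\|f-f_1\|_p+\delta^r\|\Delta^rf_1\|_p: f_1\in W_r^p\}$. For $\gamma>0$ fix any $r>\gamma$; $H_\gamma^p$ is the set of $f\in X^p$ with $\|f\|_{H_\gamma^p}:=\|f\|_p+\sup_{\delta\in(0,1]}\delta^{-\gamma}\omega_r(p;f,\delta)<\infty$ (different $r>\gamma$ give equivalent norms). When $\gamma>q/p$, each $f\in H_\gamma^p$ belongs to $X^\infty$, and is identified with its continuous representative (a uniform limit of diffusion polynomials), so that $\int f\,d\nu$ makes sense. Constants: $c$ depends only on $\mathbb{X},\rho,\mu^*,q,\kappa_1,\dots,\kappa_4$ and the fixed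 parameters $p,\gamma,r$; it does not depend on the systems $\{\phi_k\},\{\lambda_k\}$ except through these quantities. *)

(* Defs.v *)
From HB Require Import structures.
From mathcomp Require Import all_boot all_order all_algebra.
From mathcomp Require Import all_classical all_reals all_analysis.

Set Implicit Arguments.
Unset Strict Implicit.
Unset Printing Implicit Defensive.

Import Order.TTheory GRing.Theory Num.Theory.
Import numFieldNormedType.Exports.

Local Open Scope classical_set_scope.
Local Open Scope ring_scope.

Definition borelType (X : ptopologicalType) := g_sigma_algebraType (@open X).

Definition qball (R : realType) (X : Type) (rho : X -> X -> R) (x : X) (r : R)
  : set X := [set y | rho x y <= r].

Definition qball_open (R : realType) (X : Type) (rho : X -> X -> R) (x : X)
  (r : R) : set X := [set y | rho x y < r].

Definition heat_kernel (R : realType) (X : Type) (lam : nat -> R)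
    (phi : nat -> X -> R) (t : R) (x y : X) : R :=
  limn (series (fun k => expR (- (lam k ^+ 2 * t)) * phi k x * phi k y)).

(* Nonemptiness of the space is part of [ptopologicalType]. *)
Record data_defined_space (R : realType) (X : ptopologicalType)
    (rho : X -> X -> R) (mu : probability (borelType X) R)
    (lam : nat -> R) (phi : nat -> X -> R) (q k1 k2 k3 k4 : R) : Prop := {
  dds_rho_ge0 : forall x y, 0 <= rho x y ;
  dds_rho_eq0 : forall x y, rho x y = 0 <-> x = y ;
  dds_rhoC : forall x y, rho x y = rho y x ;
  dds_k1_ge1 : 1 <= k1 ;
  dds_rho_triangle : forall x y z, rho x y <= k1 * (rho x z + rho z y) ;
  dds_basis :
    basis [set U : set X | exists (x : X) (r : R), 0 < r /\ U = qball_open rho x r] ;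
  dds_lam0 : lam 0%N = 0 ;
  dds_lam_nondecreasing : {homo lam : i j / (i <= j)%N >-> i <= j} ;
  dds_lam_cvg : lam @ \oo --> +oo ;
  dds_phi_continuous : forall k, continuous (phi k) ;
  dds_phi_bounded : forall k, exists M : R, forall x, `|phi k x| <= M ;
  dds_phi_integrable : forall k, mu.-integrable setT (EFin \o phi k) ;
  dds_phi_orthonormal : forall j k,
    \int[mu]_(x in setT) (phi j x * phi k x) = (j == k)%:R ;
  dds_phi0 : forall x, phi 0%N x = 1 ;
  dds_ball_compact : forall (x : X) (r : R), 0 < r -> compact (qball rho x r) ;
  dds_q_gt0 : 0 < q ;
  dds_k2_gt0 : 0 < k2 ;
  dds_ball_measure : forall (x : X) (r : R), 0 < r ->
    (mu (qball rho x r) <= (k2 * r `^ q)%:E)%E ;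
  dds_kernel_cvg : forall (t : R) (x y : X), 0 < t <= 1 ->
    cvgn (series (fun k => expR (- (lam k ^+ 2 * t)) * phi k x * phi k y)) ;
  dds_k3_gt0 : 0 < k3 ;
  dds_k4_gt0 : 0 < k4 ;
  dds_kernel_bound : forall (t : R) (x y : X), 0 < t <= 1 ->
    `|heat_kernel lam phi t x y| <=
      k3 * t `^ (- (q / 2)) * expR (- (k4 * rho x y ^+ 2 / t)) }.

Section signed_or_positive.
Context d (T : measurableType d) (R : realType).

Definition hahn_pos (nu : {charge set T -> \bar R}) : set T :=
  sval (cid (Hahn_decomposition nu)).

Definition hahn_neg (nu : {charge set T -> \bar R}) : set T :=
  sval (cid (svalP (cid (Hahn_decomposition nu)))).

Definition hahn_posneg (nu : {charge set T -> \bar R}) :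
    hahn_decomposition nu (hahn_pos nu) (hahn_neg nu) :=
  svalP (cid (svalP (cid (Hahn_decomposition nu)))).

(* Charges are finite-valued, hence of finite total variation; positive
   measures may be infinite. *)
Definition signed_or_positive : Type :=
  ({charge set T -> \bar R} + {sigma_finite_measure set T -> \bar R})%type.

Definition variation_measure (nu : signed_or_positive)
    : {measure set T -> \bar R} :=
  match nu with
  | inl sg => charge_variation (hahn_posneg sg)
  | inr m => m
  end.

Definition sp_integral (nu : signed_or_positive) (f : T -> R) : R :=
  match nu with
  | inl sg => \int[jordan_pos (hahn_posneg sg)]_(x in setT) f x
            - \int[jordan_neg (hahn_posneg sg)]_(x in setT) f x
  | inr m => \int[m]_(x in setT) f x
  end.

End signed_or_positive.

(* A complete Borel measure lives on some sigma-algebra containing the Borel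
   sets, in general larger than the Borel one; that sigma-algebra, generated by
   [cbm_gen], is part of the data. *)
Record complete_borel_measure (R : realType) (X : ptopologicalType) := {
  cbm_gen : set (set X) ;
  cbm_measure :> signed_or_positive (g_sigma_algebraType cbm_gen) R ;
  cbm_borel : @open X `<=` <<s cbm_gen >> ;
  cbm_complete : measure_is_complete (variation_measure cbm_measure) }.

Section regular_measures.
Context (R : realType) (X : ptopologicalType) (rho : X -> X -> R) (q : R).

Definition regularity_bounds (d : R) (nu : complete_borel_measure R X)
    : set R :=
  [set C | forall x,
    (variation_measure nu (qball rho x d) <= (C * d `^ q)%:E)%E].

Definition d_regular (d : R) (nu : complete_borel_measure R X) : Prop :=
  regularity_bounds d nu !=set0.

Definition regular_norm (d : R) (nu : complete_borel_measure R X) : R :=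
  inf (regularity_bounds d nu).

End regular_measures.

(* Elements of L^p are represented by functions; equality of classes is
   equality mu-almost everywhere. *)
Section function_spaces.
Context (R : realType) (X : ptopologicalType).
Variables (mu : probability (borelType X) R).
Variables (lam : nat -> R) (phi : nat -> X -> R).

Definition Pi (n : R) : set (X -> R) :=
  [set P | exists (m : nat) (a : nat -> R),
     P = fun x => \sum_(j < m | lam j < n) a j * phi j x].

Definition diffusion_polynomial : set (X -> R) :=
  [set P | exists n, Pi n P].

Definition Lpnorm (p : \bar R) (f : X -> R) : \bar R :=
  ('N[mu]_p [EFin \o f])%E.

Definition Xp (p : \bar R) : set (X -> R) :=
  [set f | [/\ measurable_fun setT (f : borelType X -> R),
     (Lpnorm p f < +oo)%E &
     forall e : R, 0 < e ->
       exists2 P, diffusion_polynomial P & (Lpnorm p (f \- P)%R < e%:E)%E]].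

Definition fhat (f : X -> R) (k : nat) : R :=
  \int[mu]_(x in setT) (f x * phi k x).

(* [g] is a version of Delta^r f; it is determined mu-almost everywhere. *)
Definition is_Delta (p : \bar R) (r : R) (f g : X -> R) : Prop :=
  Xp p g /\ forall k, fhat g k = (lam k + 1) `^ r * fhat f k.

Definition Wp (p : \bar R) (r : R) : set (X -> R) :=
  [set f | Xp p f /\ exists g, is_Delta p r f g].

Definition Kfunctional (p : \bar R) (r : R) (f : X -> R) (delta : R) : \bar R :=
  ereal_inf [set e | exists f1 g, [/\ Wp p r f1, is_Delta p r f1 g &
    e = (Lpnorm p (f \- f1)%R + (delta `^ r)%:E * Lpnorm p g)%E]].

Definition Hnorm (p : \bar R) (gamma r : R) (f : X -> R) : \bar R :=
  (Lpnorm p f +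
   ereal_sup [set (delta `^ (- gamma))%:E * Kfunctional p r f delta
             | delta in [set delta : R | 0 < delta <= 1]%R])%E.

Definition Hspace (p : \bar R) (gamma r : R) : set (X -> R) :=
  [set f | Xp p f /\ (Hnorm p gamma r f < +oo)%E].

Definition is_continuous_version (f g : X -> R) : Prop :=
  [/\ continuous g,
      forall e : R, 0 < e ->
        exists2 P, diffusion_polynomial P & forall x, `|g x - P x| <= e &
      \forall x \ae mu, f x = g x].

(* On a data-defined space balls have positive mu-measure, so a continuous
   version is unique; the default value [f] is used only when none exists. *)
Definition continuous_version (f : X -> R) : X -> R :=
  xget f [set g | is_continuous_version f g].

End function_spaces.

(* Main.v *)
Require Import Defs.
From HB Require Import structures.
From mathcomp Require Import all_boot all_order all_algebra.
From mathcomp Require Import all_classical all_reals all_analysis.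
From mathcomp Require Import measurable_realfun ess_sup_inf.
From mathcomp Require Import ring lra.

Set Implicit Arguments.
Unset Strict Implicit.
Unset Printing Implicit Defensive.

Import Order.TTheory GRing.Theory Num.Theory.
Import numFieldNormedType.Exports.

Local Open Scope classical_set_scope.
Local Open Scope ring_scope.

(** With [u_k = exp (- (lam_k / m) ^ 2)], every heat sum
   [\sum_k u_k ^ (e + 1) phi_k x phi_k y] is a heat kernel at time
   [(e + 1) / m ^ 2], so a polynomial in [u_k] vanishing at 0 has a kernel with
   Gaussian decay.  Approximating a smooth [F], supported away from 0, by
   polynomials of degree [N] comparable to [2 ^ j] shows that the kernel of
   [h |-> \sum_k F (u_k) hhat(k) phi_k] is at most [c m ^ q 2 ^ (- s j)] where
   [m rho > 2 ^ j].  A weighted Schur test then bounds this operator from [L^p]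
   to itself, and to [L^1] of a measure with growth exponent [q].

   For [F] a cutoff equal to 1 near 1 this operator [sigma_m] maps into [Pi_m],
   is uniformly bounded, hence stable in the smoothness norm, and satisfies a
   Jackson estimate.  The quadrature error of [f] is that of [sigma_n f],
   controlled by the hypothesis, plus the integral of [f - sigma_n f] against
   the measure.  The latter telescopes into the dyadic blocks
   [sigma_(2m) f - sigma_m f], whose integrals decay geometrically because
   [gamma > q / p].  Dirac masses in place of the measure give the uniform
   convergence of [sigma_m f] to the continuous version of [f]. *)

(** The Gaussian bound is given only for real times at most 1, and this shapes the proof. A
    polynomial of degree [N] in [u_k] is usable only if its largest time, about [N / m ^ 2], stays
    below 1. Degrees comparable to [2 ^ j < m rho] satisfy this once the diameter is finite, and
    finiteness comes from a lower bound for the measure of balls: the heat kernel has integral 1 and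
    concentrates near its centre.

    The coefficients of the approximating polynomials may grow like [3 ^ N]. Taking [N] to be a
    small fixed fraction of [2 ^ j] makes the Gaussian factor at most [exp (- 3 N)], which wins.
    Bernstein approximation gains only [N ^ (-1/2)] per derivative, so decay of order [s] costs
    [2 s] derivatives, and [s >= q + 1] is what makes dyadic annuli summable.

    Regularity at the single scale [1 / n] propagates, by packing, to larger radii only. At a finer
    scale [m = 2 ^ J n] the measure of a ball is merely bounded by that of the ball enlarged [2 ^ J]
    times. This loses [2 ^ (J q / p)] against the gain [2 ^ (- J gamma)], whence the condition on
    [gamma]. *)

(** * Families of functions with uniformly bounded derivatives *)

(* The bounds are uniform in the index [i : T]; [S] counts derivatives. *)
Fixpoint smooth (R : realType) (T : Type) (S : nat) (U : set R)
    (F : T -> R -> R) : Prop :=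
  (exists K : R, forall i x, U x -> `|F i x| <= K) /\
  match S with
  | 0%N => True
  | S'.+1 => exists F' : T -> R -> R,
      (forall i x, U x -> is_derive x 1 (F i) (F' i x)) /\ smooth S' U F'
  end.

Section smooth_theory.
Context (R : realType) (T : Type).
Implicit Types (U V : set R) (F G : T -> R -> R) (S : nat).

Lemma smooth_bounded S U F : smooth S U F ->
  exists2 K : R, 0 <= K & forall i x, U x -> `|F i x| <= K.
Proof.
have [|] := pselect ((exists i : T, True) /\ U !=set0).
  move=> [[i _] [x Ux]]; case: S => [|S] [[K hK] _]; exists K => //;
  exact: le_trans (hK i x Ux).
move=> h _; exists 0 => // i x Ux; exfalso; apply: h; split; first by exists i.
by exists x.
Qed.

Lemma smoothS S U F : smooth S.+1 U F -> smooth S U F.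
Proof.
elim: S F => [|S IH] F /= [bF [F' [dF sF']]]; first by split.
by split=> //; exists F'; split=> //; exact: IH.
Qed.

Lemma smooth_sub S U V F : V `<=` U -> smooth S U F -> smooth S V F.
Proof.
move=> VU; elim: S F => [|S IH] F /= [[K bF] h].
  by split=> //; exists K => i x /VU; exact: bF.
split; first by exists K => i x /VU; exact: bF.
case: h => F' [dF sF']; exists F'; split; last exact: IH.
by move=> i x /VU; exact: dF.
Qed.

Lemma smooth_cst S U (c : R) : smooth S U (fun (_ : T) (_ : R) => c).
Proof.
elim: S c => [|S IH] c /=; first by split=> //; exists `|c|.
split; first by exists `|c|.
exists (fun _ _ => 0); split=> [i x _|]; [exact: is_derive_cst|exact: IH].
Qed.

Lemma smooth_id S U : (exists K : R, forall x, U x -> `|x| <= K) ->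
  smooth S U (fun (_ : T) (x : R) => x).
Proof.
move=> [K hK]; case: S => [|S] /=; first by split=> //; exists K => _; exact: hK.
split; first by exists K => _; exact: hK.
exists (fun _ _ => 1); split=> [i x _|]; [exact: is_derive_id|exact: smooth_cst].
Qed.

Lemma smoothD S U F G : smooth S U F -> smooth S U G ->
  smooth S U (fun i x => F i x + G i x).
Proof.
elim: S F G => [|S IH] F G /= [[K hK] hF] [[L hL] hG].
  split=> //; exists (K + L) => i x Ux.
  by rewrite (le_trans (ler_normD _ _))// lerD ?hK ?hL.
split.
  exists (K + L) => i x Ux.
  by rewrite (le_trans (ler_normD _ _))// lerD ?hK ?hL.
case: hF => F' [dF sF]; case: hG => G' [dG sG].
exists (fun i x => F' i x + G' i x); split; last exact: IH.
by move=> i x Ux; apply: is_deriveD; [exact: dF|exact: dG].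
Qed.

Lemma smoothM S U F G : smooth S U F -> smooth S U G ->
  smooth S U (fun i x => F i x * G i x).
Proof.
have bM F1 G1 : (exists K : R, forall i x, U x -> `|F1 i x| <= K) ->
    (exists K : R, forall i x, U x -> `|G1 i x| <= K) ->
    exists K : R, forall i x, U x -> `|F1 i x * G1 i x| <= K.
  by move=> [K hK] [L hL]; exists (K * L) => i x Ux; rewrite normrM ler_pM ?hK ?hL.
elim: S F G => [|S IH] F G sF sG.
  by move: sF sG => /= [bF _] [bG _]; split=> //; exact: bM.
have := smoothS sG; have := smoothS sF.
move: sF sG => /= [bF [F' [dF sF]]] [bG [G' [dG sG]]] sF0 sG0.
split; first exact: bM.
exists (fun i x => F i x * G' i x + G i x * F' i x); split.
  by move=> i x Ux; apply: is_deriveM; [exact: dF|exact: dG].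
by apply: smoothD; apply: IH.
Qed.

Lemma smoothN S U F : smooth S U F -> smooth S U (fun i x => - F i x).
Proof.
move=> sF; have := smoothM (smooth_cst S U (-1)) sF.
by under [X in smooth _ _ X -> _]eq_fun do under eq_fun do rewrite mulN1r.
Qed.

Lemma smoothB S U F G : smooth S U F -> smooth S U G ->
  smooth S U (fun i x => F i x - G i x).
Proof. by move=> sF /smoothN; exact: smoothD. Qed.

Lemma smoothX S U F n : smooth S U F -> smooth S U (fun i x => F i x ^+ n).
Proof.
move=> sF; elim: n => [|n IH].
  under eq_fun do under eq_fun do rewrite expr0; exact: smooth_cst.
under eq_fun do under eq_fun do rewrite exprS; exact: smoothM.
Qed.

Lemma smooth_comp S U V F G : (forall i x, U x -> V (G i x)) ->
  smooth S V F -> smooth S U G -> smooth S U (fun i x => F i (G i x)).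
Proof.
move=> UV; elim: S F G UV => [|S IH] F G UV.
  by move=> /= [[K hK] _] _; split=> //; exists K => i x Ux; exact/hK/UV.
move=> sF sG; have sG0 := smoothS sG.
move: sF sG => /= [[K hK] [F' [dF sF]]] [_ [G' [dG sG]]].
split; first by exists K => i x Ux; exact/hK/UV.
exists (fun i x => F' i (G i x) * G' i x); split.
  by move=> i x Ux; apply: is_derive1_comp; [exact/dF/UV|exact: dG].
by apply: smoothM => //; exact: IH.
Qed.

Lemma is_derive_near0 (f : R -> R) x : (\forall y \near x, f y = 0) ->
  is_derive x (1 : R) f 0.
Proof.
move=> f0; apply: (@near_eq_is_derive R R R (cst 0) f x 1 0).
by apply: filterS f0 => y ->.
Qed.

(** This lets a cutoff [G] multiply a function [F] that is controlled only near the support of [G].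
    On [A] the product rule applies; at a point of [U] off [A] the product vanishes in a
    neighbourhood, and [G'] vanishes there too, so the same formula gives the derivative 0. *)
Lemma smooth_supp S U V (A : set R) F G : open U -> closed A -> A `<=` V ->
  (forall i x, U x -> ~ A x -> G i x = 0) ->
  smooth S V F -> smooth S U G -> smooth S U (fun i x => G i x * F i x).
Proof.
move=> oU cA AV.
have bGF F1 G1 : (forall i x, U x -> ~ A x -> G1 i x = 0) ->
    (exists K : R, forall i x, V x -> `|F1 i x| <= K) ->
    (exists K : R, forall i x, U x -> `|G1 i x| <= K) ->
    exists K : R, forall i x, U x -> `|G1 i x * F1 i x| <= K.
  move=> G0 [K hK] [L hL]; exists (L * Num.max K 0) => i x Ux.
  rewrite normrM; have [Ax|nAx] := pselect (A x).
    by rewrite ler_pM ?hL// le_max hK//; exact: AV.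
  rewrite G0// normr0 mul0r mulr_ge0// ?le_max ?lexx ?orbT//.
  exact: le_trans (hL i x Ux).
elim: S F G => [|S IH] F G G0.
  by move=> /= [bF _] [bG _]; split=> //; exact: bGF.
move=> sF sG; have sG0 := smoothS sG; have sF0 := smoothS sF.
move: sF sG => /= [bF [F' [dF sF]]] [bG [G' [dG sG]]].
split; first exact: bGF.
have nearG i x : U x -> ~ A x -> \forall y \near x, G i y = 0.
  move=> Ux nAx; have : nbhs x (U `&` ~` A).
    apply: open_nbhs_nbhs; split=> //.
    by apply: openI => //; exact: closed_openC.
  by apply: filterS => y [Uy nAy]; exact: G0.
have G'0 i x : U x -> ~ A x -> G' i x = 0.
  move=> Ux nAx; have dGx := dG i x Ux.
  have d0 : is_derive x (1 : R) (G i) 0.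
    exact/is_derive_near0/nearG.
  by rewrite -(@derive_val _ _ _ _ _ _ _ dGx) (@derive_val _ _ _ _ _ _ _ d0).
exists (fun i x => G i x * F' i x + G' i x * F i x); split; last first.
  by apply: smoothD; apply: IH.
move=> i x Ux; have [Ax|nAx] := pselect (A x).
  rewrite [G' i x * _]mulrC; apply: is_deriveM; [exact: dG|exact/dF/AV].
rewrite G0// G'0// !mul0r addr0.
apply: is_derive_near0.
by apply: filterS (nearG i x Ux nAx) => y ->; rewrite mul0r.
Qed.

Lemma smooth_powR S (a v0 v1 : R) : 0 < v0 ->
  smooth S [set x | v0 <= x <= v1] (fun (_ : T) (x : R) => x `^ a).
Proof.
move=> v00.
have bd b : exists K : R, forall (i : T) x, [set x | v0 <= x <= v1] x -> `|x `^ b| <= K.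
  have [b0|b0] := leP 0 b.
    exists (v1 `^ b) => i x /= /andP[v0x xv1].
    have x0 : 0 <= x by rewrite (le_trans _ v0x)// ltW.
    by rewrite ger0_norm ?powR_ge0// ge0_ler_powR// nnegrE// (le_trans x0).
  exists (v0 `^ b) => i x /= /andP[v0x xv1].
  have x0 : 0 < x by rewrite (lt_le_trans v00).
  rewrite ger0_norm ?powR_ge0// -(opprK b) powRN [leRHS]powRN lef_pV2 ?posrE ?powR_gt0//.
  by rewrite ge0_ler_powR// ?nnegrE ?oppr_ge0 ltW.
elim: S a => [|S IH] a /=; first by split.
split=> //.
exists (fun _ x => a * x `^ (a - 1)); split.
  move=> i x /andP[v0x _]; apply: is_derive1_powR; exact: lt_le_trans v0x.
by apply: smoothM; [exact: smooth_cst|exact: IH].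
Qed.

Lemma smooth_ln S (v0 v1 : R) : 0 < v0 ->
  smooth S [set x | v0 <= x <= v1] (fun (_ : T) (x : R) => ln x).
Proof.
move=> v00; have bd : exists K : R, forall (i : T) x,
    [set x | v0 <= x <= v1] x -> `|ln x| <= K.
  exists (Num.max (- ln v0) (ln v1)) => i x /= /andP[v0x xv1].
  have x0 : 0 < x by rewrite (lt_le_trans v00).
  rewrite le_max; have [h|h] := leP 0 (ln x).
    by rewrite ger0_norm// ler_ln ?xv1 ?orbT// posrE (lt_le_trans x0).
  by rewrite ltr0_norm// lerN2 ler_ln ?v0x.
case: S => [|S] /=; first by split.
split=> //; exists (fun _ x => x `^ (-1)); split; last exact: smooth_powR.
move=> i x /andP[v0x _]; have x0 : 0 < x by rewrite (lt_le_trans v00).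
by rewrite powR_inv1 ?ltW//; exact: is_derive1_ln.
Qed.

(** The truncated power. Only finitely many derivatives are ever needed, so piecewise polynomials
    can play the part of smooth bump functions. *)
Definition pospow (k : nat) (x : R) : R := Num.max x 0 ^+ k.

Lemma is_derive_exprn k (x : R) :
  is_derive x (1 : R) (fun y : R => y ^+ k) (k%:R * x ^+ k.-1).
Proof.
apply: DeriveDef; first exact: exprn_derivable.
by rewrite exp_derive /GRing.scale/= /GRing.scale/= mulr1.
Qed.

Lemma is_derive_pospow k (x : R) :
  is_derive x 1 (pospow k.+2) (k.+2%:R * pospow k.+1 x).
Proof.
have [x0|x0|->] := ltgtP x 0.
- rewrite /(pospow _ x) max_r ?ltW// expr0n/= mulr0.
  apply: is_derive_near0.
  by near=> y; rewrite /pospow max_r ?expr0n//; apply: ltW; near: y; exact: lt_nbhsl.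
- rewrite /(pospow _ x) max_l ?ltW//.
  apply: (@near_eq_is_derive R R R (fun y => y ^+ k.+2) (pospow k.+2) x 1).
    near=> y; rewrite /pospow max_l// -oppr_le0; apply: ltW; near: y.
    by apply: Nlt_nbhsl; rewrite oppr_lt0.
  apply: is_derive_exprn.
rewrite /(pospow _ 0) maxxx expr0n/= mulr0.
(* At the knot 0 the difference quotient is exactly [Num.max h 0 ^+ k.+1], which tends to 0. *)
have cv : h^-1 *: ((pospow k.+2 \o shift 0) (h *: (1 : R)) - pospow k.+2 0) @[h --> (0:R)^'] --> (0 : R).
  have c0 : (Num.max h 0 ^+ k.+1) @[h --> (0:R)^'] --> (0 : R).
    apply: cvg_within_filter.
    have h1 : {for (0 : R), continuous (fun h : R => Num.max h 0)}.
      by apply: continuous_max; [exact: cvg_id|exact: cvg_cst].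
    have : Num.max h 0 ^+ k.+1 @[h --> (0 : R)] --> Num.max (0 : R) 0 ^+ k.+1.
      exact: continuous_comp h1 (@exprn_continuous R k.+1 _).
    by rewrite maxxx expr0n.
  apply: cvg_trans c0; apply: near_eq_cvg; near=> h.
  rewrite /= addr0 /GRing.scale/= mulr1 /pospow maxxx expr0n subr0.
  have [h0|h0] := leP h 0; first by rewrite !expr0n/= mulr0.
  by rewrite (exprS _ k.+1) mulrA mulVf ?gt_eqF ?mul1r.
apply: DeriveDef; last exact/cvg_lim.
by apply/cvg_ex; exists 0.
Unshelve. all: end_near. Qed.

Lemma smooth_pospow S (B : R) :
  smooth S [set x | `|x| <= B] (fun (_ : T) (x : R) => pospow S.+1 x).
Proof.
elim: S => [|S IH] /=.
  split=> //; exists B => _ x; rewrite /pospow expr1 => xB.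
  rewrite ger0_norm ?le_max ?lexx ?orbT// ge_max (le_trans (ler_norm _))//.
  exact: le_trans xB.
split.
  exists (B ^+ S.+2) => _ x xB; have B0 : 0 <= B by exact: le_trans xB.
  rewrite normrX lerXn2r ?nnegrE// ger0_norm ?le_max ?lexx ?orbT// ge_max B0 andbT.
  exact: le_trans (ler_norm _) _.
exists (fun _ x => S.+2%:R * pospow S.+1 x); split.
  by move=> _ x _; exact: is_derive_pospow.
by apply: smoothM => //; exact: smooth_cst.
Qed.

(** A transition from 0 to 1 on the unit interval: the inner truncated power is flat for [x <= 0],
    and the outer one is flat as soon as the inner one reaches 1. *)
Definition smoothstep (S : nat) (x : R) : R := 1 - pospow S.+1 (1 - pospow S.+1 x).

Lemma smoothstep_eq0 S x : x <= 0 -> smoothstep S x = 0.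
Proof.
by move=> x0; rewrite /smoothstep /pospow (max_r x0) expr0n/= subr0 max_l// expr1n subrr.
Qed.

Lemma smoothstep_eq1 S x : 1 <= x -> smoothstep S x = 1.
Proof.
move=> x1; rewrite /smoothstep /pospow (max_l (le_trans ler01 x1)).
by rewrite max_r ?subr_le0 ?exprn_ege1// expr0n/= subr0.
Qed.

Lemma smooth_smoothstep S (B : R) :
  smooth S [set x | `|x| <= B] (fun (_ : T) (x : R) => smoothstep S x).
Proof.
apply: smoothB; first exact: smooth_cst.
pose B' := 1 + `|B| ^+ S.+1.
apply: (@smooth_comp S _ [set x | `|x| <= B'] (fun _ x => pospow S.+1 x)
  (fun _ x => 1 - pospow S.+1 x)).
- move=> _ x /= xB; rewrite (le_trans (ler_normB _ _))// normr1 lerD2l.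
  rewrite /pospow normrX lerXn2r ?nnegrE// ger0_norm ?le_max ?lexx ?orbT// ge_max normr_ge0 andbT.
  by rewrite (le_trans (ler_norm _))// (le_trans xB)// ler_norm.
- exact: smooth_pospow.
- by apply: smoothB; [exact: smooth_cst|exact: smooth_pospow].
Qed.

End smooth_theory.

(** * Bernstein approximation *)

Section bernstein.
Context (R : realType).
Implicit Types (f g : R -> R).

(** A polynomial is a list of coefficient-exponent pairs, repetitions allowed, so that addition is
    concatenation. The sum of the absolute coefficients is the relevant size because each monomial
    will be replaced by a heat kernel and estimated separately. *)
Definition poly_bound (d : nat) (C : R) f := exists s : seq (R * nat),
  [/\ all (fun t => t.2 <= d)%N s, \sum_(t <- s) `|t.1| <= C &
      forall x, f x = \sum_(t <- s) t.1 * x ^+ t.2].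

Lemma poly_bound_le d d' C C' f : (d <= d')%N -> C <= C' ->
  poly_bound d C f -> poly_bound d' C' f.
Proof.
move=> dd' CC' [s [sd sC fE]]; exists s; split => //; last exact: le_trans sC _.
by apply: sub_all sd => t /leq_trans; exact.
Qed.

Lemma poly_bound_cst d (c : R) : poly_bound d `|c| (fun=> c).
Proof.
exists [:: (c, 0%N)]; split=> //=; first by rewrite big_seq1.
by move=> x; rewrite big_seq1 expr0 mulr1.
Qed.

Lemma poly_boundD d C C' f g : poly_bound d C f -> poly_bound d C' g ->
  poly_bound d (C + C') (fun x => f x + g x).
Proof.
move=> [s [sd sC fE]] [s' [sd' sC' gE]]; exists (s ++ s'); split.
- by rewrite all_cat sd.
- by rewrite big_cat lerD.
- by move=> x; rewrite big_cat/= fE gE.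
Qed.

Lemma poly_boundN d C f : poly_bound d C f -> poly_bound d C (fun x => - f x).
Proof.
move=> [s [sd sC fE]]; exists [seq (- t.1, t.2) | t <- s]; split.
- by rewrite all_map.
- by rewrite big_map; under eq_bigr do rewrite /= normrN.
- by move=> x; rewrite big_map fE -sumrN; apply: eq_bigr => t _; rewrite mulNr.
Qed.

Lemma poly_boundMX d C f : poly_bound d C f -> poly_bound d.+1 C (fun x => x * f x).
Proof.
move=> [s [sd sC fE]]; exists [seq (t.1, t.2.+1) | t <- s]; split.
- by rewrite all_map.
- by rewrite big_map.
- by move=> x; rewrite big_map fE mulr_sumr; apply: eq_bigr => t _; rewrite exprS mulrCA.
Qed.

Lemma poly_bound_antideriv d C f : poly_bound d C f -> exists Q : R -> R,
  [/\ poly_bound d.+1 C Q, Q 0 = 0 & forall x : R, is_derive x (1 : R) Q (f x)].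
Proof.
move=> [s [sd sC fE]].
exists (fun x => \sum_(t <- s) t.1 / t.2.+1%:R * x ^+ t.2.+1); split.
- exists [seq (t.1 / t.2.+1%:R, t.2.+1) | t <- s]; split.
  + by rewrite all_map.
  + rewrite big_map (le_trans _ sC)//; apply: ler_sum => t _ /=.
    by rewrite normrM ler_piMr// normfV ger0_norm// invf_le1 ?ltr0n// ler1n.
  + by move=> x; rewrite big_map.
- by rewrite big1// => t _; rewrite expr0n/= mulr0.
- move=> x; rewrite fE; elim: s {sd sC fE} => [|t s IH].
    under eq_fun do rewrite big_nil.
    by rewrite big_nil; exact: is_derive_cst.
  under eq_fun do rewrite big_cons.
  rewrite big_cons; apply: is_deriveD.
  have -> : t.1 * x ^+ t.2 = t.1 / t.2.+1%:R *: (t.2.+1%:R * x ^+ t.2.+1.-1).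
    by rewrite /GRing.scale/= mulrA divfK// pnatr_eq0.
  by apply: is_deriveZ; exact: is_derive_exprn.
Qed.

(* The expectation of [f] under the binomial distribution of parameters [N]
   and [x]. *)
Fixpoint binomial_mean (x : R) (N : nat) (f : nat -> R) : R :=
  match N with
  | 0%N => f 0%N
  | N'.+1 => x * binomial_mean x N' (f \o succn) + (1 - x) * binomial_mean x N' f
  end.

Lemma binomial_mean_quad (x : R) N (a b c : R) :
  binomial_mean x N (fun k => a * k%:R ^+ 2 + b * k%:R + c) =
  a * (N%:R * x * (1 - x) + N%:R ^+ 2 * x ^+ 2) + b * N%:R * x + c.
Proof.
elim: N a b c => [|N IH] a b c /=; first by ring.
have -> : (fun k => a * k%:R ^+ 2 + b * k%:R + c) \o succn =
    (fun k => a * k%:R ^+ 2 + (2 * a + b) * k%:R + (a + b + c)).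
  by apply/funext => k /=; rewrite -natr1; ring.
by rewrite !IH -natr1; ring.
Qed.

Lemma ler_binomial_mean (x : R) N (f g : nat -> R) : 0 <= x <= 1 ->
  (forall k, f k <= g k) -> binomial_mean x N f <= binomial_mean x N g.
Proof.
move=> /andP[x0 x1]; elim: N f g => [|N IH] f g fg //=.
by rewrite lerD// ler_wpM2l ?subr_ge0// IH// => k /=.
Qed.

Lemma binomial_meanN (x : R) N (f : nat -> R) :
  binomial_mean x N (fun k => - f k) = - binomial_mean x N f.
Proof.
elim: N f => [|N IH] f //=.
by rewrite [binomial_mean x N (_ \o _)](IH (f \o succn)) IH !mulrN opprD.
Qed.

Lemma binomial_meanB (x : R) N (f : nat -> R) c :
  binomial_mean x N f - c = binomial_mean x N (fun k => f k - c).
Proof.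
elim: N f => [|N IH] f //=.
by rewrite -[binomial_mean x N ((fun k => f k - c) \o _)](IH (f \o succn)) -IH; ring.
Qed.

(** The recursion combines earlier polynomials with multipliers [x], 1 and [- x], so each step at
    most triples the coefficient sum. *)
Lemma poly_bound_binomial_mean N (f : nat -> R) (M : R) :
  (forall k, `|f k| <= M) ->
  poly_bound N (3 ^+ N * M) (fun x => binomial_mean x N f).
Proof.
elim: N f => [|N IH] f fM /=.
  by apply: (poly_bound_le (leqnn _) _ (poly_bound_cst 0 (f 0%N))); rewrite mul1r.
have h1 := poly_boundMX (IH (f \o succn) (fun k => fM k.+1)).
have h2 := poly_bound_le (leqnSn N) (lexx _) (IH f fM).
have h3 := poly_boundN (poly_boundMX (IH f fM)).
have := poly_boundD h1 (poly_boundD h2 h3).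
rewrite (_ : (fun x => _) = fun x => x * binomial_mean x N (f \o succn) +
   (1 - x) * binomial_mean x N f); last by apply/funext => x; ring.
by apply: poly_bound_le => //; rewrite exprS le_eqVlt; apply/orP; left; apply/eqP; ring.
Qed.

Lemma min01 k N : 0 <= Num.min (k%:R / N%:R) (1 : R) <= 1.
Proof. by rewrite le_min divr_ge0 ?ler01 ?ler0n//= ge_min lexx orbT. Qed.

(** The rate is the standard deviation of [k / N], reached through a quadratic majorant. The minimum
    with 1 keeps the sample points in the unit interval for every natural [k], as the monotonicity
    of the mean requires a comparison at all [k]. *)
Lemma binomial_mean_approx N (G : R -> R) (L x : R) : (0 < N)%N -> 0 <= L ->
  (forall y z, 0 <= y <= 1 -> 0 <= z <= 1 -> `|G y - G z| <= L * `|y - z|) ->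
  0 <= x <= 1 ->
  `|binomial_mean x N (fun k => G (Num.min (k%:R / N%:R) 1)) - G x| <=
    L / Num.sqrt N%:R.
Proof.
move=> N0 L0 LG x01; rewrite binomial_meanB.
set s := Num.sqrt N%:R.
have s0 : 0 < s by rewrite sqrtr_gt0 ltr0n.
have s2 : s ^+ 2 = N%:R by rewrite sqr_sqrtr// ler0n.
have NR0 : (N%:R : R) != 0 by rewrite pnatr_eq0 -lt0n.
(* This is [L] times the majorant [s a ^ 2 / 2 + 1 / (2 s)] of [a = |k / N - x|], expanded in powers
   of [k] so that its mean follows from the first two moments. *)
pose h (k : nat) := L * s / 2 / N%:R ^+ 2 * k%:R ^+ 2 + (- L * s * x / N%:R) * k%:R
  + (L * s / 2 * x ^+ 2 + L / 2 / s).
have hE k : h k = L * (s / 2 * (k%:R / N%:R - x) ^+ 2 + 2^-1 / s).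
  by rewrite /h; field; rewrite NR0 gt_eqF.
have Gh k : `|G (Num.min (k%:R / N%:R) 1) - G x| <= h k.
  have m01 : 0 <= Num.min (k%:R / N%:R) (1 : R) <= 1.
    exact: min01.
  apply: (le_trans (LG _ _ m01 x01)); rewrite hE ler_wpM2l//.
  set w := Num.min _ _.
  have wE : `|w - x| <= `|k%:R / N%:R - x|.
    rewrite /w; have [//|kN1] := leP (k%:R / N%:R) 1.
    case/andP: x01 => _ x1; rewrite !ger0_norm ?subr_ge0//; first by rewrite lerD2r ltW.
    by rewrite (le_trans x1)// ltW.
  apply: (le_trans wE); rewrite -(real_normK (num_real (k%:R / N%:R - x)))//.
  set a := `|_|.
  rewrite -subr_ge0 (_ : _ - _ = (s * a - 1) ^+ 2 / (2 * s)); last first.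
    by field; rewrite gt_eqF.
  by rewrite divr_ge0 ?sqr_ge0// mulr_ge0// ltW.
have bh : binomial_mean x N h <= L / s.
  rewrite binomial_mean_quad -subr_ge0.
  rewrite (_ : _ - _ = L / s * (2^-1 - x * (1 - x) / 2)); last first.
    by rewrite -s2; field; rewrite gt_eqF.
  apply: mulr_ge0; first by rewrite divr_ge0// ltW.
  by case/andP: x01 => x0 x1; nra.
rewrite ler_norml; apply/andP; split.
  rewrite lerNl (le_trans _ bh)// -binomial_meanN ler_binomial_mean// => k.
  by rewrite (le_trans _ (Gh k))// -normrN ler_norm.
by rewrite (le_trans _ bh)// ler_binomial_mean// => k; rewrite (le_trans _ (Gh k))// ler_norm.
Qed.

(* Bernstein's operator has the rate [N^(-1/2)] on Lipschitz functions; applied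
   to what remains of [F] after integrating an approximation of [F'], it gains
   a factor [N^(-1/2)] per derivative. *)
Lemma smooth_poly_approx (T : Type) S (F : T -> R -> R) :
  smooth S [set x | 0 <= x <= 1] F ->
  exists2 C : R, 0 <= C & forall i N, (0 < N)%N -> exists2 P : R -> R,
    poly_bound (N + S) (C * 3 ^+ N) P &
    forall x, 0 <= x <= 1 -> `|F i x - P x| <= C / Num.sqrt N%:R ^+ S.
Proof.
elim: S F => [|S IH] F sF.
  have [K K0 FK] := smooth_bounded sF; exists K => // i N N0; exists (fun=> 0).
    apply: (poly_bound_le (leqnn _) _ (poly_bound_cst (N + 0) 0)).
    by rewrite normr0 mulr_ge0// exprn_ge0.
  by move=> x x01; rewrite subr0 expr0 divr1 FK.
have [K K0 FK] := smooth_bounded sF.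
case: sF => _ [F' [dF /IH[C C0 hC]]].
(* The samples of [G = F - Q] are bounded by [K + C]; the other [C] pays for the coefficients of
   [Q]. *)
exists (K + 2 * C); first by rewrite addr_ge0// mulr_ge0.
move=> i N N0; have [P' P'b P'a] := hC i N N0.
have [Q [Qb Q0 dQ]] := poly_bound_antideriv P'b.
set s := Num.sqrt N%:R in P'a *.
have s1 : 1 <= s by rewrite -sqrtr1 ler_wsqrtr// ler1n.
have s0 : 0 < s by rewrite (lt_le_trans _ s1).
(* [E] bounds [F' - P'], which is the derivative of [G]; hence it is a Lipschitz constant of [G]. *)
pose E := C / s ^+ S; pose G x := F i x - Q x.
have E0 : 0 <= E by rewrite divr_ge0// exprn_ge0// ltW.
have EC : E <= C by rewrite ler_pdivrMr ?exprn_gt0// ler_peMr// exprn_ege1.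
have dG (x : R) : 0 <= x <= 1 -> is_derive x (1 : R) G (F' i x - P' x).
  by move=> x01; apply: is_deriveB; exact: dF.
have lipG y z : y <= z -> 0 <= y <= 1 -> 0 <= z <= 1 -> `|G z - G y| <= E * `|z - y|.
  move=> yz /andP[y0 y1] /andP[z0 z1].
  have dGyz x : x \in `]y, z[ -> is_derive x (1 : R) G (F' i x - P' x).
    rewrite in_itv/= => /andP[yx xz]; apply: dG.
    by rewrite (le_trans y0 (ltW yx)) (le_trans (ltW xz)).
  have cG : {within `[y, z], continuous G}.
    apply: derivable_within_continuous => x; rewrite in_itv/= => /andP[yx xz].
    by apply: ex_derive; apply: dG; rewrite (le_trans y0)// (le_trans xz).
  have [c cyz ->] := MVT_segment yz dGyz cG.
  rewrite normrM ler_wpM2r// /E P'a//.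
  by move: cyz; rewrite in_itv/= => /andP[yc cz]; rewrite (le_trans y0)// (le_trans cz).
have lipG' y z : 0 <= y <= 1 -> 0 <= z <= 1 -> `|G y - G z| <= E * `|y - z|.
  move=> y01 z01; have [yz|zy] := leP y z; last by apply: lipG => //; exact: ltW.
  by rewrite distrC [`|y - z|]distrC; exact: lipG.
have GK k : `|G (Num.min (k%:R / N%:R) 1)| <= K + C.
  set w := Num.min _ _.
  have w01 : 0 <= w <= 1.
    exact: min01.
  have -> : G w = G 0 + (G w - G 0) by ring.
  rewrite (le_trans (ler_normD _ _))// lerD//.
    by rewrite /G Q0 subr0 FK//= lexx ler01.
  apply: (le_trans (lipG' _ _ w01 _)); first by rewrite lexx ler01.
  case/andP: w01 => w0 w1.
  by rewrite subr0 ger0_norm// -[leRHS]mulr1 ler_pM.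
exists (fun x => Q x + binomial_mean x N (fun k => G (Num.min (k%:R / N%:R) 1))).
  have h1 : poly_bound (N + S.+1) (C * 3 ^+ N) Q by rewrite addnS.
  have h2 := poly_bound_le (leq_addr S.+1 N) (lexx _) (poly_bound_binomial_mean N GK).
  apply: (poly_bound_le (leqnn _) _ (poly_boundD h1 h2)).
  by rewrite le_eqVlt; apply/orP; left; apply/eqP; ring.
move=> x x01; have -> a : F i x - (Q x + a) = - (a - G x) by rewrite /G; ring.
rewrite normrN (le_trans (binomial_mean_approx N0 E0 lipG' x01))// -/s /E.
rewrite exprSr invfM mulrA ler_wpM2r ?invr_ge0 ?(ltW s0)// ler_wpM2r ?invr_ge0 ?exprn_ge0 ?(ltW s0)//.
lra.
Qed.
End bernstein.

(** * Heat sums and localized kernels *)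

Section heat_sums.
Context (R : realType) (X : ptopologicalType) (rho : X -> X -> R)
  (mu : probability (borelType X) R) (lam : nat -> R) (phi : nat -> X -> R)
  (q k1 k2 k3 k4 : R).
Hypothesis dds : data_defined_space rho mu lam phi q k1 k2 k3 k4.

(** On the diagonal the terms are nonnegative, so partial sums stay below the kernel, whose Gaussian
    factor is 1. *)
Lemma heat_diag_le (t : R) (x : X) (M : nat) : 0 < t <= 1 ->
  \sum_(k < M) expR (- (lam k ^+ 2 * t)) * phi k x ^+ 2 <= k3 * t `^ (- (q / 2)).
Proof.
move=> t01; have cK := dds_kernel_cvg dds (x := x) (y := x) t01.
have := dds_kernel_bound dds x x t01.
rewrite (proj2 (dds_rho_eq0 dds x x) erefl) expr0n/= mulr0 mul0r oppr0 expR0 mulr1.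
apply: le_trans; apply: le_trans (ler_norm _).
have nd : nondecreasing_seq
    (series (fun k => expR (- (lam k ^+ 2 * t)) * phi k x * phi k x)).
  apply: nondecreasing_series => k _ _.
  by rewrite -mulrA mulr_ge0 ?expR_ge0// -expr2 sqr_ge0.
apply: le_trans (nondecreasing_cvgn_le nd cK M).
by rewrite /series/= big_mkord; apply: ler_sum => k _; rewrite expr2 mulrA.
Qed.

Lemma heat_abs_le (t : R) (x y : X) (M : nat) : 0 < t <= 1 ->
  \sum_(k < M) expR (- (lam k ^+ 2 * t)) * `|phi k x * phi k y|
    <= k3 * t `^ (- (q / 2)).
Proof.
move=> t01; have hx := heat_diag_le x M t01; have hy := heat_diag_le y M t01.
apply: (@le_trans _ _ (2^-1 * (\sum_(k < M) expR (- (lam k ^+ 2 * t)) * phi k x ^+ 2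
    + \sum_(k < M) expR (- (lam k ^+ 2 * t)) * phi k y ^+ 2))); last by lra.
rewrite -big_split/= mulr_sumr; apply: ler_sum => k _.
rewrite -mulrDr mulrCA ler_wpM2l ?expR_ge0// normrM.
rewrite -(real_normK (num_real (phi k x))) -(real_normK (num_real (phi k y))).
have := sqr_ge0 (`|phi k x| - `|phi k y|); set a := `|_|; set b := `|_|; nra.
Qed.

(** The extra factor [expR (- (lam k ^+ 2 * t))] raises every exponent of [P] by one, so each
    monomial becomes a heat kernel at a positive time [e.+1%:R * t]. *)
Lemma heat_poly_cvg (t : R) (x y : X) d (C B : R) (P : R -> R) :
  0 < t -> d.+1%:R * t <= 1 -> poly_bound d C P ->
  (forall e, (e <= d)%N -> `|heat_kernel lam phi (e.+1%:R * t) x y| <= B) ->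
  exists2 l : R, (fun M => \sum_(k < M) expR (- (lam k ^+ 2 * t)) *
      P (expR (- (lam k ^+ 2 * t))) * (phi k x * phi k y)) @ \oo --> l &
    `|l| <= C * B.
Proof.
move=> t0 dt [s [sd sC PE]] KB.
have B0 : 0 <= B by exact: le_trans (KB 0%N _).
suff [l hl lB] : exists2 l : R, (fun M => \sum_(k < M) expR (- (lam k ^+ 2 * t)) *
      P (expR (- (lam k ^+ 2 * t))) * (phi k x * phi k y)) @ \oo --> l &
    `|l| <= (\sum_(t <- s) `|t.1|) * B.
  by exists l => //; rewrite (le_trans lB)// ler_wpM2r.
have -> : (fun M => \sum_(k < M) expR (- (lam k ^+ 2 * t)) *
      P (expR (- (lam k ^+ 2 * t))) * (phi k x * phi k y)) =
   (fun M => \sum_(e <- s) e.1 * series (fun k =>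
      expR (- (lam k ^+ 2 * (e.2.+1%:R * t))) * phi k x * phi k y) M).
  apply/funext => M; under [RHS]eq_bigr do rewrite /series/= big_mkord mulr_sumr.
  rewrite exchange_big/=; apply: eq_bigr => k _.
  rewrite PE mulr_sumr mulr_suml; apply: eq_bigr => e _.
  have -> : expR (- (lam k ^+ 2 * (e.2.+1%:R * t))) =
      expR (- (lam k ^+ 2 * t)) * expR (- (lam k ^+ 2 * t)) ^+ e.2.
    rewrite -expRM_natl -expRD -natr1; congr expR; ring.
  ring.
elim: s sd {PE sC} => [|e s IH] /=.
  move=> _; exists 0; last by rewrite big_nil mul0r normr0.
  by under eq_fun do rewrite big_nil; exact: cvg_cst.
move=> /andP[ed /IH[l hl lB]].
exists (e.1 * heat_kernel lam phi (e.2.+1%:R * t) x y + l).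
  under eq_fun do rewrite big_cons; apply: cvgD => //; apply: cvgMr.
  apply: (dds_kernel_cvg dds); rewrite mulr_gt0 ?ltr0n//=.
  by rewrite (le_trans _ dt)// ler_wpM2r ?(ltW t0)// ler_nat.
rewrite big_cons mulrDl (le_trans (ler_normD _ _))// lerD// normrM.
by rewrite ler_wpM2l// KB.
Qed.

(** The multiplier splits as [u P(u)] plus an error of size [E u]. The error is summed absolutely by
    [heat_abs_le], with no use of cancellation; the polynomial part keeps the decay of the heat
    kernels through [B]. *)
Lemma heat_multiplier_le (t : R) (x y : X) d M (C B E : R) (F P : R -> R) :
  0 < t -> d.+1%:R * t <= 1 -> poly_bound d C P ->
  (forall e, (e <= d)%N -> `|heat_kernel lam phi (e.+1%:R * t) x y| <= B) ->
  (forall u, 0 < u <= 1 -> `|F u - u * P u| <= E * u) ->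
  (forall k, (M <= k)%N -> F (expR (- (lam k ^+ 2 * t))) = 0) ->
  `|\sum_(k < M) F (expR (- (lam k ^+ 2 * t))) * (phi k x * phi k y)| <=
    E * (k3 * t `^ (- (q / 2))) + C * B.
Proof.
move=> t0 dt Pb KB FP F0.
have [l hl lB] := heat_poly_cvg t0 dt Pb KB.
have t01 : 0 < t <= 1.
  by rewrite t0 (le_trans _ dt)// ler_peMl ?(ltW t0)// ler1n.
have E0 : 0 <= E by have := FP 1; rewrite ltr01 lexx mulr1 => /(_ isT); exact: le_trans.
apply: le_trans (lerD (lexx _) lB).
rewrite -lerBlDl.
set S := `|_|; set Q := (fun _ : nat => _) in hl.
have : `|Q M'| @[M' --> \oo] --> `|l| by exact: cvg_norm.
move=> cQ; rewrite -(cvg_lim _ cQ)//; apply: limr_ge; first by apply/cvg_ex; exists `|l|.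
exists M => // M' /= MM'.
(* The finite sum may be lengthened to any [M'] since [F] vanishes there, which allows the limit in
   the infinite polynomial part. *)
have SE : S = `|\sum_(k < M') F (expR (- (lam k ^+ 2 * t))) * (phi k x * phi k y)|.
  rewrite /S -!(big_mkord xpredT (fun k => F (expR (- (lam k ^+ 2 * t))) * (phi k x * phi k y))).
  rewrite [in RHS](big_cat_nat (leq0n M) MM')//=; congr `|_|.
  rewrite [X in _ = _ + X]big_nat_cond [X in _ = _ + X]big1 ?addr0// => k /andP[/andP[Mk _] _].
  by rewrite F0 ?mul0r.
rewrite SE lerBlDl.
have -> : \sum_(k < M') F (expR (- (lam k ^+ 2 * t))) * (phi k x * phi k y) =
    \sum_(k < M') (F (expR (- (lam k ^+ 2 * t))) - expR (- (lam k ^+ 2 * t)) *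
      P (expR (- (lam k ^+ 2 * t)))) * (phi k x * phi k y) + Q M'.
  by rewrite /Q -big_split/=; apply: eq_bigr => k _; ring.
rewrite (le_trans (ler_normD _ _))// lerD2r.
apply: le_trans (ler_wpM2l E0 (heat_abs_le x y M' t01)).
rewrite (le_trans (ler_norm_sum _ _ _))// mulr_sumr; apply: ler_sum => k _.
rewrite normrM mulrA ler_wpM2r// FP// expR_gt0/= -[leRHS]expR0 ler_expR oppr_le0.
by rewrite mulr_ge0 ?sqr_ge0// ltW.
Qed.

End heat_sums.

Section kernel_decay.
Context (R : realType).

Definition mult_kernel (X : Type) (lam : nat -> R) (phi : nat -> X -> R)
    (F : R -> R) (m : R) (M : nat) (x y : X) : R :=
  \sum_(k < M) F (expR (- (lam k ^+ 2 * m ^- 2))) * (phi k x * phi k y).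

Lemma exprn_le_expR (x : R) s : 0 <= x -> x ^+ s <= s.+1%:R ^+ s * expR x.
Proof.
move=> x0; have s0 : (0 : R) < s.+1%:R by rewrite ltr0n.
have -> : x = s.+1%:R * (x / s.+1%:R) by field; rewrite gt_eqF.
set y := x / _; have y0 : 0 <= y by rewrite divr_ge0// ltW.
rewrite exprMn ler_wpM2l ?exprn_ge0 ?(ltW s0)// expRM_natl exprSr.
have yE : y <= expR y by rewrite (le_trans _ (expR_ge1Dx y))// lerDr.
rewrite (@le_trans _ _ (expR y ^+ s))//; first by rewrite lerXn2r// nnegrE// expR_ge0.
by rewrite ler_peMr ?exprn_ge0 ?expR_ge0// -expR0 ler_expR.
Qed.

Lemma expr2n_large (a : R) : exists i : nat, a <= 2 ^+ i.
Proof.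
have [n an] : exists n : nat, a <= n%:R.
  exists (Num.bound `|a|); rewrite (le_trans (ler_norm a))// ltW//.
  by rewrite archi_boundP.
exists n; rewrite (le_trans an)// -natrX ler_nat ltnW//.
exact: ltn_expl.
Qed.

(** The constant is chosen before the space and the system, so it depends on them only through [q],
    [k3], [k4] and the diameter bound [D]; it is also uniform in the family index. *)
Lemma kernel_decay (T : Type) (F : T -> R -> R) (s : nat) (D q k3 k4 : R) :
  0 <= D -> 0 < k3 -> 0 < k4 ->
  smooth (s + s) `]-1, 2[ F -> (forall i u, u <= expR (-1) -> F i u = 0) ->
  exists2 c : R, 0 < c &
  forall (X : ptopologicalType) (rho : X -> X -> R)
  (mu : probability (borelType X) R) (lam : nat -> R) (phi : nat -> X -> R)
  (k1 k2 : R), data_defined_space rho mu lam phi q k1 k2 k3 k4 ->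
  (forall x y, rho x y <= D) ->
  forall i (m : R) M x y, 1 <= m -> (forall k, (M <= k)%N -> m <= lam k) ->
  `|mult_kernel lam phi (F i) m M x y| <= c * m `^ q /\
  forall j : nat, 2 ^+ j < m * rho x y ->
    `|mult_kernel lam phi (F i) m M x y| <= c * m `^ q * 2 ^- (j * s).
Proof.
move=> D0 k30 k40 sF F0.
pose a : R := expR (-1).
have a0 : 0 < a by exact: expR_gt0.
have a1 : a < 1 by rewrite -expR0 ltr_expR ltrN10.
(* [G = F / u] is what gets approximated, so that the approximant of [F] is [u P(u)] and has no
   constant term. The division is harmless because [F] vanishes below [a]. *)
pose G i (u : R) := F i u * u `^ (-1).
have sG : smooth (s + s) `]-1, 2[ G.
  apply: (@smooth_supp _ _ _ _ [set x | a <= x <= 2] `[a, 2]).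
  - exact: interval_open.
  - exact: interval_closed.
  - by move=> x; rewrite /= in_itv.
  - move=> i x; rewrite /= !in_itv/= => /andP[_ x2] nax; apply: F0.
    by rewrite leNgt; apply/negP => ax; apply: nax; rewrite !ltW.
  - exact: smooth_powR.
  - exact: sF.
have FG i u : 0 <= u -> F i u = u * G i u.
  rewrite le_eqVlt => /predU1P[<-|u0].
    by rewrite mul0r F0// ltW.
  by rewrite /G powR_inv1 ?(ltW u0)// mulrCA mulfV ?mulr1// gt_eqF.
have sG01 : smooth (s + s) [set x | 0 <= x <= 1] G.
  apply: smooth_sub sG => x /= /andP[x0 x1]; rewrite in_itv/=; lra.
have [K K0 GK] := smooth_bounded sG01.
have [C C0 hC] := smooth_poly_approx sG01.
(* The degree will be [2 ^ (j - i0)] up to an additive constant. The first summand makes all heat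
   times at most 1, the second makes the Gaussian beat the coefficients [3 ^ N]. *)
have [i0 hi0] := expr2n_large (D * (s + s).+2%:R + 3 * (s + s).+2%:R / k4 + 1).
set w : R := (s + s).+2%:R in hi0.
have w1 : 1 <= w by rewrite ler1n.
have i0D : D * w <= 2 ^+ i0.
  by apply: le_trans hi0; rewrite -addrA lerDl addr_ge0// divr_ge0// ?(ltW k40)// mulr_ge0.
have i0k : 3 * w / k4 <= 2 ^+ i0.
  by apply: le_trans hi0; rewrite addrAC lerDr addr_ge0// mulr_ge0// (le_trans _ w1).
(* The factor [2 ^+ (i0 * s)] covers the indices [j < i0], where only the trivial bound is used, and
   converts powers of [N] into powers of [2 ^ j]. *)
pose c := k3 * (K + C + C * s.+1%:R ^+ s) * 2 ^+ (i0 * s) + 1.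
have c00 : 0 <= k3 * (K + C + C * s.+1%:R ^+ s) * 2 ^+ (i0 * s).
  by rewrite mulr_ge0 ?exprn_ge0// mulr_ge0 ?(ltW k30)// !addr_ge0// mulr_ge0// exprn_ge0.
have c0 : 0 < c by rewrite /c ltr_wpDl.
exists c => // X rho mu lam phi k1 k2 dds rhoD i m M x y m1 Mlam.
have m0 : 0 < m by exact: lt_le_trans m1.
have mt : 0 < m ^- 2 <= 1.
  by rewrite invr_gt0 exprn_gt0//= invf_le1 ?exprn_gt0// exprn_ege1.
have mq : (m ^- 2) `^ (- (q / 2)) = m `^ q.
  rewrite -powR_mulrn ?(ltW m0)// -powRN -powRrM; congr (_ `^ _); lra.
have F0k k : (M <= k)%N -> F i (expR (- (lam k ^+ 2 * m ^- 2))) = 0.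
  move=> /Mlam mk; apply: F0; rewrite ler_expR lerN2.
  rewrite -[1](@mulfV _ (m ^+ 2)) ?gt_eqF ?exprn_gt0//.
  by rewrite ler_wpM2r ?invr_ge0 ?exprn_ge0 ?(ltW m0)// lerXn2r ?nnegrE ?(ltW m0)// (le_trans _ mk) ?ltW.
have mq0 : 0 < m `^ q by rewrite powR_gt0.
(* Approximation by the zero polynomial: [F u] is at most [K u]. *)
have triv : `|mult_kernel lam phi (F i) m M x y| <= K * (k3 * m `^ q).
  have := @heat_multiplier_le _ _ _ _ _ _ _ _ _ _ _ dds (m ^- 2) x y 0 M 0
    (`|heat_kernel lam phi (1 * m ^- 2) x y|) K (F i) (fun=> 0).
  rewrite mq mul0r addr0; apply.
  - by case/andP: mt.
  - by rewrite mul1r; case/andP: mt.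
  - by have := poly_bound_cst 0 (0 : R); rewrite normr0.
  - by case.
  - move=> u /andP[u0 u1]; rewrite mulr0 subr0 (FG _ _ (ltW u0)) normrM ger0_norm ?(ltW u0)//.
    by rewrite [leRHS]mulrC ler_wpM2l ?(ltW u0)// GK//= (ltW u0).
  - exact: F0k.
have trivc : K * (k3 * m `^ q) <= c * 2 ^- (i0 * s) * m `^ q.
  rewrite mulrA ler_wpM2r ?(ltW mq0)//.
  rewrite -ler_pdivrMr ?invr_gt0 ?exprn_gt0// invrK /c (@le_trans _ _ (k3 * K * 2 ^+ (i0 * s)))//.
    by rewrite (mulrC k3).
  rewrite ler_wpDr// ler_wpM2r ?exprn_ge0// ler_wpM2l ?(ltW k30)//.
  by rewrite -addrA lerDl addr_ge0// mulr_ge0// exprn_ge0.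
split.
  apply: (le_trans triv); apply: (le_trans trivc); rewrite ler_wpM2r ?(ltW mq0)//.
  by rewrite ler_piMr ?(ltW c0)// invf_le1 ?exprn_gt0// exprn_ege1// ler1n.
move=> j jm; have [ij|ji] := leqP i0 j; last first.
  apply: (le_trans triv); apply: (le_trans trivc); rewrite mulrAC ler_wpM2l//.
    by rewrite mulr_ge0 ?ltW.
  rewrite lef_pV2 ?posrE ?exprn_gt0// ler_weXn2l ?ler1n//.
  by rewrite leq_mul2r (ltnW ji) orbT.
pose N := (2 ^ (j - i0))%N.
have N0 : (0 < N)%N by rewrite expn_gt0.
have N1 : (1 : R) <= N%:R by rewrite ler1n.
have NE : (N%:R : R) * 2 ^+ i0 = 2 ^+ j by rewrite natrX -exprD subnK.
have [P Pb Pa] := hC i N N0.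
have mrho : N%:R * 2 ^+ i0 < m * rho x y by rewrite NE.
have rho0 := dds_rho_ge0 dds x y.
(* The diameter enters here: [N 2 ^ i0 < m rho <= m D] and [D w <= 2 ^ i0]. Since [m <= m ^ 2], all
   times involved are then at most 1. *)
have mN : N%:R * w <= m.
  have D00 : 0 < D.
    rewrite lt_neqAle D0 andbT; apply: contraTneq mrho => D00.
    have := rhoD x y; rewrite -D00 => r0; rewrite -leNgt (@le_trans _ _ 0)//.
    by rewrite mulr_ge0_le0// ltW.
  rewrite -(ler_pM2r D00) -mulrA (mulrC w) (@le_trans _ _ (N%:R * 2 ^+ i0))//.
    by rewrite ler_wpM2l.
  by rewrite ltW// (lt_le_trans mrho)// ler_wpM2l// ltW.
have NSw : ((N + (s + s)).+1%:R : R) <= N%:R * w.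
  rewrite /w -natrM ler_nat; case: N N0 {N1 NE P Pb Pa mrho mN} => // n _.
  rewrite mulSn (_ : (n.+1 + (s + s)).+1 = (s + s).+2 + n)%N; last by rewrite addSn addnC.
  by rewrite leq_add2l leq_pmulr.
have Nm2 : (N + (s + s)).+1%:R * m ^- 2 <= 1.
  rewrite ler_pdivrMr ?exprn_gt0// mul1r (le_trans NSw)// (le_trans mN)//.
  by rewrite expr2 ler_peMl// ltW.
(* With [e + 1 <= N w] and [m rho > N 2 ^ i0], the Gaussian exponent [k4 (m rho) ^ 2 / (e + 1)] is
   at least [3 N]. *)
pose B := k3 * m `^ q * expR (- (3 * N%:R)).
have KB e : (e <= N + (s + s))%N -> `|heat_kernel lam phi (e.+1%:R * m ^- 2) x y| <= B.
  move=> eN.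
  have e0 : (0 : R) < e.+1%:R by rewrite ltr0n.
  have et : 0 < e.+1%:R * m ^- 2 <= 1.
    rewrite mulr_gt0//=; last by case/andP: mt.
    by rewrite (le_trans _ Nm2)// ler_wpM2r ?ler_nat//; case/andP: mt => /ltW.
  apply: (le_trans (dds_kernel_bound dds x y et)).
  apply: ler_pM; rewrite ?expR_ge0// ?mulr_ge0 ?powR_ge0 ?(ltW k30)//.
    rewrite ler_wpM2l ?(ltW k30)// -mq !powRN lef_pV2 ?posrE ?powR_gt0//; first last.
    - by case/andP: mt.
    - by case/andP: et.
    have q0 := dds_q_gt0 dds.
    have m20 : 0 <= m ^+ 2 by rewrite exprn_ge0// ltW.
    rewrite ge0_ler_powR ?nnegrE ?divr_ge0 ?invr_ge0 ?(ltW q0)//.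
    by rewrite ler_peMl ?ler1n ?invr_ge0.
  rewrite ler_expR lerN2.
  have -> : k4 * rho x y ^+ 2 / (e.+1%:R * m ^- 2) = k4 * (m * rho x y) ^+ 2 / e.+1%:R.
    by field; rewrite !gt_eqF.
  rewrite ler_pdivlMr//.
  have eNw : e.+1%:R <= N%:R * w by rewrite (le_trans _ NSw)// ler_nat ltnS.
  apply: (@le_trans _ _ (3 * N%:R * (N%:R * w))); first by rewrite ler_wpM2l// mulr_ge0.
  apply: (@le_trans _ _ (k4 * (N%:R * 2 ^+ i0) ^+ 2)); last first.
    rewrite ler_wpM2l ?(ltW k40)// lerXn2r ?nnegrE ?(ltW mrho)// ?mulr_ge0 ?exprn_ge0//.
    exact: ltW.
  rewrite exprMn (_ : 3 * _ * _ = k4 * (N%:R ^+ 2 * (3 * w / k4))); last first.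
    by field; rewrite gt_eqF.
  rewrite ler_wpM2l ?(ltW k40)// ler_wpM2l ?exprn_ge0// (le_trans i0k)//.
  by rewrite expr2 ler_peMl ?exprn_ge0// exprn_ege1// ler1n.
have Ea u : 0 < u <= 1 -> `|F i u - u * P u| <= C / N%:R ^+ s * u.
  move=> /andP[u0 u1]; rewrite (FG _ _ (ltW u0)) -mulrBr normrM ger0_norm ?(ltW u0)//.
  rewrite [leRHS]mulrC ler_wpM2l ?(ltW u0)//.
  have := Pa u; rewrite (ltW u0) u1 => /(_ isT).
  by rewrite exprD -exprMn -expr2 sqr_sqrtr// ler0n.
have mt0 : 0 < m ^- 2 by case/andP: mt.
have := heat_multiplier_le dds mt0 Nm2 Pb KB Ea F0k.
move=> /le_trans; apply; rewrite mq.
have Ns : (N%:R ^+ s)^-1 = 2 ^+ (i0 * s) * 2 ^- (j * s) :> R.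
  by rewrite !exprM -NE exprMn invfM mulrCA mulfV ?mulr1// expf_neq0// expf_neq0// pnatr_eq0.
have pow3e : 3 ^+ N * expR (- (3 * N%:R)) <= expR (- N%:R) :> R.
  have -> : - (3 * N%:R) = N%:R * (- 2) - N%:R :> R by ring.
  rewrite expRD expRM_natl mulrA ler_piMl ?expR_ge0// -exprMn exprn_ile1 ?mulr_ge0 ?expR_ge0//.
  have e2 : (2 : R) <= expR 1 by rewrite (le_trans _ (expR_ge1Dx 1))//; lra.
  have : (4 : R) <= expR 2.
    have -> : (2 : R) = 1 + 1 by lra.
    by rewrite expRD; nra.
  by rewrite expRN ler_pdivrMr ?expR_gt0//; lra.
have eN : expR (- N%:R) <= s.+1%:R ^+ s / N%:R ^+ s :> R.
  rewrite expRN ler_pdivlMr ?exprn_gt0 ?ltr0n// mulrC ler_pdivrMr ?expR_gt0//.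
  by apply: exprn_le_expR; rewrite ler0n.
apply: (@le_trans _ _ (k3 * (C + C * s.+1%:R ^+ s) / N%:R ^+ s * m `^ q)).
  have -> : C * 3 ^+ N * B = C * k3 * m `^ q * (3 ^+ N * expR (- (3 * N%:R))).
    by rewrite /B; move: (3 ^+ N) (expR _) => u v; ring.
  have -> : k3 * (C + C * s.+1%:R ^+ s) / N%:R ^+ s * m `^ q =
      C / N%:R ^+ s * (k3 * m `^ q) + C * k3 * m `^ q * (s.+1%:R ^+ s / N%:R ^+ s).
    by move: (s.+1%:R ^+ s) (N%:R ^- s) => u v; ring.
  rewrite lerD2l ler_wpM2l ?mulr_ge0 ?(ltW k30) ?(ltW mq0)//.
  exact: le_trans eN.
rewrite Ns mulrA [leRHS]mulrAC ler_wpM2r ?(ltW mq0)// ler_wpM2r ?invr_ge0 ?exprn_ge0//.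
rewrite /c ler_wpDr// ler_wpM2r ?exprn_ge0// ler_wpM2l ?(ltW k30)//.
by rewrite -addrA ler_wpDl.
Qed.

End kernel_decay.

(** * Measures of balls *)

Section borel.
Context (R : realType) (X : ptopologicalType).
Local Notation B := (borelType X).

Lemma open_borel (U : set X) : open U -> measurable (U : set B).
Proof. by move=> oU; exact: sub_gen_smallest. Qed.

Lemma continuous_borel (f : X -> R) : continuous f -> measurable_fun setT (f : B -> R).
Proof.
move=> /continuousP cf; apply: (measurability _ (RGenOpens.measurableE R)).
move=> _ [_ [a [b ->] <-]]; rewrite setTI; apply: open_borel.
exact/cf/interval_open.
Qed.

Lemma bounded_integrable (tau : {finite_measure set B -> \bar R}) (f : B -> R) (M : R) :
  measurable_fun setT f -> (forall x, `|f x| <= M) ->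
  tau.-integrable setT (EFin \o f).
Proof.
move=> mf fM; apply: measurable_bounded_integrable => //.
  by rewrite ltey_eq fin_num_measure.
exists M; split; first exact: num_real.
by move=> N MN x _ /=; rewrite (le_trans (fM x))// ltW.
Qed.

Lemma integral_le_cst (tau : {measure set B -> \bar R}) (E : set B) (f : B -> R) (a : R) :
  measurable E -> measurable_fun E f ->
  (forall x, E x -> 0 <= f x <= a) ->
  (\int[tau]_(x in E) (f x)%:E <= a%:E * tau E)%E.
Proof.
move=> mE mf fa; rewrite -integral_cst//; apply: ge0_le_integral => //.
- by move=> x /fa /andP[]; rewrite lee_fin.
- exact/measurable_EFinP.
- by move=> x /fa /andP[]; rewrite lee_fin.
Qed.

End borel.

Section geometry.
Context (R : realType) (X : ptopologicalType) (rho : X -> X -> R)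
  (mu : probability (borelType X) R) (lam : nat -> R) (phi : nat -> X -> R)
  (q k1 k2 k3 k4 : R).
Hypothesis dds : data_defined_space rho mu lam phi q k1 k2 k3 k4.
Local Notation B := (borelType X).
Local Notation ball := (qball rho).

(** A closed ball is a countable intersection of open balls; those of nonpositive radius are empty
    and must be treated apart, since the basis contains only positive radii. *)
Lemma measurable_qball (x : X) (r : R) : measurable (ball x r : set B).
Proof.
have -> : ball x r = \bigcap_n qball_open rho x (r + n.+1%:R^-1).
  apply/seteqP; split=> y /=.
    by move=> yr n _; rewrite /qball_open/= (le_lt_trans yr)// ltrDl invr_gt0.
  move=> yr; apply/ler_addgt0Pr => e e0.
  have [n ne] := ltr_add_invr e0.
  by rewrite ltW// (lt_trans (yr n I))// ltrD2l; rewrite add0r in ne.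
apply: bigcapT_measurable => n.
have [r0|r0] := ltP 0 (r + n.+1%:R^-1).
  by apply: open_borel; apply: (proj1 (dds_basis dds)); exists x, (r + n.+1%:R^-1).
rewrite (_ : qball_open _ _ _ = set0); first exact: measurable0.
apply/seteqP; split=> y //=; rewrite /qball_open/= => h.
by have := dds_rho_ge0 dds x y; rewrite leNgt (lt_le_trans h).
Qed.

Lemma measurable_phi k : measurable_fun setT (phi k : B -> R).
Proof. by apply: continuous_borel; exact: (dds_phi_continuous dds). Qed.

(** Decomposition into dyadic annuli about [y]: the central ball of radius [1 / m] contributes at
    most [a b], and since [s >= q + 1] the annulus of index [j] contributes at most
    [a b 2 ^ q 2 ^ (- j)]. *)
Lemma integral_decay (tau : {finite_measure set B -> \bar R}) (k : B -> R)
    (y : X) (m a b : R) (s : nat) :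
  0 < m -> 0 <= a -> 0 <= b -> q + 1 <= s%:R ->
  measurable_fun setT k ->
  (forall j, (tau (ball y (2 ^+ j / m)) <= (b * (2 ^+ j) `^ q)%:E)%E) ->
  (forall x, 0 <= k x <= a) ->
  (forall x j, 2 ^+ j < m * rho y x -> k x <= a * 2 ^- (j * s)) ->
  (\int[tau]_x (k x)%:E <= (a * b * (1 + 2 * 2 `^ q))%:E)%E.
Proof.
move=> m0 a0 b0 qs mk tauB ka kdec.
have q0 := dds_q_gt0 dds.
pose E j : set B := ball y (2 ^+ j / m).
have mE j : measurable (E j) by exact: measurable_qball.
have nE j x : ~ E j x -> 2 ^+ j < m * rho y x.
  rewrite /E/= /qball/= => /negP; rewrite -ltNge ltr_pdivrMr//.
  by rewrite mulrC.
have EE j : E j `<=` E j.+1.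
  move=> x; rewrite /E/= /qball/= => /le_trans; apply.
  by rewrite ler_wpM2r ?invr_ge0 ?(ltW m0)// ler_weXn2l// ler1n.
have k0 D : forall x, D x -> (0 <= (k x)%:E)%E by move=> x _; rewrite lee_fin; case/andP: (ka x).
have mkE D : measurable D -> measurable_fun (D : set B) (EFin \o k).
  by move=> mD; apply/measurable_EFinP; exact: measurable_funTS.
have dec j : 2 ^- (j * s) * (2 ^+ j.+1) `^ q <= 2 `^ q * 2 ^- j :> R.
  have p2 n : (2 : R) ^+ n = 2 `^ n%:R by rewrite powR_mulrn.
  rewrite !p2 -!powRN -!powRrM -!powRD; try by rewrite pnatr_eq0 implybT.
  rewrite ler_powR ?ler1n// natrM -natr1.
  have : 0 <= (j%:R : R) by []. 
  nra.
have step J : (\int[tau]_(x in E J) (k x)%:E <=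
    (a * b * (1 + 2 `^ q * (2 - 2 * 2 ^- J)))%:E)%E.
  elim: J => [|J IH].
    rewrite expr0 invr1 mulr1 subrr mulr0 addr0 mulr1.
    apply: (le_trans (integral_le_cst _ (mE 0%N) _ (fun x _ => ka x))).
      by apply: measurable_funTS.
    rewrite EFinM lee_wpmul2l ?lee_fin//.
    by have := tauB 0%N; rewrite expr0 powR1 mulr1.
  have -> : E J.+1 = E J `|` (E J.+1 `\` E J) by rewrite setDUK.
  have mD : measurable (E J.+1 `\` E J) by exact: measurableD.
  rewrite (ge0_integral_setU tau (mE J) mD (mkE _ (measurableU _ _ (mE J) mD)) (k0 _)); last first.
    by apply/disj_setPS => x [] ? [].
  have h : (\int[tau]_(x in E J.+1 `\` E J) (k x)%:E <= (a * b * (2 `^ q * 2 ^- J))%:E)%E.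
    apply: (@le_trans _ _ ((a * 2 ^- (J * s))%:E * tau (E J.+1 `\` E J))%E).
      apply: integral_le_cst => //; first exact: measurable_funTS.
      move=> x [_ /nE nx]; rewrite kdec// andbT; by case/andP: (ka x).
    apply: (@le_trans _ _ ((a * 2 ^- (J * s))%:E * (b * (2 ^+ J.+1) `^ q)%:E)%E).
      rewrite lee_wpmul2l ?lee_fin ?mulr_ge0 ?invr_ge0 ?exprn_ge0//.
      apply: le_trans (tauB J.+1).
      by apply: le_measure; [rewrite inE|rewrite inE; exact: mE|exact: subDsetl].
    rewrite -EFinM lee_fin.
    rewrite [leLHS](_ : _ = a * b * (2 ^- (J * s) * (2 ^+ J.+1) `^ q)); last by ring.
    by rewrite ler_wpM2l ?mulr_ge0.
  apply: (le_trans (leeD IH h)); rewrite -EFinD lee_fin -mulrDr.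
  rewrite ler_wpM2l ?mulr_ge0// -addrA lerD2l -mulrDr ler_wpM2l ?powR_ge0//.
  rewrite exprS invfM; lra.
apply/lee_addgt0Pr => e e0.
have tauT : (tau setT < +oo)%E by rewrite ltey_eq fin_num_measure.
(* Outside the ball of index [J] the integrand is at most [a 2 ^ (- J)], which the finite total mass
   makes smaller than [e]. *)
have [J hJ] := expr2n_large (a * fine (tau setT) / e).
have J2 : 0 < (2 : R) ^- J by rewrite invr_gt0 exprn_gt0.
have -> : [set: B] = E J `|` ~` E J by rewrite setUv.
have mEC : measurable (~` E J) by exact: measurableC.
rewrite (ge0_integral_setU tau (mE J) mEC (mkE _ (measurableU _ _ (mE J) mEC)) (k0 _)); last first.
  by apply/disj_setPS => x [].
apply: leeD.
  apply: (le_trans (step J)); rewrite lee_fin ler_wpM2l ?mulr_ge0// lerD2l [leRHS]mulrC.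
  rewrite ler_wpM2l ?powR_ge0//; lra.
apply: (@le_trans _ _ ((a * 2 ^- J)%:E * tau (~` E J))%E).
  apply: integral_le_cst => //; first exact: measurable_funTS.
  move=> x /nE nx; case/andP: (ka x) => -> _ /=; rewrite (le_trans (kdec _ _ nx))//.
  rewrite ler_wpM2l// lef_pV2 ?posrE ?exprn_gt0// ler_weXn2l ?ler1n//.
  rewrite leq_pmulr// -(ltr0n R); lra.
apply: (@le_trans _ _ ((a * 2 ^- J)%:E * tau setT)%E).
  by rewrite lee_wpmul2l ?lee_fin ?mulr_ge0 ?(ltW J2)// le_measure ?inE//.
rewrite -(@fineK _ (tau setT)) ?fin_num_measure// -EFinM lee_fin.
by rewrite mulrAC ler_pdivrMr ?exprn_gt0// -ler_pdivrMl// mulrC.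
Qed.

End geometry.

Section heat_mass.
Context (R : realType) (X : ptopologicalType) (rho : X -> X -> R)
  (mu : probability (borelType X) R) (lam : nat -> R) (phi : nat -> X -> R)
  (q k1 k2 k3 k4 : R).
Hypothesis dds : data_defined_space rho mu lam phi q k1 k2 k3 k4.
Local Notation B := (borelType X).

Lemma phi_integrable k : mu.-integrable setT (EFin \o (phi k : B -> R)).
Proof. exact: (dds_phi_integrable dds k). Qed.

Lemma heat_partial_measurable (t : R) (x : X) n : measurable_fun setT
  (fun y : B => series (fun k => expR (- (lam k ^+ 2 * t)) * phi k x * phi k y) n).
Proof.
apply: measurable_sum => k; apply: measurable_funM => //.
exact: (measurable_phi dds).
Qed.

Lemma heat_measurable (t : R) (x : X) : 0 < t <= 1 ->
  measurable_fun setT (fun y : B => heat_kernel lam phi t x y).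
Proof.
move=> t01; apply: (measurable_fun_cvg (heat_partial_measurable t x)).
by move=> y _; exact: (dds_kernel_cvg dds (x := x) (y := y) t01).
Qed.

(** Only the term [k = 0] survives integration, because [phi 0] is 1, [lam 0] is 0 and the other
    [phi k] are orthogonal to 1. The absolute bound [heat_abs_le] gives a constant dominating
    function. *)
Lemma integral_heat (t : R) (x : X) : 0 < t <= 1 ->
  (\int[mu]_y (heat_kernel lam phi t x y)%:E = 1)%E.
Proof.
move=> t01.
pose S n (y : B) := series (fun k => expR (- (lam k ^+ 2 * t)) * phi k x * phi k y) n.
pose b : R := k3 * t `^ (- (q / 2)).
have mS n : measurable_fun setT (EFin \o S n).
  apply/measurable_EFinP; exact: heat_partial_measurable.
have SK y : [set: B] y -> (EFin \o S n) y @[n --> \oo] --> (heat_kernel lam phi t x y)%:E.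
  move=> _; apply: cvg_EFin; first exact: nearW.
  exact: (dds_kernel_cvg dds (x := x) (y := y) t01).
have Sb n y : [set: B] y -> (`|(EFin \o S n) y| <= (b%:E))%E.
  move=> _; rewrite /= lee_fin; apply: le_trans (heat_abs_le dds x y n t01).
  rewrite /S /series/= big_mkord (le_trans (ler_norm_sum _ _ _))//.
  by apply: ler_sum => k _; rewrite -mulrA normrM ger0_norm ?expR_ge0.
have int_b : mu.-integrable setT (cst (b%:E)).
  exact: finite_measure_integrable_cst.
have := dominated_cvg measurableT mS SK _ int_b Sb.
move=> /(_ (fun _ _ => isT)) cv.
have Sint n : (\int[mu]_y (EFin \o S n.+1) y = 1)%E.
  rewrite (eq_integral (fun y : B => (\sum_(0 <= k < n.+1) ((expR (- (lam k ^+ 2 * t)) * phi k x) *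
    phi k y)%:E)%E)); last by move=> y _; rewrite /= /S /series/= sumEFin.
  rewrite integral_sum//; last first.
    move=> k; under eq_fun do rewrite EFinM.
    exact/integrableZl/phi_integrable.
  have phiE k : (\int[mu]_y (phi k y)%:E)%E = ((0%N == k)%:R)%:E.
    rewrite -(dds_phi_orthonormal dds 0%N k) /Rintegral fineK.
      by apply: eq_integral => y _; rewrite (dds_phi0 dds) mul1r.
    under eq_integral do rewrite (dds_phi0 dds) mul1r.
    exact: integrable_fin_num (phi_integrable k).
  have termE k : (\int[mu]_y ((expR (- (lam k ^+ 2 * t)) * phi k x) * phi k y)%:E =
     (expR (- (lam k ^+ 2 * t)) * phi k x * (0%N == k)%:R)%:E)%E.
    under eq_integral do rewrite EFinM.
    rewrite integralZl//; last exact: phi_integrable.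
    by rewrite phiE EFinM.
  under eq_bigr do rewrite termE.
  rewrite big_nat_recl//= big1_seq ?adde0.
    by rewrite (dds_lam0 dds) expr0n/= mul0r oppr0 expR0 (dds_phi0 dds) !mulr1.
  by move=> k _; rewrite mulr0.
have cv1 : (\int[mu]_y (EFin \o S n) y)%E @[n --> \oo] --> 1%E.
  rewrite -(cvg_shiftS _).
  rewrite (_ : [sequence _]_n = cst 1%E); first exact: cvg_cst.
  by apply/funext => n; exact: Sint.
exact: (cvg_unique (@ereal_hausdorff R) cv cv1).
Qed.

End heat_mass.

Section ball_lower_bound.
Context (R : realType).

Lemma gaussian_le (k4 z : R) s : 0 < k4 -> 1 <= z ->
  expR (- (k4 * z ^+ 2)) <= s.+1%:R ^+ s / k4 ^+ s * z ^- s.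
Proof.
move=> k40 z1; have z0 : 0 < z by exact: lt_le_trans z1.
have h := exprn_le_expR s (mulr_ge0 (ltW k40) (ltW z0)).
rewrite expRN -mulrA -invfM ler_pdivlMr ?mulr_gt0 ?exprn_gt0//.
rewrite mulrC ler_pdivrMr ?expR_gt0// -exprMn (le_trans h)//.
by rewrite ler_wpM2l ?exprn_ge0// ler_expR ler_wpM2l ?(ltW k40)// expr2 ler_peMl// ltW.
Qed.

(** The kernel at time [m ^ (-2)], with [m = 2 ^ J / r], has absolute mass at least 1. For [J] large
    at most half of it lies outside the ball, and inside the kernel is at most [k3 m ^ q], so the
    ball cannot be too small. The restriction [r <= 1] keeps the time admissible. *)
Lemma qball_measure_ge (q k2 k3 k4 : R) : 0 < k2 -> 0 < k3 -> 0 < k4 ->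
  exists2 c : R, 0 < c &
  forall (X : ptopologicalType) (rho : X -> X -> R)
  (mu : probability (borelType X) R) (lam : nat -> R) (phi : nat -> X -> R)
  (k1 : R), data_defined_space rho mu lam phi q k1 k2 k3 k4 ->
  forall x r, 0 < r <= 1 -> ((c * r `^ q)%:E <= mu (qball rho x r))%E.
Proof.
move=> k20 k30 k40.
have [s qs] : exists s : nat, q + 1 <= s%:R.
  exists (Num.bound `|q + 1|); rewrite (le_trans (ler_norm _))// ltW//.
  by rewrite archi_boundP.
(* The Gaussian is traded for decay of order [s + 1]: [s] powers serve [integral_decay], and the
   remaining one yields the small factor [2 ^ (- J)] outside the ball. *)
pose c1 : R := s.+2%:R ^+ s.+1 / k4 ^+ s.+1.
have c10 : 0 < c1 by rewrite divr_gt0 ?exprn_gt0.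
have [J hJ] := expr2n_large (2 * k3 * c1 * k2 * (1 + 2 * 2 `^ q)).
have J0 : 0 < (2 : R) ^+ J by rewrite exprn_gt0.
have J1 : 1 <= (2 : R) ^+ J by rewrite exprn_ege1// ler1n.
exists ((2 * k3)^-1 * (2 ^+ J) `^ (- q)).
  by rewrite mulr_gt0 ?powR_gt0// invr_gt0 mulr_gt0.
move=> X rho mu lam phi k1 dds x r /andP[r0 r1].
have q0 := dds_q_gt0 dds.
pose m := 2 ^+ J / r.
have m0 : 0 < m by rewrite divr_gt0.
have m1 : 1 <= m by rewrite ler_pdivlMr// mul1r (le_trans r1).
have mt : 0 < m ^- 2 <= 1.
  by rewrite invr_gt0 exprn_gt0//= invf_le1 ?exprn_gt0// exprn_ege1.
have mq : (m ^- 2) `^ (- (q / 2)) = m `^ q.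
  by rewrite -powR_mulrn ?(ltW m0)// -powRN -powRrM; congr (_ `^ _); lra.
have mq0 : 0 < m `^ q by rewrite powR_gt0.
pose K y := `|heat_kernel lam phi (m ^- 2) x y|.
have Kb y : K y <= k3 * m `^ q * expR (- (k4 * (m * rho x y) ^+ 2)).
  rewrite (le_trans (dds_kernel_bound dds x y mt))// mq.
  by rewrite (_ : k4 * rho x y ^+ 2 / m ^- 2 = k4 * (m * rho x y) ^+ 2)// invrK; ring.
have mK : measurable_fun setT (K : borelType X -> R).
  by apply: measurableT_comp => //; exact: (heat_measurable dds).
set E : set (borelType X) := qball rho x r.
have mE : measurable E by exact: (measurable_qball dds).
have mEC : measurable (~` E) by exact: measurableC.
have zE y : (~ E y) -> 2 ^+ J < m * rho x y.
  rewrite /E/= /qball/= => /negP; rewrite -ltNge => h.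
  by rewrite /m mulrAC ltr_pdivlMr// ltr_pM2l.
(* The part of the kernel outside the ball, extended by 0 so that the annuli estimate applies on the
   whole space. *)
pose k (y : borelType X) := K y * \1_(~` E) y.
have mk : measurable_fun setT k.
  by apply: measurable_funM => //; exact: measurable_indic.
pose a : R := k3 * m `^ q * c1 * 2 ^- J.
have a0 : 0 <= a.
  by do 2?apply: mulr_ge0; [apply: mulr_ge0; exact: ltW|exact: ltW|rewrite invr_ge0; exact: ltW].
have kz y z : 1 <= z -> z <= m * rho x y -> k y <= a * z ^- s.
  move=> z1 zm; rewrite /k indicE; case: (boolP (y \in ~` E)) => [|_]; last first.
    by rewrite mulr0 mulr_ge0 ?invr_ge0 ?exprn_ge0// (le_trans _ z1).
  rewrite inE => /zE hz; rewrite mulr1 (le_trans (Kb y))//.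
  rewrite [leRHS](_ : _ = k3 * (m `^ q * (c1 * (2 ^- J * z ^- s)))); last by rewrite /a; ring.
  rewrite -(mulrA k3).
  rewrite ler_wpM2l ?(ltW k30)// ler_wpM2l ?(ltW mq0)//.
  have mr1 : 1 <= m * rho x y by exact: le_trans zm.
  have z0 : 0 < z by exact: lt_le_trans z1.
  have mr0 : 0 < m * rho x y by exact: lt_le_trans mr1.
  rewrite (le_trans (gaussian_le s.+1 k40 mr1))// ler_wpM2l ?(ltW c10)//.
  rewrite exprS invfM ler_pM ?invr_ge0 ?exprn_ge0 ?(ltW mr0)//.
    by rewrite lef_pV2 ?posrE// ltW.
  by rewrite lef_pV2 ?posrE ?exprn_gt0// lerXn2r ?nnegrE ?(ltW z0) ?(ltW mr0).
have ka y : 0 <= k y <= a.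
  have -> /= : 0 <= k y by apply: mulr_ge0; [exact: normr_ge0|rewrite indicE; exact: ler0n].
  rewrite /k; have [zm|zm] := leP 1 (m * rho x y).
    by have := kz y 1 (lexx _) zm; rewrite expr1n invr1 mulr1.
  rewrite indicE; case: (boolP (y \in ~` E)) => [|_]; last by rewrite mulr0.
  rewrite inE => /zE hz; exfalso; move: zm; rewrite ltNge => /negP; apply.
  by rewrite (le_trans J1)// ltW.
have hint : (\int[mu]_y (k y)%:E <= (a * (k2 * m `^ (- q)) * (1 + 2 * 2 `^ q))%:E)%E.
  apply: (integral_decay dds m0 a0 _ qs mk (y := x)).
  - by rewrite mulr_ge0 ?powR_ge0// ltW.
  - move=> j; rewrite (le_trans (dds_ball_measure dds x _))// ?divr_gt0 ?exprn_gt0// lee_fin.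
    rewrite powRM ?invr_ge0 ?exprn_ge0 ?(ltW m0)// -powR_inv1 ?(ltW m0)// -powRrM mulN1r.
    by rewrite mulrAC mulrA.
  - exact: ka.
  - move=> y j hj; rewrite exprM kz//; last exact: ltW.
    by rewrite exprn_ege1// ler1n.
have hint2 : (\int[mu]_y (k y)%:E <= (2^-1)%:E)%E.
  apply: (le_trans hint); rewrite lee_fin.
  rewrite [leLHS](_ : _ = (k3 * c1 * k2 * (1 + 2 * 2 `^ q)) * 2 ^- J); last first.
    rewrite /a powRN; field; rewrite ?gt_eqF//.
  by rewrite ler_pdivrMr//; lra.
have h1 : (1 <= \int[mu]_y (K y)%:E)%E.
  have := le_abse_integral mu measurableT (f := fun y => (heat_kernel lam phi (m ^- 2) x y)%:E).
  rewrite (integral_heat dds x mt) abse1; apply.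
  by apply/measurable_EFinP; exact: (heat_measurable dds).
have h2 : (\int[mu]_y (K y)%:E <= (k3 * m `^ q)%:E * mu E + (2^-1)%:E)%E.
  have -> : (\int[mu]_y (K y)%:E = \int[mu]_(y in E) (K y)%:E + \int[mu]_(y in ~` E) (K y)%:E)%E.
    rewrite -ge0_integral_setU ?setUv//; first by apply/measurable_EFinP.
      by move=> y _; rewrite lee_fin normr_ge0.
    by apply/disj_setPS => y [].
  apply: leeD.
    apply: integral_le_cst => //; first exact: measurable_funTS.
    move=> y _; rewrite normr_ge0/= (le_trans (Kb y))// ler_piMr//.
      by rewrite mulr_ge0 ?(ltW k30) ?(ltW mq0).
    by rewrite -[leRHS]expR0 ler_expR oppr_le0 mulr_ge0 ?sqr_ge0// ltW.
  apply: le_trans hint2; rewrite integral_mkcond; apply: ge0_le_integral => //.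
  - by move=> y _; rewrite patchE; case: ifP => //; rewrite lee_fin normr_ge0.
  - apply/(measurable_restrictT _ _).1 => //; apply/measurable_EFinP; exact: measurable_funTS.
  - by apply/measurable_EFinP.
  - move=> y _; rewrite patchE /k indicE; case: ifP => _; rewrite lee_fin ?mulr1//.
    by rewrite mulr0.
have := le_trans h1 h2.
rewrite -(@fineK _ (mu E)) ?fin_num_measure// -EFinM -EFinD !lee_fin.
move: (fine (mu E)) => w hw.
rewrite -mulrA (_ : (2 ^+ J) `^ (- q) * r `^ q = (m `^ q)^-1); last first.
  by rewrite /m powRM ?invr_ge0 ?(ltW J0) ?(ltW r0)// -(powR_inv1 (ltW r0)) -powRrM mulN1r !powRN invfM invrK.
rewrite -invfM -div1r ler_pdivrMr ?mulr_gt0//; lra.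
Qed.
End ball_lower_bound.

Section packing.
Context (R : realType) (X : ptopologicalType) (rho : X -> X -> R)
  (mu : probability (borelType X) R) (lam : nat -> R) (phi : nat -> X -> R)
  (q k1 k2 k3 k4 : R).
Hypothesis dds : data_defined_space rho mu lam phi q k1 k2 k3 k4.
Local Notation B := (borelType X).
Local Notation ball := (qball rho).

Let balls (L : seq X) (t : R) : set B := foldr (fun z A => ball z t `|` A) set0 L.

Let measurable_balls L t : measurable (balls L t).
Proof.
elim: L => [|z L IH] /=; first exact: measurable0.
by apply: measurableU => //; exact: (measurable_qball dds).
Qed.

Let ballsP L t y : balls L t y -> exists2 z, z \in L & rho z y <= t.
Proof.
elim: L => [|z L IH] //= [zy|/IH[w wL wy]]; first by exists z; rewrite ?mem_head.
by exists w; rewrite ?in_cons ?wL ?orbT.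
Qed.

Let mem_balls L t y z : z \in L -> rho z y <= t -> balls L t y.
Proof.
elim: L => [|w L IH] //=; rewrite in_cons => /predU1P[->|zL] zy; first by left.
by right; exact: IH.
Qed.

(** A maximal [s]-separated family in [E]. Dividing the radius by [2 * k1] makes the small balls
    disjoint despite the constant in the quasi-triangle inequality, so their number is limited by
    the measure of [V]; maximality gives the covering. *)
Lemma packing (E : set X) (V : set B) (s b : R) : 0 < b -> measurable V ->
  (forall x, E x -> (b%:E <= mu (ball x (s / (2 * k1))))%E) ->
  (forall x, E x -> ball x (s / (2 * k1)) `<=` V) ->
  exists L : seq X, (size L)%:R * b <= fine (mu V) /\
    forall x, E x -> exists2 z, z \in L & rho z x <= s.
Proof.
move=> b0 mV Eb EV; set t := s / (2 * k1).
have k10 : 0 < k1 by rewrite (lt_le_trans ltr01)// (dds_k1_ge1 dds).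
pose sep := pairwise (fun x y => s < rho x y).
have mass L : sep L -> (forall z, z \in L -> E z) ->
    (((size L)%:R * b)%:E <= mu (balls L t))%E.
  elim: L => [|z L IH] /=; first by rewrite mul0r measure0.
  move=> /andP[zL sL] EL; rewrite measureU//; last 2 first.
  - exact: (measurable_qball dds).
  - apply/seteqP; split=> y //= [zy /ballsP[w wL wy]].
    have := allP zL w wL; rewrite ltNge => /negP; apply.
    rewrite (le_trans (dds_rho_triangle dds z w y))// (dds_rhoC dds y).
    rewrite -[leRHS](_ : k1 * (t + t) = s); last by rewrite /t; field; rewrite gt_eqF.
    by rewrite ler_wpM2l ?(ltW k10)// lerD.
  rewrite -natr1 mulrDl mul1r addrC EFinD leeD//.
    by apply: Eb; apply: EL; rewrite mem_head.
  by apply: IH => // w wL; apply: EL; rewrite in_cons wL orbT.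
have massV L : sep L -> (forall z, z \in L -> E z) -> (size L)%:R * b <= fine (mu V).
  move=> sL EL; rewrite -lee_fin fineK ?fin_num_measure//.
  apply: (le_trans (mass L sL EL)); apply: le_measure; rewrite ?inE//.
  by move=> y /ballsP[z /EL Ez zy]; apply: (EV z Ez).
pose P n := `[< exists L, [/\ size L = n, sep L & forall z, z \in L -> E z] >].
have exP : exists n, P n by exists 0%N; apply/asboolP; exists [::].
have ubP n : P n -> (n <= Num.truncn (fine (mu V) / b))%N.
  move=> /asboolP[L [<- sL EL]]; rewrite truncn_ge_nat; last first.
    by rewrite divr_ge0 ?(ltW b0)// fine_ge0.
  by rewrite ler_pdivlMr// massV.
have [n /asboolP[L [sizeL sL EL]] nmax] := ex_maxnP exP ubP.
exists L; split; first exact: massV.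
move=> x Ex; apply/not_exists2P => h.
have : P n.+1.
  apply/asboolP; exists (x :: L); split => /=.
  - by rewrite sizeL.
  - apply/andP; split; last exact: sL.
    apply/allP => z zL.
    by have [//|/negP] := h z; rewrite -ltNge (dds_rhoC dds).
  - by move=> z; rewrite in_cons => /predU1P[->|/EL].
by move=> /nmax; rewrite ltnn.
Qed.

Lemma measure_cover (tau : {measure set B -> \bar R}) (E : set B) (L : seq X) (d b : R) :
  measurable E -> (forall x, (tau (ball x d) <= b%:E)%E) ->
  (forall x, E x -> exists2 z, z \in L & rho z x <= d) ->
  (tau E <= ((size L)%:R * b)%:E)%E.
Proof.
move=> mE taub EL; apply: (@le_trans _ _ (tau (balls L d))).
  apply: le_measure; rewrite ?inE//.
  by move=> x /EL[z zL zx]; exact: mem_balls zx.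
elim: L {EL} => [|z L IH] /=; first by rewrite measure0 mul0r.
apply: (le_trans (measureU2 _ (measurable_qball dds _ _) (measurable_balls _ _))).
rewrite -natr1 mulrDl mul1r [X in X%:E]addrC EFinD; apply: leeD; first exact: taub.
exact: IH.
Qed.

End packing.

Section growth.
Context (R : realType).

(** A ball of radius [r] is covered by balls of radius [d] around a packing. Their number is at most
    of order [(r / d) ^ q], by comparing upper and lower bounds for [mu], and each has [tau]-measure
    at most [C d ^ q]. *)
Lemma regular_growth (q k1 k2 k3 k4 : R) : 1 <= k1 -> 0 < k2 -> 0 < k3 -> 0 < k4 ->
  exists2 c : R, 0 < c &
  forall (X : ptopologicalType) (rho : X -> X -> R)
  (mu : probability (borelType X) R) (lam : nat -> R) (phi : nat -> X -> R),
  data_defined_space rho mu lam phi q k1 k2 k3 k4 ->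
  forall (tau : {measure set (borelType X) -> \bar R}) d C, 0 < d <= 1 -> 0 <= C ->
  (forall x, (tau (qball rho x d) <= (C * d `^ q)%:E)%E) ->
  forall x r, d <= r -> (tau (qball rho x r) <= (c * C * r `^ q)%:E)%E.
Proof.
move=> k11 k20 k30 k40; have k10 : 0 < k1 by exact: lt_le_trans k11.
have [c0 c00 hc0] := qball_measure_ge q k20 k30 k40.
have w0 : 0 < 2 * k1 by rewrite mulr_gt0.
have wq0 : 0 < (2 * k1) `^ q by rewrite powR_gt0.
(* One power of [2 * k1] comes from enlarging the ball to contain the packing, the other from
   shrinking the packing balls. *)
exists (k2 * (2 * k1) `^ q * (2 * k1) `^ q / c0).
  by rewrite divr_gt0// !mulr_gt0.
move=> X rho mu lam phi dds tau d C /andP[d0 d1] C0 tauC x r dr.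
have q0 := dds_q_gt0 dds.
have r0 : 0 < r by exact: lt_le_trans dr.
pose t := d / (2 * k1).
have t0 : 0 < t by rewrite divr_gt0.
have t1 : 0 < t <= 1.
  rewrite t0 ler_pdivrMr// mul1r (le_trans d1)//; lra.
have td : t <= d by rewrite ler_pdivrMr// ler_peMr ?(ltW d0)//; lra.
have b0 : 0 < c0 * t `^ q by rewrite mulr_gt0// powR_gt0.
have EV y : qball rho x r y -> qball rho y t `<=` qball rho x (2 * k1 * r).
  rewrite /qball/= => xy z yz; apply: (le_trans (dds_rho_triangle dds x z y)).
  rewrite (_ : 2 * k1 * r = k1 * (r + r)); last by ring.
  by rewrite ler_wpM2l ?(ltW k10)// lerD// (le_trans yz)// (le_trans td).
have [L [sL coverL]] := packing dds b0 (measurable_qball dds x (2 * k1 * r))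
  (fun y _ => hc0 _ _ _ _ _ _ dds y t t1) EV.
apply: (le_trans (measure_cover dds (measurable_qball dds x r) tauC coverL)).
rewrite lee_fin.
have muV : fine (mu (qball rho x (2 * k1 * r))) <= k2 * (2 * k1 * r) `^ q.
  rewrite -lee_fin fineK ?fin_num_measure//; last exact: (measurable_qball dds).
  by apply: (dds_ball_measure dds); rewrite mulr_gt0.
have := le_trans sL muV.
have iw0 : 0 <= (2 * k1)^-1 by rewrite invr_ge0 ltW.
have -> : t `^ q = d `^ q * ((2 * k1) `^ q)^-1.
  by rewrite /t (powRM _ (ltW d0) iw0) -(powR_inv1 (ltW w0)) -powRrM mulN1r powRN.
rewrite (powRM _ (ltW w0) (ltW r0)).
move: (d `^ q) (r `^ q) ((2 * k1) `^ q) wq0 (size L)%:R => D Q W W0 N h.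
rewrite (_ : N * (C * D) = C * W / c0 * (N * (c0 * (D * W^-1)))); last first.
  by field; rewrite !gt_eqF.
rewrite (_ : _ * C * Q = C * W / c0 * (k2 * (W * Q))); last by ring.
by rewrite ler_wpM2l// divr_ge0 ?(ltW c00)// mulr_ge0 ?(ltW W0).
Qed.

(** Balls of radius 1 have measure bounded below and [mu] has mass 1, so finitely many balls of
    radius [2 * k1] cover the space. *)
Lemma bounded_diameter (X : ptopologicalType) (rho : X -> X -> R)
  (mu : probability (borelType X) R) (lam : nat -> R) (phi : nat -> X -> R) (q k1 k2 k3 k4 : R) :
  data_defined_space rho mu lam phi q k1 k2 k3 k4 ->
  exists2 D : R, 0 <= D & forall x y, rho x y <= D.
Proof.
move=> dds; have k11 := dds_k1_ge1 dds; have k10 : 0 < k1 by exact: lt_le_trans k11.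
have [c0 c00 hc0] := qball_measure_ge q (dds_k2_gt0 dds) (dds_k3_gt0 dds) (dds_k4_gt0 dds).
have := @packing _ _ _ _ _ _ _ _ _ _ _ dds setT setT (2 * k1) c0 c00 measurableT.
case.
- move=> x _; have := hc0 _ _ _ _ _ _ dds x 1.
  by rewrite powR1 mulr1 divff ?gt_eqF ?mulr_gt0// ltr01 lexx; exact.
- by [].
move=> L [_ coverL].
pose D0 := \sum_(z <- L) \sum_(w <- L) rho z w.
have rho_ge0 := dds_rho_ge0 dds.
have D00 : 0 <= D0 by rewrite sumr_ge0// => z _; rewrite sumr_ge0.
have LD z w : z \in L -> w \in L -> rho z w <= D0.
  move=> zL wL; rewrite /D0 (big_rem z)//= (big_rem w)//= -addrA lerDl addr_ge0//.
    by rewrite sumr_ge0.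
  by rewrite sumr_ge0// => ? _; rewrite sumr_ge0.
exists (k1 * (2 * k1 + k1 * (D0 + 2 * k1))).
  by rewrite mulr_ge0 ?(ltW k10)// !addr_ge0 ?mulr_ge0 ?addr_ge0 ?mulr_ge0 ?(ltW k10).
move=> x y; have [z zL zx] := coverL x I; have [w wL wy] := coverL y I.
rewrite (le_trans (dds_rho_triangle dds x y z))// ler_wpM2l ?(ltW k10)//.
rewrite lerD ?(dds_rhoC dds x)// (le_trans (dds_rho_triangle dds z y w))//.
by rewrite ler_wpM2l ?(ltW k10)// lerD// LD.
Qed.

End growth.

(** * Multiplier operators *)

Section jensen.
Context (R : realType).

(** The convex function [t ^ p] lies above its tangent at [A]; obtained here from Young's
    inequality. *)
Lemma powR_tangent (p t A : R) : 1 <= p -> 0 <= t -> 0 < A ->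
  p * A `^ (p - 1) * t <= t `^ p + (p - 1) * A `^ p.
Proof.
move=> p1 t0 A0; have [->|p1'] := eqVneq p 1.
  by rewrite subrr powRr0 !mul1r mul0r addr0 powRr1.
have {p1 p1'} p1 : 1 < p by rewrite lt_neqAle eq_sym p1'.
have p0 : 0 < p by exact: lt_trans p1.
have pm0 : 0 < p - 1 by rewrite subr_gt0.
have q0 : 0 < p / (p - 1) by rewrite divr_gt0.
have := @conjugate_powR _ t (A `^ (p - 1)) p (p / (p - 1)) t0 (powR_ge0 _ _) p0 q0.
have -> : p^-1 + (p / (p - 1))^-1 = 1 by field; rewrite !gt_eqF.
move=> /(_ erefl).
have -> : (A `^ (p - 1)) `^ (p / (p - 1)) = A `^ p.
  by rewrite -powRrM; congr (_ `^ _); field; rewrite gt_eqF.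
rewrite -(ler_pM2l p0) mulrDr.
rewrite (_ : p * (t `^ p / p) = t `^ p); last by field; rewrite gt_eqF.
rewrite (_ : p * (A `^ p / (p / (p - 1))) = (p - 1) * A `^ p); last by field; rewrite !gt_eqF.
by rewrite (_ : p * (t * _) = p * A `^ (p - 1) * t)//; ring.
Qed.

Context d (T : measurableType d).

(** The tangent inequality is integrated against [w] and then optimised over the point of tangency
    [A]. The weight need only have mass at most [b]. *)
Lemma weighted_jensen (tau : {measure set T -> \bar R}) (w f : T -> R) (p b J : R) :
  1 <= p -> 0 < b -> measurable_fun setT w -> measurable_fun setT f ->
  (forall x, 0 <= w x) -> (forall x, 0 <= f x) ->
  (\int[tau]_x (w x)%:E <= b%:E)%E ->
  (\int[tau]_x (w x * f x `^ p)%:E <= J%:E)%E ->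
  exists I : R, [/\ (\int[tau]_x (w x * f x)%:E = I%:E)%E, 0 <= I &
    I `^ p <= b `^ (p - 1) * J].
Proof.
move=> p1 b0 mw mf w0 f0 wb wJ.
have p0 : 0 < p by exact: lt_le_trans p1.
have mfp : measurable_fun setT (fun x => f x `^ p).
  exact: (measurableT_comp (measurable_powR p)).
have I0 : (0 <= \int[tau]_x (w x * f x)%:E)%E.
  by apply: integral_ge0 => x _; rewrite lee_fin mulr_ge0.
have J0 : 0 <= J.
  rewrite -lee_fin (le_trans _ wJ)// integral_ge0// => x _.
  by rewrite lee_fin mulr_ge0 ?powR_ge0.
have key A : 0 < A -> ((p * A `^ (p - 1))%:E * \int[tau]_x (w x * f x)%:E <=
    (J + (p - 1) * A `^ p * b)%:E)%E.
  move=> A0; rewrite -ge0_integralZl_EFin//; first last.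
  - by rewrite mulr_ge0 ?powR_ge0// ltW.
  - by apply/measurable_EFinP; exact: measurable_funM.
  - by move=> x _; rewrite lee_fin mulr_ge0.
  apply: (@le_trans _ _ (\int[tau]_x ((w x * f x `^ p)%:E + ((p - 1) * A `^ p)%:E * (w x)%:E))%E).
    apply: ge0_le_integral => //.
    - by move=> x _; rewrite -EFinM lee_fin !mulr_ge0 ?powR_ge0// ltW.
    - by apply/measurable_EFinP; apply: measurable_funM => //; exact: measurable_funM.
    - apply/measurable_EFinP; apply: measurable_funD; apply: measurable_funM => //.
    - move=> x _; rewrite -!EFinM -EFinD lee_fin.
      have := powR_tangent p1 (f0 x) A0; move=> /(ler_wpM2l (w0 x)); lra.
  have pA : 0 <= (p - 1) * A `^ p by rewrite mulr_ge0 ?powR_ge0// subr_ge0.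
  rewrite ge0_integralD//; last 4 first.
  - by move=> x _; rewrite lee_fin mulr_ge0 ?powR_ge0.
  - by apply/measurable_EFinP; exact: measurable_funM.
  - by move=> x _; rewrite -EFinM lee_fin mulr_ge0.
  - by apply/measurable_EFinP; exact: measurable_funM.
  rewrite ge0_integralZl_EFin//; last 2 first.
  - by move=> x _; rewrite lee_fin.
  - by apply/measurable_EFinP.
  by rewrite EFinD leeD// [leRHS]EFinM lee_wpmul2l// lee_fin.
(* The choice [A = 1] already shows finiteness, so the optimal [A] below is a real number. *)
have : (\int[tau]_x (w x * f x)%:E < +oo)%E.
  have := key 1 ltr01; rewrite powR1 mulr1; case: (\int[tau]_x _)%E => //.
    by move=> r _; rewrite ltry.
  by rewrite gt0_muley ?lte_fin// leye_eq.
move: key; case: (\int[tau]_x (w x * f x)%:E)%E I0 => // I; rewrite lee_fin => I0 key _.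
exists I; split => //; move: I0; rewrite le_eqVlt => /predU1P[<-|I0].
  by rewrite powR0 ?gt_eqF// mulr_ge0 ?powR_ge0.
have Ip : I `^ p = I * I `^ (p - 1).
  by rewrite -{2}(powRr1 (ltW I0)) -powRD ?(gt_eqF I0) ?implybT// addrCA subrr addr0.
have bp : b `^ p = b * b `^ (p - 1).
  by rewrite -{2}(powRr1 (ltW b0)) -powRD ?(gt_eqF b0) ?implybT// addrCA subrr addr0.
have ib0 : 0 <= b^-1 by rewrite invr_ge0 ltW.
have e (e' : R) : (I / b) `^ e' = I `^ e' / b `^ e'.
  by rewrite (powRM _ (ltW I0) ib0) -(powR_inv1 (ltW b0)) -powRrM mulN1r powRN.
(* The optimal point of tangency is the mean value. *)
have := key (I / b) (divr_gt0 I0 b0); rewrite -EFinM lee_fin !e Ip bp.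
have := powR_gt0 (p - 1) I0; have := powR_gt0 (p - 1) b0.
move: (I `^ (p - 1)) (b `^ (p - 1)) => u v v0 u0 /(ler_wpM2r (ltW v0)).
rewrite (_ : p * (u / v) * I * v = p * (I * u)); last by field; rewrite gt_eqF.
rewrite (_ : (J + _) * v = v * J + (p - 1) * (I * u)); last by field; rewrite !gt_eqF.
lra.
Qed.

End jensen.

Section schur.
Context (R : realType) d (T : measurableType d).

(** Jensen's inequality with weight [K (x, .)] at each [x], then Tonelli. The measure [tau] on the
    side of [x] is kept separate from [mu], so that the same test gives both boundedness on [L^p]
    and estimates against another measure. *)
Lemma schur_test (mu tau : {finite_measure set T -> \bar R}) (K : T * T -> R)
    (h g : T -> R) (p a b H k0 : R) :
  1 <= p -> 0 <= a -> 0 < b ->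
  measurable_fun setT K -> (forall z, 0 <= K z <= k0) ->
  measurable_fun setT h -> (forall y, 0 <= h y) ->
  measurable_fun setT g -> (forall x, 0 <= g x) ->
  (forall x, (\int[mu]_y (K (x, y))%:E <= b%:E)%E) ->
  (forall y, (\int[tau]_x (K (x, y))%:E <= a%:E)%E) ->
  (forall x, ((g x)%:E <= \int[mu]_y (K (x, y) * h y)%:E)%E) ->
  (\int[mu]_y (h y `^ p)%:E = H%:E)%E ->
  (\int[tau]_x (g x `^ p)%:E <= (b `^ (p - 1) * (a * H))%:E)%E.
Proof.
move=> p1 a0 b0 mK K0 mh h0 mg g0 Kb Ka gK hH.
have p0 : 0 < p by exact: lt_le_trans p1.
have mhp : measurable_fun setT (fun x => h x `^ p).
  exact: (measurableT_comp (measurable_powR p)).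
have mK1 x : measurable_fun setT (fun y => K (x, y)) by exact: measurable_fun_pair2.
have mK2 y : measurable_fun setT (fun x => K (x, y)) by exact: measurable_fun_pair1.
have K00 z : 0 <= K z by case/andP: (K0 z).
have mKhp : measurable_fun setT (fun z : T * T => K z * h z.2 `^ p).
  by apply: measurable_funM => //; exact: (measurableT_comp mhp).
have KhpH x : (\int[mu]_y (K (x, y) * h y `^ p)%:E <= (k0 * H)%:E)%E.
  have k00 : 0 <= k0 by case/andP: (K0 (x, x)) => /le_trans; apply.
  rewrite EFinM -hH -ge0_integralZl_EFin//; last first.
  - by apply/measurable_EFinP.
  - by move=> y _; rewrite lee_fin powR_ge0.
  apply: ge0_le_integral => //.
  - by move=> y _; rewrite lee_fin mulr_ge0 ?powR_ge0.
  - by apply/measurable_EFinP; exact: measurable_funM.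
  - by apply/measurable_EFinP; exact: measurable_funM.
  - by move=> y _; rewrite -EFinM lee_fin ler_wpM2r ?powR_ge0//; case/andP: (K0 (x, y)).
have ptw x : ((g x `^ p)%:E <= (b `^ (p - 1))%:E * \int[mu]_y (K (x, y) * h y `^ p)%:E)%E.
  have JE : (\int[mu]_y (K (x, y) * h y `^ p)%:E = (fine (\int[mu]_y (K (x, y) * h y `^ p)%:E))%:E)%E.
    rewrite fineK// ge0_fin_numE; first exact: le_lt_trans (KhpH x) (ltry _).
    by apply: integral_ge0 => y _; rewrite lee_fin mulr_ge0 ?powR_ge0.
  set J := fine _ in JE.
  have JJ : (\int[mu]_y (K (x, y) * h y `^ p)%:E <= J%:E)%E by rewrite JE.
  have [I [IE I0 Ip]] := weighted_jensen p1 b0 (mK1 x) mh (fun y => K00 (x, y)) h0 (Kb x) JJ.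
  rewrite JE -EFinM lee_fin (le_trans _ Ip)// ge0_ler_powR ?nnegrE ?(ltW p0)//.
  by have := gK x; rewrite IE lee_fin.
apply: (@le_trans _ _ (\int[tau]_x ((b `^ (p - 1))%:E * \int[mu]_y (K (x, y) * h y `^ p)%:E))%E).
  have mF := measurable_fun_fubini_tonelli_F (m2 := mu) (fun z => (K z * h z.2 `^ p)%:E).
  apply: ge0_le_integral => //.
  - by move=> x _; rewrite lee_fin powR_ge0.
  - by apply/measurable_EFinP; exact: (measurableT_comp (measurable_powR p)).
  - apply: measurable_funeM; apply: mF; first by apply/measurable_EFinP.
    by move=> z; rewrite lee_fin mulr_ge0 ?powR_ge0.
have mF : measurable_fun setT (fun x => \int[mu]_y (K (x, y) * h y `^ p)%:E)%E.
  apply: (measurable_fun_fubini_tonelli_F (m2 := mu) (fun z => (K z * h z.2 `^ p)%:E)).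
    by apply/measurable_EFinP.
  by move=> z; rewrite lee_fin mulr_ge0 ?powR_ge0.
rewrite ge0_integralZl_EFin//; first last.
- exact: powR_ge0.
- by move=> x _; apply: integral_ge0 => y _; rewrite lee_fin mulr_ge0 ?powR_ge0.
rewrite EFinM lee_wpmul2l ?lee_fin ?powR_ge0//.
rewrite (fubini_tonelli (m1 := tau) (m2 := mu) (fun z => (K z * h z.2 `^ p)%:E))//=; first last.
- by move=> z; rewrite lee_fin mulr_ge0 ?powR_ge0.
- by apply/measurable_EFinP.
rewrite EFinM -hH -ge0_integralZl_EFin//; first last.
- by apply/measurable_EFinP.
- by move=> y _; rewrite lee_fin powR_ge0.
apply: ge0_le_integral => //.
- by move=> y _; apply: integral_ge0 => x _; rewrite lee_fin mulr_ge0 ?powR_ge0.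
- apply: (measurable_fun_fubini_tonelli_G (m1 := tau) (fun z => (K z * h z.2 `^ p)%:E)).
    by apply/measurable_EFinP.
  by move=> z; rewrite lee_fin mulr_ge0 ?powR_ge0.
- by apply: measurable_funeM; apply/measurable_EFinP.
- move=> y _; under eq_integral do rewrite mulrC EFinM.
  rewrite ge0_integralZl_EFin//; first last.
  + exact: powR_ge0.
  + by apply/measurable_EFinP.
  + by move=> x _; rewrite lee_fin.
  by rewrite muleC lee_wpmul2r// lee_fin powR_ge0.
Qed.

End schur.

Section lp.
Context (R : realType) d (T : measurableType d) (mu : probability T R).
Local Notation norm p f := ('N[mu]_p [EFin \o f])%E.

Definition Lp (p : \bar R) (f : T -> R) : Prop :=
  measurable_fun setT f /\ (norm p f < +oo)%E.

Lemma Lp_Lfun p f : Lp p f -> f \in Lfun mu p.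
Proof.
by move=> [mf ff]; rewrite inE; apply/andP; split; rewrite inE.
Qed.

Lemma Lp_integrable p f : (1 <= p)%E -> Lp p f -> mu.-integrable setT (EFin \o f).
Proof.
move=> p1 /Lp_Lfun fp; apply/Lfun1_integrable.
by apply: (Lfun_subset (lexx 1%E) p1 _ p1 fp); rewrite fin_num_measure.
Qed.

Lemma Lp_norm_fin p f : Lp p f -> norm p f = (fine (norm p f))%:E.
Proof. by move=> [_ ff]; rewrite fineK// ge0_fin_numE ?Lnorm_ge0. Qed.

Lemma Lp_powR (r : R) f : 0 < r -> Lp r%:E f ->
  (\int[mu]_x (`|f x| `^ r)%:E = (fine (norm r%:E f) `^ r)%:E)%E.
Proof.
move=> r0 /Lp_norm_fin h; rewrite -poweR_EFin -h poweR_Lnorm ?gt_eqF//.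
Qed.

Lemma LpD p f g : (1 <= p)%E -> Lp p f -> Lp p g -> Lp p (f \+ g).
Proof.
move=> p1 [mf ff] [mg gg]; split; first exact: measurable_funD.
by rewrite (le_lt_trans (eminkowski mu mf mg p1))// lte_add_pinfty.
Qed.

Lemma LpZ p f (c : R) : (1 <= p)%E -> Lp p f -> Lp p (fun x => c * f x) /\
  norm p (fun x : T => (c * f x)%R) = (`|c|%:E * norm p f)%E.
Proof.
move=> p1 fp; have h := @LnormZ _ _ _ mu p p1 (Lfun_Sub p1 (Lp_Lfun fp)) c.
split; last exact: h.
split; first by apply: measurable_funM => //; exact: (proj1 fp).
have -> : norm p (fun x : T => (c * f x)%R) = (`|c|%:E * norm p f)%E by exact: h.
by rewrite (Lp_norm_fin fp) -EFinM ltry.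
Qed.

Lemma LpB p f g : (1 <= p)%E -> Lp p f -> Lp p g -> Lp p (f \- g) /\
  (norm p (f \- g)%R <= norm p f + norm p g)%E.
Proof.
move=> p1 fp gp; have [gp' gE] := LpZ (-1) p1 gp.
have -> : f \- g = f \+ (fun x => -1 * g x) by apply/funext => x /=; rewrite mulN1r.
split; first exact: LpD.
apply: le_trans (eminkowski mu _ _ p1) _; [by case: fp|by case: gp'|].
by rewrite gE normrN normr1 mul1e.
Qed.

Lemma Lp_bounded p (f : T -> R) (M : R) : (1 <= p)%E -> 0 <= M -> measurable_fun setT f ->
  (forall x, `|f x| <= M) -> Lp p f /\ (norm p f <= M%:E)%E.
Proof.
move=> p1 M0 mf fM.
suff h : (norm p f <= M%:E)%E by split=> //; split=> //; rewrite (le_lt_trans h)// ltry.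
rewrite unlock /Lnorm; case: p p1 => [r| |//].
  rewrite lee_fin => r1; have r0 : 0 < r by exact: lt_le_trans r1.
  rewrite (eq_integral (fun x => (`|f x| `^ r)%:E)); last by [].
  have hi : (\int[mu]_x (`|f x| `^ r)%:E <= (M `^ r)%:E)%E.
    have <- : (\int[mu]_(x in setT) (cst (M `^ r)%:E) x = (M `^ r)%:E)%E.
      by rewrite (integral_cst mu measurableT) -[RHS]mule1; congr (_ * _)%E; exact: probability_setT.
    apply: ge0_le_integral => //.
    - by apply/measurable_EFinP; apply: (measurableT_comp (measurable_powR r)); exact: measurableT_comp.
    - by move=> x _; rewrite /= lee_fin ge0_ler_powR ?nnegrE// ltW.
  have I0 : (0 <= \int[mu]_x (`|f x| `^ r)%:E)%E.
    by apply: integral_ge0 => x _; rewrite lee_fin powR_ge0.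
  move: hi I0; case: (\int[mu]_x _)%E => [I| |]//; rewrite !lee_fin => hi I0.
  rewrite -[leRHS](powRr1 M0) -(mulfV (lt0r_neq0 r0)) powRrM.
  by rewrite ge0_ler_powR ?nnegrE ?powR_ge0// invr_ge0 ltW.
move=> _; case: ifPn => // _.
by apply/ess_supP; apply: nearW => x /=; rewrite lee_fin.
Qed.

End lp.

Section multiplier_operator.
Context (R : realType) (X : ptopologicalType).

(** Some index beyond which all frequencies are at least [m], not necessarily the least. The choice
    is immaterial: there [exp (- (lam / m) ^ 2) <= exp (-1)], where the multipliers used below
    vanish. *)
Definition freq_count (lam : nat -> R) (m : R) : nat :=
  xget 0%N [set M | forall k, (M <= k)%N -> m <= lam k].

Definition multop (mu : probability (borelType X) R) (lam : nat -> R)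
    (phi : nat -> X -> R) (F : R -> R) (m : R) (h : X -> R) (x : X) : R :=
  \sum_(k < freq_count lam m)
    F (expR (- (lam k ^+ 2 * m ^- 2))) * fhat mu phi h k * phi k x.

Context (rho : X -> X -> R)
  (mu : probability (borelType X) R) (lam : nat -> R) (phi : nat -> X -> R)
  (q k1 k2 k3 k4 : R).
Hypothesis dds : data_defined_space rho mu lam phi q k1 k2 k3 k4.
Local Notation B := (borelType X).

Lemma freq_countP m k : (freq_count lam m <= k)%N -> m <= lam k.
Proof.
rewrite /freq_count; case: xgetP => [M -> h|none]; first exact: h.
have /cvgryPge/(_ m)[M _ hM] := dds_lam_cvg dds.
by exfalso; apply: (none M) => k' /hM.
Qed.

Lemma phi_mul_integrable (h : B -> R) k : mu.-integrable setT (EFin \o h) ->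
  mu.-integrable setT (EFin \o (fun x : B => h x * phi k x)).
Proof.
move=> hi; have [M phiM] := dds_phi_bounded dds k.
have bd : [bounded phi k x : R | x in [set: B]].
  exists M; split; first exact: num_real.
  by move=> N MN x _ /=; rewrite (le_trans (phiM x))// ltW.
exact: (integrableMl measurableT hi (measurable_phi dds k) bd).
Qed.

Lemma fhatD (f g : B -> R) k : mu.-integrable setT (EFin \o f) ->
  mu.-integrable setT (EFin \o g) ->
  fhat mu phi (fun x => f x + g x) k = fhat mu phi f k + fhat mu phi g k.
Proof.
move=> fi gi; rewrite /fhat -RintegralD//; try exact: phi_mul_integrable.
by apply: eq_Rintegral => x _; rewrite mulrDl.
Qed.

Lemma fhatZ (f : B -> R) (c : R) k : mu.-integrable setT (EFin \o f) ->
  fhat mu phi (fun x => c * f x) k = c * fhat mu phi f k.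
Proof.
move=> fi; rewrite /fhat -RintegralZl//; last exact: phi_mul_integrable.
by apply: eq_Rintegral => x _; rewrite mulrA.
Qed.

Lemma fhat_ae_eq (f g : B -> R) k : mu.-integrable setT (EFin \o f) ->
  measurable_fun setT g -> (\forall x \ae mu, f x = g x) ->
  fhat mu phi g k = fhat mu phi f k.
Proof.
move=> fi mg fg; rewrite /fhat /Rintegral; congr fine.
apply: ae_eq_integral => //.
- by apply/measurable_EFinP; apply: measurable_funM => //; exact: (measurable_phi dds).
- exact: measurable_int (phi_mul_integrable k fi).
- by apply: filterS fg => x fgx _ /=; rewrite fgx.
Qed.

Lemma sum_phi_measurable M (a : nat -> R) :
  measurable_fun setT (fun x : B => \sum_(k < M) a k * phi k x).
Proof.
apply: measurable_sum => k; apply: measurable_funM => //; exact: (measurable_phi dds).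
Qed.

Lemma sum_phi_bounded M (a : nat -> R) : exists2 N : R, 0 <= N &
  forall x, `|\sum_(k < M) a k * phi k x| <= N.
Proof.
elim: M => [|M [N N0 hN]]; first by exists 0 => // x; rewrite big_ord0 normr0.
have [K phiK] := dds_phi_bounded dds M.
have K0 : 0 <= K by rewrite (le_trans _ (phiK point)).
exists (N + `|a M| * K); first by rewrite addr_ge0// mulr_ge0.
move=> x; rewrite big_ord_recr/= (le_trans (ler_normD _ _))// lerD//.
by rewrite normrM ler_wpM2l.
Qed.

Lemma sum_phi_integrable (tau : {finite_measure set B -> \bar R}) M (a : nat -> R) :
  tau.-integrable setT (EFin \o (fun x : B => \sum_(k < M) a k * phi k x)).
Proof.
have [N N0 hN] := sum_phi_bounded M a.
exact: (bounded_integrable tau (sum_phi_measurable M a) hN).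
Qed.

Lemma sum_phi_Lp p M (a : nat -> R) : (1 <= p)%E ->
  Lp mu p (fun x : B => \sum_(k < M) a k * phi k x).
Proof.
move=> p1; have [N N0 hN] := sum_phi_bounded M a.
by have [] := @Lp_bounded _ _ _ mu p _ N p1 N0 (sum_phi_measurable M a) hN.
Qed.

Lemma fhat_sum_phi M (a : nat -> R) k :
  fhat mu phi (fun x => \sum_(j < M) a j * phi j x) k = if (k < M)%N then a k else 0.
Proof.
elim: M => [|M IH].
  rewrite ltn0 /fhat; under eq_Rintegral do rewrite big_ord0 mul0r.
  by rewrite Rintegral_cst// mul0r.
have -> : (fun x => \sum_(j < M.+1) a j * phi j x) =
  (fun x => (\sum_(j < M) a j * phi j x) + a M * phi M x).
  by apply/funext => x; rewrite big_ord_recr.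
have phi_i := phi_integrable dds M.
rewrite fhatD; first last.
- exact: (integrableZl measurableT (a M) phi_i).
- exact: sum_phi_integrable.
rewrite IH fhatZ// /fhat (dds_phi_orthonormal dds) ltnS [in RHS]leq_eqVlt.
have [->|kM] := eqVneq k M; first by rewrite ltnn add0r mulr1.
by rewrite mulr0 addr0.
Qed.

End multiplier_operator.

Section multop_kernel.
Context (R : realType) (X : ptopologicalType) (rho : X -> X -> R)
  (mu : probability (borelType X) R) (lam : nat -> R) (phi : nat -> X -> R)
  (q k1 k2 k3 k4 : R).
Hypothesis dds : data_defined_space rho mu lam phi q k1 k2 k3 k4.
Local Notation B := (borelType X).

Lemma mult_kernelC F m M x y :
  mult_kernel lam phi F m M x y = mult_kernel lam phi F m M y x.
Proof. by apply: eq_bigr => k _; rewrite [phi k x * _]mulrC. Qed.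

Lemma mult_kernel_measurable F m M :
  measurable_fun setT (fun z : B * B => mult_kernel lam phi F m M z.1 z.2).
Proof.
apply: measurable_sum => k; apply: measurable_funM => //.
apply: measurable_funM.
  exact: (measurableT_comp (measurable_phi dds k) measurable_fst).
exact: (measurableT_comp (measurable_phi dds k) measurable_snd).
Qed.

Lemma mult_kernel_measurable2 F m M x :
  measurable_fun setT (fun y : B => mult_kernel lam phi F m M x y).
Proof.
apply: measurable_sum => k; apply: measurable_funM => //.
apply: measurable_funM => //; exact: (measurable_phi dds).
Qed.

Lemma mult_kernel_integrable F m M x (h : B -> R) (c : R) :
  mu.-integrable setT (EFin \o h) ->
  (forall y, `|mult_kernel lam phi F m M x y| <= c) ->
  mu.-integrable setT (EFin \o (fun y : B => mult_kernel lam phi F m M x y * h y)).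
Proof.
move=> hi Kc; have bd : [bounded mult_kernel lam phi F m M x y : R | y in [set: B]].
  exists c; split; first exact: num_real.
  by move=> N MN y _ /=; rewrite (le_trans (Kc y))// ltW.
exact: (integrableMr measurableT (mult_kernel_measurable2 F m M x) bd hi).
Qed.

Lemma multop_kernelE F m (h : B -> R) x : mu.-integrable setT (EFin \o h) ->
  multop mu lam phi F m h x =
  \int[mu]_(y in setT) (mult_kernel lam phi F m (freq_count lam m) x y * h y).
Proof.
move=> hi; rewrite /multop /mult_kernel.
have phii k : mu.-integrable setT (EFin \o (fun y : B =>
    F (expR (- (lam k ^+ 2 * m ^- 2))) * phi k x * (h y * phi k y))).
  exact: (integrableZl measurableT _ (phi_mul_integrable dds k hi)).
have sumi M : mu.-integrable setT (EFin \o (fun y : B => (\sum_(k < M)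
    F (expR (- (lam k ^+ 2 * m ^- 2))) * (phi k x * phi k y)) * h y)).
  elim: M => [|M IH].
    apply: (eq_integrable measurableT (cst 0%E)); last exact: integrable0.
    by move=> y _; rewrite /= big_ord0 mul0r.
  have h1 := integrableD measurableT IH (phii M).
  apply: (eq_integrable measurableT) h1.
  by move=> y _; rewrite /= big_ord_recr/= -EFinD; congr EFin; ring.
elim: (freq_count lam m) => [|M IH].
  rewrite big_ord0; under eq_Rintegral do rewrite big_ord0 mul0r.
  by rewrite Rintegral_cst// mul0r.
rewrite big_ord_recr/= IH.
have -> : F (expR (- (lam M ^+ 2 * m ^- 2))) * fhat mu phi h M * phi M x =
  \int[mu]_(y in setT) (F (expR (- (lam M ^+ 2 * m ^- 2))) * phi M x * (h y * phi M y)).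
  rewrite RintegralZl//; last exact: (phi_mul_integrable dds M hi).
  by rewrite /fhat; ring.
rewrite -(RintegralD measurableT (sumi M) (phii M)).
by apply: eq_Rintegral => y _; rewrite big_ord_recr/=; ring.
Qed.

Lemma multop_abs_le F m (h : B -> R) x (c : R) : mu.-integrable setT (EFin \o h) ->
  (forall y, `|mult_kernel lam phi F m (freq_count lam m) x y| <= c) ->
  (`|multop mu lam phi F m h x|%:E <=
    \int[mu]_y (`|mult_kernel lam phi F m (freq_count lam m) x y| * `|h y|)%:E)%E.
Proof.
move=> hi Kc; rewrite multop_kernelE//.
have gi := mult_kernel_integrable hi Kc.
rewrite EFin_normr_Rintegral//; apply: (le_trans (le_abse_integral mu measurableT _)).
  exact: measurable_int gi.
by under eq_integral do rewrite /= normrM.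
Qed.

Lemma multop_measurable F m h : measurable_fun setT (multop mu lam phi F m h : B -> R).
Proof.
exact: (sum_phi_measurable dds (freq_count lam m) (fun k =>
  F (expR (- (lam k ^+ 2 * m ^- 2))) * fhat mu phi h k)).
Qed.

Lemma freq_count_sum F m M (a : nat -> R) : 0 < m ->
  (forall u, u <= expR (-1) -> F u = 0) -> (forall k, (M <= k)%N -> m <= lam k) ->
  \sum_(k < freq_count lam m) F (expR (- (lam k ^+ 2 * m ^- 2))) * a k =
  \sum_(k < M) F (expR (- (lam k ^+ 2 * m ^- 2))) * a k.
Proof.
move=> m0 F0 Mlam.
have F0k k : m <= lam k -> F (expR (- (lam k ^+ 2 * m ^- 2))) = 0.
  move=> mk; apply: F0; rewrite ler_expR lerN2.
  rewrite -[1](@mulfV _ (m ^+ 2)) ?gt_eqF ?exprn_gt0//.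
  rewrite ler_wpM2r ?invr_ge0 ?exprn_ge0 ?(ltW m0)// lerXn2r ?nnegrE ?(ltW m0)//.
  by rewrite (le_trans _ mk) ?ltW.
have ext N N' : (N <= N')%N -> (forall k, (N <= k)%N -> m <= lam k) ->
    \sum_(k < N) F (expR (- (lam k ^+ 2 * m ^- 2))) * a k =
    \sum_(k < N') F (expR (- (lam k ^+ 2 * m ^- 2))) * a k.
  move=> NN' Nlam; rewrite -!(big_mkord xpredT (fun k => F (expR (- (lam k ^+ 2 * m ^- 2))) * a k)).
  rewrite [in RHS](big_cat_nat (leq0n N) NN')//=.
  rewrite [X in _ = _ + X]big_nat_cond [X in _ = _ + X]big1 ?addr0// => k /andP[/andP[Nk _] _].
  by rewrite F0k ?mul0r// Nlam.
have fc k : (freq_count lam m <= k)%N -> m <= lam k by exact: (freq_countP dds).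
by have [h|/ltnW h] := leqP (freq_count lam m) M; [exact: ext|apply/esym/ext].
Qed.

End multop_kernel.

Section multop_bounds.
Context (R : realType).

Lemma Lp_norm_le d (T : measurableType d) (mu : probability T R) (f : T -> R) (r M : R) :
  0 < r -> 0 <= M -> (\int[mu]_x (`|f x| `^ r)%:E <= (M `^ r)%:E)%E ->
  ('N[mu]_r%:E [EFin \o f] <= M%:E)%E.
Proof.
move=> r0 M0 hi; rewrite unlock /Lnorm.
rewrite (eq_integral (fun x => (`|f x| `^ r)%:E)); last by [].
have I0 : (0 <= \int[mu]_x (`|f x| `^ r)%:E)%E.
  by apply: integral_ge0 => x _; rewrite lee_fin powR_ge0.
move: hi I0; case: (\int[mu]_x _)%E => [I| |]//; rewrite !lee_fin => hi I0.
rewrite -[leRHS](powRr1 M0) -(mulfV (lt0r_neq0 r0)) powRrM.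
by rewrite ge0_ler_powR ?nnegrE ?powR_ge0// invr_ge0 ltW.
Qed.

Lemma inve_conjugate (r : R) : 1 <= r ->
  fine (r%:E^-1)%E = r^-1 /\ fine ((hoelder_conjugate r%:E)^-1)%E = 1 - r^-1.
Proof.
move=> r1; have r0 : 0 < r by exact: lt_le_trans r1.
have rE : (r%:E^-1 = (r^-1)%:E)%E by rewrite inver gt_eqF.
split; first by rewrite rE.
have := @hoelder_conjugate_eq1 R r%:E (ltNyr _).
rewrite eqe gt_eqF// rE => /(_ isT); case: ((hoelder_conjugate r%:E)^-1)%E => //= x.
by rewrite -EFinD => -[<-]; rewrite addrC addKr.
Qed.

(** Boundedness on [L^p] is the Schur test with [tau = mu]. Against a general [tau] the test
    controls the [L^p] norm, and Jensen with weight 1 passes to [L^1], which produces the exponents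
    [1 / p] and [1 - 1 / p]. The constant precedes [p], so the result can be used with several
    exponents at once. *)
Lemma multop_bounds (T : Type) (F : T -> R -> R) (s : nat) (D q k1 k2 k3 k4 : R) :
  0 <= D -> 0 < k2 -> 0 < k3 -> 0 < k4 -> q + 1 <= s%:R ->
  smooth (s + s) `]-1, 2[ F -> (forall i u, u <= expR (-1) -> F i u = 0) ->
  exists2 c : R, 0 < c &
  forall (X : ptopologicalType) (rho : X -> X -> R)
  (mu : probability (borelType X) R) (lam : nat -> R) (phi : nat -> X -> R),
  data_defined_space rho mu lam phi q k1 k2 k3 k4 ->
  (forall x y, rho x y <= D) ->
  forall i (m : R) (h : borelType X -> R) p, 1 <= m -> (1 <= p)%E -> Lp mu p h ->
  (Lpnorm mu p (multop mu lam phi (F i) m h) <= c%:E * Lpnorm mu p h)%E /\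
  forall (tau : {finite_measure set (borelType X) -> \bar R}) (C : R), 0 <= C ->
    (forall y j, (tau (qball rho y (2 ^+ j / m)) <= (C * (2 ^+ j) `^ q)%:E)%E) ->
    (\int[tau]_x `|multop mu lam phi (F i) m h x|%:E <=
      (c * (m `^ q * C) `^ fine (p^-1)%E *
        fine (tau setT) `^ fine ((hoelder_conjugate p)^-1)%E)%:E * Lpnorm mu p h)%E.
Proof.
move=> D0 k20 k30 k40 qs sF F0.
have [c0 c00 hc0] := kernel_decay q D0 k30 k40 sF F0.
pose w : R := 1 + 2 * 2 `^ q.
have w0 : 0 < w by rewrite ltr_pwDl// mulr_ge0// powR_ge0.
pose b := c0 * k2 * w.
have b0 : 0 < b by rewrite !mulr_gt0.
(* Dominates both [b] and [c0 * w], hence also their geometric means with weights [1 - 1 / p] and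
   [1 / p], for every [p]. *)
pose c := b + c0 * w.
have cw0 : 0 < c0 * w by rewrite mulr_gt0.
have cc0 : 0 < c by rewrite addr_gt0.
exists c => // X rho mu lam phi dds rhoD i m h p m1 p1 hp.
have m0 : 0 < m by exact: lt_le_trans m1.
have mq0 : 0 < m `^ q by rewrite powR_gt0.
have hi := Lp_integrable p1 hp.
pose M := freq_count lam m.
pose K (z : borelType X * borelType X) := `|mult_kernel lam phi (F i) m M z.1 z.2|.
have Kb z : 0 <= K z <= c0 * m `^ q.
  rewrite normr_ge0/=.
  by have [] := hc0 _ _ _ _ _ _ _ dds rhoD i m M z.1 z.2 m1 (@freq_countP _ _ _ _ _ _ _ _ _ _ _ dds m).
have mK : measurable_fun setT K.
  by apply: measurableT_comp => //; exact: (mult_kernel_measurable dds).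
have Kint (tau : {finite_measure set (borelType X) -> \bar R}) C y : 0 <= C ->
    (forall y j, (tau (qball rho y (2 ^+ j / m)) <= (C * (2 ^+ j) `^ q)%:E)%E) ->
    (\int[tau]_x (K (x, y))%:E <= (c0 * m `^ q * C * w)%:E)%E.
  move=> C0 tauC; apply: (integral_decay dds m0 _ C0 qs _ (tauC y)).
  - by rewrite mulr_ge0// ltW.
  - exact: measurable_fun_pair1.
  - by move=> x; exact: Kb.
  - move=> x j hj; have [_ h2] := hc0 _ _ _ _ _ _ _ dds rhoD i m M x y m1 (@freq_countP _ _ _ _ _ _ _ _ _ _ _ dds m).
    by apply: h2; rewrite (dds_rhoC dds).
have q0 := dds_q_gt0 dds.
have mub y j : (mu (qball rho y (2 ^+ j / m)) <= (k2 * m `^ (- q) * (2 ^+ j) `^ q)%:E)%E.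
  rewrite (le_trans (dds_ball_measure dds y _))// ?divr_gt0 ?exprn_gt0// lee_fin.
  have im0 : 0 <= m^-1 by rewrite invr_ge0 ltW.
  rewrite (powRM _ (exprn_ge0 _ _) im0)// -(powR_inv1 (ltW m0)) -powRrM mulN1r.
  by rewrite mulrAC mulrA.
have Kmu y : (\int[mu]_x (K (x, y))%:E <= b%:E)%E.
  have := Kint mu (k2 * m `^ (- q)) y _ mub.
  rewrite mulr_ge0 ?powR_ge0 ?(ltW k20)// => /(_ isT); rewrite powRN.
  by rewrite (_ : _ * w = b)// /b; field; rewrite gt_eqF.
have Kmu2 x : (\int[mu]_y (K (x, y))%:E <= b%:E)%E.
  apply: le_trans (Kmu x); rewrite le_eqVlt; apply/orP; left; apply/eqP.
  by apply: eq_integral => y _; rewrite /K/= mult_kernelC.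
have mK2 x : measurable_fun setT (fun y : borelType X => K (x, y)).
  exact: (measurable_fun_pair2 x mK).
pose g x := `|multop mu lam phi (F i) m h x|.
have mg : measurable_fun setT (g : borelType X -> R).
  by apply: measurableT_comp => //; exact: (multop_measurable dds).
have mh : measurable_fun setT h by case: hp.
have mah : measurable_fun setT (fun y => `|h y|) by exact: measurableT_comp.
have gK x : ((g x)%:E <= \int[mu]_y (K (x, y) * `|h y|)%:E)%E.
  apply: (multop_abs_le dds hi (c := c0 * m `^ q)) => y.
  by have /andP[] := Kb (x, y).
pose N := fine (Lpnorm mu p h).
have NE : Lpnorm mu p h = N%:E by exact: Lp_norm_fin.
have N0 : 0 <= N by rewrite fine_ge0// Lnorm_ge0.
rewrite NE; case: p p1 hp N NE N0 => [r| |//]; last first.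
  move=> _ _ N NE N0.
  (* For the infinite exponent the kernel's mass bounds the operator pointwise, at every point and
     not just almost everywhere. *)
  have hN : \forall y \ae mu, `|h y| <= N.
    move: NE; rewrite /Lpnorm unlock /Lnorm; case: ifPn => [_ NE|]; last first.
      by move=> /negP[]; rewrite [X in (_ < X)%E](probability_setT mu) lte01.
    have := ess_sup_ge mu (abse \o (EFin \o h)); rewrite NE.
    by apply: filterS => y; rewrite /= lee_fin.
  have gbN x : g x <= b * N.
    rewrite -lee_fin (le_trans (gK x))//.
    apply: (@le_trans _ _ (\int[mu]_y ((K (x, y))%:E * N%:E))%E).
      apply: ae_ge0_le_integral => //.
      + by move=> y _; rewrite lee_fin mulr_ge0//; case/andP: (Kb (x, y)).
      + by apply/measurable_EFinP; apply: measurable_funM; [exact: mK2|].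
      + by move=> y _; rewrite lee_fin mulr_ge0//; case/andP: (Kb (x, y)).
      + by apply/measurable_EFinP; apply: measurable_funM; [exact: mK2|exact: measurable_cst].
      + apply: filterS hN => y hy _; rewrite -EFinM lee_fin ler_wpM2l//.
        by case/andP: (Kb (x, y)).
    under eq_integral do rewrite muleC.
    rewrite ge0_integralZl_EFin//; first last.
    + by apply/measurable_EFinP; exact: mK2.
    + by move=> y _; rewrite lee_fin; case/andP: (Kb (x, y)).
    by rewrite muleC EFinM lee_wpmul2r// lee_fin.
  have bc : b * N <= c * N by rewrite ler_wpM2r// lerDl ltW.
  split.
    have [_] := @Lp_bounded _ _ _ mu +oo%E (multop mu lam phi (F i) m h : borelType X -> R)
      (c * N) (leey _) (mulr_ge0 (ltW cc0) N0) (multop_measurable dds _ _ _)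
      (fun x => le_trans (gbN x) bc).
    by rewrite EFinM.
  move=> tau C C0 tauC.
  rewrite hoelder_conjugatey inve1 invey/= powRr0 mulr1 powRr1 ?fine_ge0//.
  apply: (le_trans (integral_le_cst tau measurableT mg (a := c * N) _)).
    by move=> x _; rewrite normr_ge0/= (le_trans (gbN x)).
  rewrite -[X in (_ * X <= _)%E]fineK ?fin_num_measure// -!EFinM lee_fin.
  by rewrite mulrAC.
rewrite lee_fin => r1 hp N NE N0.
have r0 : 0 < r by exact: lt_le_trans r1.
have ir0 : 0 <= r^-1 by rewrite invr_ge0 ltW.
have ir1 : r^-1 <= 1 by rewrite invf_le1.
have HH : (\int[mu]_x (`|h x| `^ r)%:E = (N `^ r)%:E)%E.
  by have := Lp_powR r0 hp; rewrite -/(Lpnorm mu r%:E h) NE.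
split.
  rewrite -EFinM; apply: Lp_norm_le => //; first by rewrite mulr_ge0// ltW.
  apply: (le_trans (schur_test (tau := mu) r1 (ltW b0) b0 mK Kb mah (fun=> normr_ge0 _) mg (fun=> normr_ge0 _) Kmu2 Kmu gK HH)).
  rewrite lee_fin mulrA (_ : b `^ (r - 1) * b = b `^ r); last first.
    by rewrite -{2}(powRr1 (ltW b0)) -powRD ?(gt_eqF b0) ?implybT// subrK.
  have bN0 : 0 <= b * N by rewrite mulr_ge0// ltW.
  have bcN : b * N <= c * N by rewrite ler_wpM2r// lerDl ltW.
  by rewrite -(powRM _ (ltW b0) N0) ge0_ler_powR ?nnegrE ?(ltW r0)// (le_trans bN0).
move=> tau C C0 tauC; have [-> ->] := inve_conjugate r1.
pose t0 := fine (tau setT).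
have tE : tau setT = t0%:E by rewrite fineK// fin_num_measure.
have t00 : 0 <= t0 by rewrite fine_ge0.
rewrite -/t0 -EFinM.
(* A null measure is set apart because [weighted_jensen] asks for a positive mass bound. *)
have [tz|tnz] := eqVneq t0 0.
  rewrite null_set_integral//; last 2 first.
  - by apply/measurable_EFinP.
  - exact: (etrans tE (congr1 EFin tz)).
  by rewrite lee_fin !mulr_ge0 ?powR_ge0// ltW.
have tp : 0 < t0 by rewrite lt_neqAle eq_sym tnz.
pose a := c0 * m `^ q * C * w.
have a0 : 0 <= a by rewrite !mulr_ge0// ltW.
have := schur_test (tau := tau) r1 a0 b0 mK Kb mah (fun=> normr_ge0 _) mg (fun=> normr_ge0 _) Kmu2
   (fun y => Kint tau C y C0 tauC) gK HH.
move=> hs.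
have m1' : measurable_fun setT (cst 1 : borelType X -> R) by exact: measurable_cst.
have J1 : (\int[tau]_x (cst (1 : R) x * g x `^ r)%:E <= (b `^ (r - 1) * (a * N `^ r))%:E)%E.
  by apply: le_trans hs; under eq_integral do rewrite /= mul1r.
have w1 : (\int[tau]_x (cst (1 : R) x)%:E <= t0%:E)%E.
  by rewrite (integral_cst tau measurableT 1%E) mul1e (_ : _ setT = t0%:E).
have [I [IE I0 Ip]] := weighted_jensen r1 tp m1' mg (fun=> ler01) (fun=> normr_ge0 _) w1 J1.
have -> : (\int[tau]_x `|multop mu lam phi (F i) m h x|%:E = I%:E)%E.
  by rewrite -IE; apply: eq_integral => x _; rewrite /= mul1r.
rewrite lee_fin.
have Ir : I = (I `^ r) `^ r^-1 by rewrite -powRrM mulfV ?gt_eqF// powRr1.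
have aN : 0 <= a * N `^ r by rewrite mulr_ge0 ?powR_ge0.
have baN : 0 <= b `^ (r - 1) * (a * N `^ r) by rewrite mulr_ge0 ?powR_ge0.
have rhs0 : 0 <= t0 `^ (r - 1) * (b `^ (r - 1) * (a * N `^ r)).
  by rewrite mulr_ge0 ?powR_ge0.
rewrite Ir; apply: (le_trans (ge0_ler_powR ir0 _ _ Ip)); rewrite ?nnegrE ?powR_ge0//.
have e1 (x : R) : 0 <= x -> (x `^ (r - 1)) `^ r^-1 = x `^ (1 - r^-1).
  by move=> x0; rewrite -powRrM mulrBl mulfV ?gt_eqF// mul1r.
rewrite (powRM _ (powR_ge0 _ _) baN) (powRM _ (powR_ge0 _ _) aN) (powRM _ a0 (powR_ge0 _ _)).
rewrite !e1 ?(ltW b0)// -(powRrM N) mulfV ?gt_eqF// powRr1//.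
have mqC : 0 <= m `^ q * C by rewrite mulr_ge0// ltW.
have -> : a = (c0 * w) * (m `^ q * C) by rewrite /a; ring.
rewrite (powRM _ (ltW cw0) mqC).
have cE : c = c `^ (1 - r^-1) * c `^ r^-1.
  by rewrite -powRD ?(gt_eqF cc0) ?implybT// subrK powRr1// ltW.
have h1 : b `^ (1 - r^-1) * (c0 * w) `^ r^-1 <= c.
  rewrite [leRHS]cE ler_pM ?powR_ge0// ge0_ler_powR ?nnegrE ?subr_ge0 ?(ltW b0) ?(ltW cc0) ?(ltW cw0)//.
    by rewrite lerDl ltW.
  by rewrite lerDr ltW.
rewrite [leLHS](_ : _ = (b `^ (1 - r^-1) * (c0 * w) `^ r^-1) *
  ((m `^ q * C) `^ r^-1 * t0 `^ (1 - r^-1) * N)); last by ring.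
rewrite [leRHS](_ : _ = c * ((m `^ q * C) `^ r^-1 * t0 `^ (1 - r^-1) * N)); last by ring.
by rewrite ler_wpM2r// !mulr_ge0 ?powR_ge0.
Qed.

End multop_bounds.

(** * Cutoffs and the Jackson estimate *)

Section cutoff.
Context (R : realType).

(** In terms of frequencies, with [u = exp (- (lam / m) ^ 2)]: it is 1 for [lam <= m / 2] and 0 for
    [lam >= m]. *)
Definition cutoff (S : nat) (u : R) : R :=
  smoothstep S ((u - expR (-1)) / (expR (- 4^-1) - expR (-1))).

Let den0 : 0 < expR (- 4^-1) - expR (-1) :> R.
Proof. by rewrite subr_gt0 ltr_expR; lra. Qed.

Lemma cutoff_eq0 S u : u <= expR (-1) -> cutoff S u = 0.
Proof.
move=> u1; apply: smoothstep_eq0.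
by rewrite pmulr_lle0 ?invr_gt0// subr_le0.
Qed.

Lemma cutoff_eq1 S u : expR (- 4^-1) <= u -> cutoff S u = 1.
Proof.
move=> u1; apply: smoothstep_eq1.
by rewrite ler_pdivlMr// mul1r lerD2r.
Qed.

Lemma smooth_cutoff (T : Type) S (U : set R) (B : R) : (forall u, U u -> `|u| <= B) ->
  smooth S U (fun (_ : T) => cutoff S).
Proof.
move=> UB; set d := expR (- 4^-1) - expR (-1) : R.
apply: (@smooth_comp _ _ S U [set x | `|x| <= (B + 1) / d] (fun _ => smoothstep S)
  (fun _ u => (u - expR (-1)) / d)).
- move=> _ u /UB uB /=; rewrite normrM normfV (ger0_norm (ltW den0)) ler_pM2r ?invr_gt0//.
  by rewrite (le_trans (ler_normB _ _))// lerD// ger0_norm ?expR_ge0//.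
- exact: smooth_smoothstep.
- apply: smoothM; last exact: smooth_cst.
  by apply: smoothB; [apply: smooth_id; exists B|exact: smooth_cst].
Qed.

Lemma smooth_param (T : Type) S (U : set R) (c : T -> R) (K : R) :
  (forall i, `|c i| <= K) -> smooth S U (fun i (_ : R) => c i).
Proof.
move=> cK; case: S => [|S] /=; first by split=> //; exists K => i _ _.
split; first by exists K => i _ _.
by exists (fun _ _ => 0); split=> [i x _|]; [exact: is_derive_cst|exact: smooth_cst].
Qed.

(* With [u = exp (- (lam / m) ^ 2)] and [e = 1 / m], the base of the negative
   power is [(lam + 1) / m]. *)
Definition block (S : nat) (r : R) (e : {e : R | 0 <= e <= 1}) (u : R) : R :=
  cutoff S u * (1 - cutoff S (u ^+ 4)) * ((- ln u) `^ 2^-1 + sval e) `^ (- r).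

Lemma block_eq0 S r e u : u <= expR (-1) -> block S r e u = 0.
Proof. by move=> u1; rewrite /block (cutoff_eq0 _ u1) !mul0r. Qed.

(** The two cutoffs confine [u] to the interval from [exp (-1)] to [exp (- 1/16)]. There the square
    root of [- ln u] lies between 1/4 and 1, so the base of the negative power lies between 1/4 and
    2 and all bounds are uniform in [e]. This parameter is why families of functions are
    considered. *)
Lemma smooth_block S r : smooth S `]-1, 2[ (block S r).
Proof.
pose a : R := expR (-1); pose b : R := expR (- 16^-1).
have a0 : 0 < a by exact: expR_gt0.
have b0 : 0 < b by exact: expR_gt0.
apply: (@smooth_supp _ _ S _ [set x | a <= x <= b] `[a, b]).
- exact: interval_open.
- exact: interval_closed.
- by move=> x; rewrite /= in_itv.
- move=> _ x _; rewrite /= in_itv/= => nab.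
  have [xa|ax] := leP x a; first by rewrite cutoff_eq0// mul0r.
  rewrite [cutoff S (x ^+ 4)]cutoff_eq1 ?subrr ?mulr0//.
  have bx : b < x by rewrite ltNge; apply/negP => xb; apply: nab; rewrite (ltW ax).
  rewrite (_ : expR (- 4^-1) = b ^+ 4); last by rewrite -expRM_natl; congr expR; lra.
  by rewrite lerXn2r ?nnegrE ?(ltW bx) ?(ltW b0)// (le_trans (ltW b0))// ltW.
- have vrange (x : R) : a <= x <= b -> 16^-1 <= - ln x <= 1.
    move=> /andP[ax xb]; have x0 : 0 < x by exact: lt_le_trans ax.
    rewrite lerNr lerNl -[- 16^-1]expRK -[-1]expRK !ler_ln ?posrE ?expR_gt0//.
    by rewrite ax xb.
  have srange (y : R) : 16^-1 <= y <= 1 -> 4^-1 <= y `^ 2^-1 <= 1.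
    move=> /andP[y0 y1]; have y00 : 0 <= y by apply: le_trans y0.
    rewrite powR12_sqrt//; apply/andP; split; last by rewrite -sqrtr1 ler_wsqrtr.
    by rewrite -(@ger0_norm _ (4^-1))// -sqrtr_sqr ler_wsqrtr//; apply: le_trans y0; lra.
  apply: (@smooth_comp _ _ S _ [set x | 4^-1 <= x <= 2] (fun _ x => x `^ (- r))
    (fun e u => (- ln u) `^ 2^-1 + sval e)).
  + move=> [e /= /andP[e0 e1]] x /= /vrange/srange/andP[h1 h2]; lra.
  + exact: smooth_powR.
  apply: smoothD; last first.
    apply: (@smooth_param _ _ _ _ 1) => -[e /= /andP[e0 e1]].
    by rewrite ger0_norm.
  apply: (@smooth_comp _ _ S _ [set x | 16^-1 <= x <= 1] (fun _ x => x `^ 2^-1)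
    (fun _ u => - ln u)).
  + by move=> _ x /vrange.
  + exact: smooth_powR.
  + by apply: smoothN; exact: smooth_ln.
- have U2 (u : R) : `]-1, 2[%classic u -> `|u| <= 2.
    by rewrite /= in_itv/= => /andP[u1 u2]; rewrite ler_norml; lra.
  apply: smoothM; first exact: smooth_cutoff U2.
  apply: smoothB; first exact: smooth_cst.
  apply: (@smooth_comp _ _ S _ [set x | `|x| <= 2 ^+ 4] (fun _ => cutoff S)
    (fun _ u => u ^+ 4)).
  + by move=> _ x /U2 xU /=; rewrite normrX lerXn2r ?nnegrE.
  + by apply: (@smooth_cutoff _ _ _ (2 ^+ 4)).
  + by apply: smoothX; apply: smooth_id; exists 2.
Qed.

(** Halving the scale turns [u] into [u ^ 4], and [cutoff S u] is 1 wherever [cutoff S (u ^+ 4)] is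
    nonzero, so the difference factors as in [block]. The factor [(lam + 1) ^ r] is then the
    multiplier of [Delta^r]. *)
Lemma cutoff_block S r (lam m : R) (m21 : 0 <= (2 * m)^-1 <= 1) : 0 <= lam -> 1 <= m ->
  cutoff S (expR (- (lam ^+ 2 * (2 * m) ^- 2))) - cutoff S (expR (- (lam ^+ 2 * m ^- 2))) =
  (2 * m) `^ (- r) * block S r (exist _ (2 * m)^-1 m21) (expR (- (lam ^+ 2 * (2 * m) ^- 2)))
    * (lam + 1) `^ r.
Proof.
move=> lam0 m1; have m0 : 0 < m by exact: lt_le_trans m1.
set M := 2 * m in m21 *; have M0 : 0 < M by rewrite mulr_gt0.
set u := expR (- (lam ^+ 2 * M ^- 2)).
have u4 : expR (- (lam ^+ 2 * m ^- 2)) = u ^+ 4.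
  by rewrite -expRM_natl /M; congr expR; field; rewrite gt_eqF.
have u0 : 0 < u by exact: expR_gt0.
rewrite u4 /block/= expRK opprK.
have -> : (lam ^+ 2 * M ^- 2) `^ 2^-1 = lam / M.
  have -> : lam ^+ 2 * M ^- 2 = (lam / M) ^+ 2 by rewrite expr_div_n.
  have lM : 0 <= lam / M by rewrite divr_ge0// ltW.
  by rewrite -powR_mulrn// -powRrM mulfV ?powRr1.
have l1 : 0 < lam + 1 by rewrite ltr_wpDl.
have -> : lam / M + M^-1 = (lam + 1) * M^-1 by field; rewrite gt_eqF.
have iM0 : 0 <= M^-1 by rewrite invr_ge0 ltW.
rewrite (powRM _ (ltW l1) iM0) -(powR_inv1 (ltW M0)) -powRrM mulN1r opprK !powRN.
have Mr : M `^ r != 0 by rewrite gt_eqF// powR_gt0.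
have lr : (lam + 1) `^ r != 0 by rewrite gt_eqF// powR_gt0.
have -> (a : R) : (M `^ r)^-1 * (a * (((lam + 1) `^ r)^-1 * M `^ r)) * (lam + 1) `^ r = a.
  by field; rewrite Mr lr.
have [uS|uS] := leP (u ^+ 4) (expR (-1)).
  by rewrite (cutoff_eq0 _ uS) !subr0 mulr1.
rewrite (@cutoff_eq1 S u) ?mul1r//.
rewrite leNgt; apply/negP => h; move: uS; rewrite ltNge => /negP; apply.
rewrite (_ : expR (-1) = expR (- 4^-1) ^+ 4); last by rewrite -expRM_natl; congr expR; lra.
by rewrite lerXn2r ?nnegrE ?expR_ge0 ?(ltW u0)// ltW.
Qed.

End cutoff.

Section jackson.
Context (R : realType) (X : ptopologicalType) (rho : X -> X -> R)
  (mu : probability (borelType X) R) (lam : nat -> R) (phi : nat -> X -> R)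
  (q k1 k2 k3 k4 : R).
Hypothesis dds : data_defined_space rho mu lam phi q k1 k2 k3 k4.
Local Notation B := (borelType X).
Variables (p : \bar R) (r : R) (S : nat) (c1 c2 : R).
Hypotheses (p1 : (1 <= p)%E) (r0 : 0 < r) (c10 : 0 < c1) (c20 : 0 < c2).
Local Notation sigma := (multop mu lam phi (cutoff S)).
Local Notation norm := (Lpnorm mu p).
Hypothesis norm_sigma : forall m (h : B -> R), 1 <= m -> Lp mu p h ->
  (norm (sigma m h) <= c1%:E * norm h)%E.
Hypothesis norm_block : forall e m (h : B -> R), 1 <= m -> Lp mu p h ->
  (norm (multop mu lam phi (block S r e) m h) <= c2%:E * norm h)%E.

Lemma lam_ge0 k : 0 <= lam k.
Proof. by rewrite -(dds_lam0 dds); exact: (dds_lam_nondecreasing dds). Qed.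

Lemma cutoff_hf_eq0 m k : 0 < m -> m <= lam k ->
  cutoff S (expR (- (lam k ^+ 2 * m ^- 2))) = 0.
Proof.
move=> m0 mk; apply: cutoff_eq0; rewrite ler_expR lerN2.
rewrite -[1](@mulfV _ (m ^+ 2)) ?gt_eqF ?exprn_gt0//.
by rewrite ler_wpM2r ?invr_ge0 ?exprn_ge0 ?(ltW m0)// lerXn2r ?nnegrE ?(ltW m0)// lam_ge0.
Qed.

Lemma sigmaE m M (h : X -> R) x : 0 < m -> (forall k, (M <= k)%N -> m <= lam k) ->
  sigma m h x = \sum_(k < M) cutoff S (expR (- (lam k ^+ 2 * m ^- 2))) *
    fhat mu phi h k * phi k x.
Proof.
move=> m0 Mlam; rewrite /multop.
under eq_bigr do rewrite -mulrA; under [RHS]eq_bigr do rewrite -mulrA.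
exact: (freq_count_sum dds (fun k => fhat mu phi h k * phi k x) m0 (@cutoff_eq0 R S) Mlam).
Qed.

Lemma fhat_sigma m (h : X -> R) k : 0 < m -> fhat mu phi (sigma m h) k =
  cutoff S (expR (- (lam k ^+ 2 * m ^- 2))) * fhat mu phi h k.
Proof.
move=> m0; have := fhat_sum_phi dds (freq_count lam m) (fun k =>
  cutoff S (expR (- (lam k ^+ 2 * m ^- 2))) * fhat mu phi h k) k.
rewrite /multop => ->; have [//|km] := ltnP k (freq_count lam m).
by rewrite cutoff_hf_eq0 ?mul0r//; exact: (freq_countP dds).
Qed.

Lemma Pi_sigma m (h : X -> R) : 0 < m -> Pi lam phi m (sigma m h).
Proof.
move=> m0; exists (freq_count lam m), (fun k =>
  cutoff S (expR (- (lam k ^+ 2 * m ^- 2))) * fhat mu phi h k).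
apply/funext => x; rewrite /multop [RHS]big_mkcond/=; apply: eq_bigr => k _.
by case: ltP => // mk; rewrite cutoff_hf_eq0 ?mul0r.
Qed.

Lemma PiE n P : Pi lam phi n P -> exists M (a : nat -> R),
  P = fun x => \sum_(k < M) a k * phi k x.
Proof.
move=> [M [a ->]]; exists M, (fun k => if lam k < n then a k else 0).
apply/funext => x; rewrite big_mkcond/=; apply: eq_bigr => k _.
by case: ifP => // _; rewrite mul0r.
Qed.

Lemma Pi_Lp n P : Pi lam phi n P -> Lp mu p (P : B -> R).
Proof. by move=> /PiE[M [a ->]]; exact: (sum_phi_Lp dds M a p1). Qed.

Lemma sigma_Lp m h : 0 < m -> Lp mu p (sigma m h : B -> R).
Proof. by move=> m0; exact: Pi_Lp (Pi_sigma h m0). Qed.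

Lemma Xp_Lp f : Xp mu lam phi p f -> Lp mu p (f : B -> R).
Proof. by case. Qed.

Lemma Pi_Xp n P : Pi lam phi n P -> Xp mu lam phi p P.
Proof.
move=> PP; have [mP fP] := Pi_Lp PP; split=> // e e0; exists P; first by exists n.
rewrite (_ : P \- P = cst 0); last by apply/funext => x /=; rewrite subrr.
rewrite /Lpnorm (_ : EFin \o cst 0 = cst 0%E)// Lnorm0 ?lte_fin// gt_eqF//.
by rewrite (lt_le_trans lte01).
Qed.

Lemma sigma_Xp m h : 0 < m -> Xp mu lam phi p (sigma m h).
Proof. by move=> m0; exact: Pi_Xp (Pi_sigma h m0). Qed.

Lemma sigmaB m (f g : B -> R) : Lp mu p f -> Lp mu p g ->
  sigma m (f \- g) = sigma m f \- sigma m g.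
Proof.
move=> fp gp; have fi := Lp_integrable p1 fp; have gi := Lp_integrable p1 gp.
apply/funext => x; rewrite /multop /= -sumrB; apply: eq_bigr => k _.
have -> : fhat mu phi (f \- g) k = fhat mu phi f k - fhat mu phi g k.
  rewrite -[in RHS]mulN1r -(fhatZ dds (-1) k gi) -(fhatD dds)//.
    by congr fhat; apply/funext => y /=; rewrite mulN1r.
  exact: (integrableZl measurableT (-1) gi).
by rewrite mulrBr mulrBl.
Qed.

(** Once [m] is at least twice all frequencies of [P], the cutoff is 1 on them. *)
Lemma sigma_Pi n P : Pi lam phi n P -> exists2 m0 : R, 1 <= m0 &
  forall m, m0 <= m -> sigma m P = P.
Proof.
move=> /PiE[M [a ->]]; exists (Num.max 1 (2 * lam M)); first by rewrite le_max lexx.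
move=> m; rewrite ge_max => /andP[m1 mM]; have m0 : 0 < m by exact: lt_le_trans m1.
apply/funext => x.
rewrite (@sigmaE m (M + freq_count lam m)%N)//; last first.
  move=> k /(leq_trans (leq_addl _ _)); exact: (freq_countP dds).
rewrite -(big_mkord xpredT (fun k => cutoff S (expR (- (lam k ^+ 2 * m ^- 2))) *
  fhat mu phi (fun x => \sum_(k < M) a k * phi k x) k * phi k x)).
rewrite (big_cat_nat (leq0n M) (leq_addr _ M))//= [X in _ + X]big_nat_cond.
rewrite [X in _ + X]big1 ?addr0 ?big_mkord; last first.
  by move=> k /andP[/andP[Mk _] _]; rewrite (fhat_sum_phi dds) ltnNge Mk/= mulr0 mul0r.
apply: eq_bigr => k _; rewrite (fhat_sum_phi dds) ltn_ord cutoff_eq1 ?mul1r//.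
rewrite ler_expR lerN2 ler_pdivrMr ?exprn_gt0//.
have kM : 2 * lam k <= m.
  rewrite (le_trans _ mM)// ler_wpM2l//; apply: (dds_lam_nondecreasing dds).
  exact: ltnW.
have := lam_ge0 k; nra.
Qed.

(** Density of polynomials together with uniform boundedness: for large [m] the error of [f] is that
    of [f - P], at most [1 + c1] times its norm. *)
Lemma sigma_approx f e : Xp mu lam phi p f -> 0 < e -> exists2 m0 : R, 1 <= m0 &
  forall m, m0 <= m -> (norm (f \- sigma m f)%R <= e%:E)%E.
Proof.
move=> fX e0; have fp := Xp_Lp fX.
have e'0 : 0 < e / (1 + c1) by rewrite divr_gt0// addr_gt0.
have [_ _ /(_ _ e'0)[P [n Pn] fP]] := fX.
have Pp := Pi_Lp Pn; have [m0 m01 mP] := sigma_Pi Pn.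
exists m0 => // m mm0; have m1 : 1 <= m by exact: le_trans mm0.
have [fPp _] := LpB p1 fp Pp.
have -> : (f \- sigma m f)%R = ((f \- P) \- sigma m (f \- P))%R.
  rewrite sigmaB// mP//; apply/funext => x /=; ring.
have sp := @sigma_Lp m (f \- P)%R (lt_le_trans ltr01 m1).
have [_] := LpB p1 fPp sp.
move=> /le_trans; apply; apply: (@le_trans _ _ ((1 + c1)%:E * norm (f \- P)%R)%E).
  have NE : norm (f \- P)%R = (fine (norm (f \- P)%R))%:E by exact: Lp_norm_fin.
  have := norm_sigma m1 fPp; rewrite -/(Lpnorm mu p _) NE -!EFinM mulrDl mul1r EFinD.
  by move=> h; rewrite leeD// -NE.
rewrite -[e](@divfK _ (1 + c1)) ?gt_eqF ?addr_gt0// mulrC EFinM.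
by rewrite lee_wpmul2l ?lee_fin ?addr_ge0 ?(ltW c10)// ltW.
Qed.

(** The difference of two consecutive scales is [(2 m) ^ (- r)] times a block operator applied to
    [g], a version of [Delta^r f]. *)
Lemma sigma_doubling m f g : 1 <= m -> is_Delta mu lam phi p r f g ->
  (norm (sigma (2 * m) f \- sigma m f)%R <= ((2 * m) `^ (- r) * c2)%:E * norm g)%E.
Proof.
move=> m1 [gX fg]; have m0 : 0 < m by exact: lt_le_trans m1.
have M1 : 1 <= 2 * m by lra.
have M0 : 0 < 2 * m by exact: lt_le_trans M1.
have iM : 0 <= (2 * m)^-1 <= 1 by rewrite invr_ge0 (ltW M0) invf_le1.
pose F := block S r (exist _ (2 * m)^-1 iM).
have -> : (sigma (2 * m) f \- sigma m f)%R =
    (fun x => (2 * m) `^ (- r) * multop mu lam phi F (2 * m) g x)%R.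
  apply/funext => x /=; rewrite (@sigmaE m (freq_count lam (2 * m)))//; last first.
    move=> k /(freq_countP dds); lra.
  rewrite /multop -sumrB mulr_sumr; apply: eq_bigr => k _.
  by rewrite fg -!mulrBl (cutoff_block S r iM (lam_ge0 k) m1) -/F; ring.
have gp := Xp_Lp gX.
have Fp : Lp mu p (multop mu lam phi F (2 * m) g : B -> R).
  split; first exact: (multop_measurable dds).
  rewrite (le_lt_trans (norm_block _ M1 gp))// /Lpnorm (Lp_norm_fin gp) -EFinM ltry//.
have [_] := LpZ ((2 * m) `^ (- r)) p1 Fp.
rewrite -/(Lpnorm mu p _) => ->; rewrite ger0_norm ?powR_ge0// EFinM -muleA.
by rewrite lee_wpmul2l ?lee_fin ?powR_ge0// norm_block.
Qed.

Let jackson_const : R := c2 / (1 - 2 `^ (- r)).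

Let two_r : 0 < (2 : R) `^ (- r) < 1.
Proof.
have h : (1 : R) `^ r < 2 `^ r by rewrite gt0_ltr_powR ?nnegrE ?ltr1n.
by rewrite powR1 in h; rewrite powR_gt0//= powRN invf_lt1 ?powR_gt0.
Qed.

(** Summing [sigma_doubling] over the scales [2 ^ J m] gives a geometric series of ratio
    [2 ^ (- r)]; [sigma_approx] closes the telescope. *)
Lemma jackson m f g : 1 <= m -> Xp mu lam phi p f -> is_Delta mu lam phi p r f g ->
  (norm (f \- sigma m f)%R <= (jackson_const * m `^ (- r))%:E * norm g)%E.
Proof.
move=> m1 fX fg; have m0 : 0 < m by exact: lt_le_trans m1.
have gp := Xp_Lp (proj1 fg); have fp := Xp_Lp fX.
have /andP[t0 t1] := two_r; set t := 2 `^ (- r) in t0 t1.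
have pow2 J : 0 < 2 ^+ J * m by rewrite mulr_gt0 ?exprn_gt0.
have pow21 J : 1 <= 2 ^+ J * m by rewrite mulr_ege1// exprn_ege1// ler1n.
pose N := fine (norm g); have NE : norm g = N%:E by exact: Lp_norm_fin.
have N0 : 0 <= N by rewrite fine_ge0// Lnorm_ge0.
have tele J : (norm (sigma (2 ^+ J * m) f \- sigma m f)%R <=
    (c2 * m `^ (- r) * N * ((1 - t ^+ J) / (1 - t)))%:E)%E.
  elim: J => [|J IH].
    rewrite expr0 mul1r (_ : _ \- _ = cst 0); last by apply/funext => x /=; rewrite subrr.
    rewrite /Lpnorm (_ : EFin \o cst 0 = cst 0%E)// Lnorm0 ?expr0 ?subrr ?mul0r ?mulr0//.
    by rewrite gt_eqF// (lt_le_trans lte01).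
  have s1 := @sigma_Lp (2 ^+ J.+1 * m) f (pow2 _).
  have s2 := @sigma_Lp (2 ^+ J * m) f (pow2 _).
  have s3 := @sigma_Lp m f m0.
  have [d12 _] := LpB p1 s1 s2; have [d23 _] := LpB p1 s2 s3.
  have -> : (sigma (2 ^+ J.+1 * m) f \- sigma m f)%R =
    ((sigma (2 ^+ J.+1 * m) f \- sigma (2 ^+ J * m) f) \+
     (sigma (2 ^+ J * m) f \- sigma m f))%R by apply/funext => x /=; ring.
  apply: (le_trans (eminkowski mu (proj1 d12) (proj1 d23) p1)).
  have := sigma_doubling (pow21 J) fg; rewrite mulrA -exprS NE => h.
  apply: (le_trans (leeD h IH)); rewrite -EFinD lee_fin.
  have -> : (2 ^+ J.+1 * m) `^ (- r) = t ^+ J.+1 * m `^ (- r).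
    rewrite (powRM _ (exprn_ge0 _ _) (ltW m0))//; congr (_ * _).
    have e2 : (2 : R) ^+ J.+1 = 2 `^ J.+1%:R by rewrite powR_mulrn.
    have et : t ^+ J.+1 = t `^ J.+1%:R by rewrite powR_mulrn// ltW.
    by rewrite e2 et /t -!powRrM mulrC.
  have -> : 1 - t ^+ J.+1 = (1 - t ^+ J) + t ^+ J * (1 - t) by rewrite exprS; ring.
  rewrite [in leRHS]mulrDl mulfK ?gt_eqF ?subr_gt0// mulrDr addrC lerD2l.
  rewrite exprS [leLHS](_ : _ = c2 * m `^ (- r) * N * (t ^+ J * t)); last by ring.
  rewrite ler_wpM2l ?mulr_ge0 ?powR_ge0 ?(ltW c20)// ler_piMr ?exprn_ge0 ?(ltW t0)//.
  exact: ltW.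
apply/lee_addgt0Pr => e e0; have [m' m'1 hm'] := sigma_approx fX e0.
have [J hJ] := expr2n_large m'.
have mJ : m' <= 2 ^+ J * m by rewrite (le_trans hJ)// ler_peMr// exprn_ge0.
have s2 := @sigma_Lp (2 ^+ J * m) f (pow2 _).
have s3 := @sigma_Lp m f m0.
have [d12 _] := LpB p1 fp s2; have [d23 _] := LpB p1 s2 s3.
have -> : (f \- sigma m f)%R = ((f \- sigma (2 ^+ J * m) f) \+
     (sigma (2 ^+ J * m) f \- sigma m f))%R by apply/funext => x /=; ring.
apply: (le_trans (eminkowski mu (proj1 d12) (proj1 d23) p1)).
rewrite addeC leeD ?hm'// (le_trans (tele J))// NE -EFinM lee_fin.
rewrite /jackson_const -/t [leRHS](_ : _ = c2 * m `^ (- r) * N * (1 / (1 - t))); last by ring.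
rewrite ler_wpM2l ?mulr_ge0 ?powR_ge0 ?(ltW c20)// ler_wpM2r ?invr_ge0 ?subr_ge0 ?(ltW t1)//.
by rewrite gerBl exprn_ge0// ltW.
Qed.

Let sigma_const : R := 1 + c1 + jackson_const.

Let jackson_const_gt0 : 0 < jackson_const.
Proof. by case/andP: two_r => _ t1; rewrite divr_gt0// subr_gt0. Qed.

Let sigma_const_gt0 : 0 < sigma_const.
Proof. by rewrite !addr_gt0. Qed.

Lemma norm_ge0 f : (0 <= norm f)%E.
Proof. exact: Lnorm_ge0. Qed.

(** For each competitor [f1], boundedness handles [f - f1] and the Jackson estimate handles [f1]. *)
Lemma sigma_error_Kfunctional m f : 1 <= m -> Xp mu lam phi p f ->
  (norm (f \- sigma m f)%R <= sigma_const%:E * Kfunctional mu lam phi p r f m^-1)%E.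
Proof.
move=> m1 fX; have m0 : 0 < m by exact: lt_le_trans m1.
have fp := Xp_Lp fX.
rewrite -lee_pdivrMl//; apply: le_ereal_inf_tmp => _ [f1 [g [[f1X _] fg ->]]].
have f1p := Xp_Lp f1X; have gp := Xp_Lp (proj1 fg).
have [ffp _] := LpB p1 fp f1p.
have sf := sigma_Lp f m0; have sf1 := sigma_Lp f1 m0.
have [d1 _] := LpB p1 f1p sf1.
have [d2 d2E] := LpB p1 ffp (sigma_Lp (f \- f1) m0).
rewrite lee_pdivrMl//.
have -> : (f \- sigma m f)%R =
    (((f \- f1) \- sigma m (f \- f1)) \+ (f1 \- sigma m f1))%R.
  by rewrite sigmaB//; apply/funext => x /=; ring.
apply: (le_trans (eminkowski mu (proj1 d2) (proj1 d1) p1)).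
have [a aE a0] : exists2 a : R, norm (f \- f1)%R = a%:E & 0 <= a.
  by exists (fine (norm (f \- f1)%R)); [exact: Lp_norm_fin|rewrite fine_ge0// norm_ge0].
have [b bE b0] : exists2 b : R, norm g = b%:E & 0 <= b.
  by exists (fine (norm g)); [exact: Lp_norm_fin|rewrite fine_ge0// norm_ge0].
have h1 := jackson m1 f1X fg.
have h2 := le_trans d2E (leeD (lexx _) (norm_sigma m1 ffp)).
apply: (le_trans (leeD h2 h1)).
rewrite -/(norm (f \- f1)%R) aE bE -?EFinM -?EFinD -?EFinM -?EFinD lee_fin.
have mr : m^-1 `^ r = m `^ (- r).
  by rewrite -(powR_inv1 (ltW m0)) -powRrM mulN1r.
have b1 : 0 <= m `^ (- r) * b by rewrite mulr_ge0 ?powR_ge0.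
rewrite mr /sigma_const -mulrA.
have j0 := jackson_const_gt0; have c10' := c10.
have j1 : 0 <= jackson_const * a by rewrite mulr_ge0// ltW.
have j2 : 0 <= c1 * (m `^ (- r) * b) by rewrite mulr_ge0// ltW.
lra.
Qed.

Lemma Kfunctional_le_Hnorm gamma delta f : 0 < delta <= 1 ->
  (Kfunctional mu lam phi p r f delta <=
    (delta `^ gamma)%:E * Hnorm mu lam phi p gamma r f)%E.
Proof.
move=> d01; have d0 : 0 < delta by case/andP: d01.
have dg0 : 0 < delta `^ gamma by rewrite powR_gt0.
rewrite -lee_pdivrMl// -powRN.
apply: (@le_trans _ _ (ereal_sup [set ((delta `^ (- gamma))%:E *
   Kfunctional mu lam phi p r f delta)%E | delta in [set delta : R | 0 < delta <= 1]])).
  by apply: ereal_sup_ubound; exists delta.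
by rewrite leeDr// norm_ge0.
Qed.

Lemma sigma_error gamma m f : 1 <= m -> Hspace mu lam phi p gamma r f ->
  (norm (f \- sigma m f)%R <=
    (sigma_const * m `^ (- gamma))%:E * Hnorm mu lam phi p gamma r f)%E.
Proof.
move=> m1 [fX _]; have m0 : 0 < m by exact: lt_le_trans m1.
apply: (le_trans (sigma_error_Kfunctional m1 fX)).
rewrite EFinM -muleA lee_wpmul2l ?lee_fin ?(ltW sigma_const_gt0)//.
have m01 : 0 < m^-1 <= 1 by rewrite invr_gt0 m0 invf_le1.
have := Kfunctional_le_Hnorm gamma f m01.
by rewrite -(powR_inv1 (ltW m0)) -powRrM mulN1r powR_inv1// ltW.
Qed.

(** Multipliers commute with [Delta^r], so a competitor [(f1, g)] for [f] is carried to the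
    competitor [(sigma m f1, sigma m g)] for [sigma m f]. *)
Lemma Kfunctional_sigma m f delta : 1 <= m -> Xp mu lam phi p f ->
  (Kfunctional mu lam phi p r (sigma m f) delta <=
    c1%:E * Kfunctional mu lam phi p r f delta)%E.
Proof.
move=> m1 fX; have m0 : 0 < m by exact: lt_le_trans m1.
have fp := Xp_Lp fX.
rewrite -lee_pdivrMl//; apply: le_ereal_inf_tmp => _ [f1 [g [[f1X _] fg ->]]].
have f1p := Xp_Lp f1X; have gp := Xp_Lp (proj1 fg).
have [ffp _] := LpB p1 fp f1p.
rewrite lee_pdivrMl//.
have sg : is_Delta mu lam phi p r (sigma m f1) (sigma m g).
  split; first exact: sigma_Xp.
  by move=> k; rewrite !fhat_sigma// (proj2 fg); ring.
apply: (@le_trans _ _ (norm (sigma m f \- sigma m f1)%R +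
    (delta `^ r)%:E * norm (sigma m g))%E).
  apply: ereal_inf_lbound; exists (sigma m f1), (sigma m g); split => //.
  by split; [exact: sigma_Xp|exists (sigma m g)].
rewrite -sigmaB//.
have NE : norm (f \- f1)%R = (fine (norm (f \- f1)%R))%:E by exact: Lp_norm_fin.
have NE' : norm g = (fine (norm g))%:E by exact: Lp_norm_fin.
rewrite ge0_muleDr ?norm_ge0// ?mule_ge0 ?norm_ge0 ?lee_fin ?powR_ge0//.
apply: leeD; first exact: norm_sigma.
by rewrite muleCA lee_wpmul2l ?lee_fin ?powR_ge0// norm_sigma.
Qed.

Lemma Hnorm_sigma gamma m f : 1 <= m -> Xp mu lam phi p f ->
  (Hnorm mu lam phi p gamma r (sigma m f) <= c1%:E * Hnorm mu lam phi p gamma r f)%E.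
Proof.
move=> m1 fX; have m0 : 0 < m by exact: lt_le_trans m1.
have fp := Xp_Lp fX.
have K0 delta : (0 <= Kfunctional mu lam phi p r f delta)%E.
  apply: le_ereal_inf_tmp => _ [f1 [g [_ _ ->]]].
  by rewrite adde_ge0 ?norm_ge0// mule_ge0 ?norm_ge0 ?lee_fin ?powR_ge0.
rewrite /Hnorm; set sup := ereal_sup [set (_ * Kfunctional _ _ _ _ _ f _)%E | _ in _].
have sup0 : (0 <= sup)%E.
  apply: (@le_trans _ _ ((1 `^ (- gamma))%:E * Kfunctional mu lam phi p r f 1)%E).
    by rewrite mule_ge0 ?K0// lee_fin powR_ge0.
  by apply: ereal_sup_ubound; exists 1 => //=; rewrite ltr01 lexx.
rewrite ge0_muleDr ?norm_ge0//; apply: leeD; first exact: norm_sigma.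
apply: ge_ereal_sup => _ [delta /= d01 <-].
apply: (@le_trans _ _ ((delta `^ (- gamma))%:E * (c1%:E * Kfunctional mu lam phi p r f delta))%E).
  by rewrite lee_wpmul2l ?lee_fin ?powR_ge0// Kfunctional_sigma.
rewrite muleCA lee_wpmul2l ?lee_fin ?(ltW c10)//.
by apply: ereal_sup_ubound; exists delta.
Qed.

End jackson.

(** * Integration against complete signed measures *)

Section borel_trace.
Context (R : realType) (X : ptopologicalType) (G : set (set X)).
Local Notation T := (g_sigma_algebraType G).
Local Notation B := (borelType X).

Lemma measurable_trace : @open X `<=` <<s G >> -> measurable_fun setT (id : T -> B).
Proof.
move=> openG _ Y mY; rewrite setTI.
suff : <<s @open X >> `<=` <<s G >> by exact.
by apply: smallest_sub => //; exact: smallest_sigma_algebra.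
Qed.

(** The restriction to Borel sets, built as the pushforward under the identity. It makes the kernel
    estimates, which live on the Borel sigma-algebra, available for measures defined on a larger
    one. *)
Lemma borel_trace_exists (m : {measure set T -> \bar R}) :
  @open X `<=` <<s G >> -> (m setT < +oo)%E ->
  exists tau : {finite_measure set B -> \bar R},
  (forall A : set B, tau A = m A) /\
  forall h : B -> \bar R, measurable_fun setT h -> (forall x, 0 <= h x)%E ->
   (\int[tau]_x h x = \int[m]_x h x)%E.
Proof.
move=> openG mT; have mid := measurable_trace openG.
pose tau0 : {measure set B -> \bar R} :=
  measure_function_pushforward__canonical__measure_function_Measure m mid.
have fin : fin_num_fun tau0.
  move=> A mA; rewrite ge0_fin_numE//; apply: le_lt_trans mT.
  have mA' : measurable ((id : T -> B) @^-1` A) by rewrite -[X in measurable X]setTI; exact (mid measurableT A mA).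
  suff : (m ((id : T -> B) @^-1` A) <= m setT)%E by exact.
  by apply: le_measure; rewrite ?inE.
pose tau : {finite_measure set B -> \bar R} := HB.pack_for (FiniteMeasure.type B R)
  (Measure.sort tau0) (Measure_isFinite.Build _ _ _ (Measure.sort tau0) fin).
exists tau; split => // h mh h0.
transitivity (\int[tau0]_x h x)%E; first by apply: eq_measure_integral.
by rewrite (ge0_integral_pushforward mid).
Qed.

End borel_trace.

Section signed_integral.
Context (R : realType) (X : ptopologicalType).
Local Notation B := (borelType X).
Variable nu : complete_borel_measure R X.
Local Notation T := (g_sigma_algebraType (cbm_gen nu)).
Hypothesis nuT : (variation_measure nu setT < +oo)%E.

Let measurable_cbm (h : B -> R) : measurable_fun setT h -> measurable_fun setT (h : T -> R).
Proof.
by move=> mh; exact: (measurableT_comp mh (measurable_trace (@cbm_borel _ _ nu))).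
Qed.

Let bounded_int (m : {measure set T -> \bar R}) (h : T -> R) (M : R) :
  (m setT < +oo)%E -> measurable_fun setT h -> (forall x, `|h x| <= M) ->
  m.-integrable setT (EFin \o h).
Proof.
move=> mT mh hM; apply: measurable_bounded_integrable => //.
exists M; split; first exact: num_real.
by move=> N MN x _ /=; rewrite (le_trans (hM x))// ltW.
Qed.

Lemma sp_integralB (f g : B -> R) (M : R) : measurable_fun setT f -> measurable_fun setT g ->
  (forall x, `|f x| <= M) -> (forall x, `|g x| <= M) ->
  sp_integral nu (fun x => f x - g x) = sp_integral nu f - sp_integral nu g.
Proof.
move=> /measurable_cbm mf /measurable_cbm mg fM gM; move: nuT.
rewrite /sp_integral; case: (cbm_measure nu) => [sg|m] /= mT.
- set P := jordan_pos _; set N := jordan_neg _.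
  have PT : (P setT < +oo)%E by rewrite ltey_eq fin_num_measure.
  have NT : (N setT < +oo)%E by rewrite ltey_eq fin_num_measure.
  rewrite (RintegralB measurableT (bounded_int PT mf fM) (bounded_int PT mg gM)).
  rewrite (RintegralB measurableT (bounded_int NT mf fM) (bounded_int NT mg gM)).
  ring.
- by rewrite (RintegralB measurableT (bounded_int mT mf fM) (bounded_int mT mg gM)).
Qed.

(** For a signed measure the variation is the sum of the two Jordan parts, and the triangle
    inequality is applied to their difference. *)
Lemma sp_integral_le (tau : {finite_measure set B -> \bar R}) (f : B -> R) (M : R) :
  (forall h : B -> \bar R, measurable_fun setT h -> (forall x, 0 <= h x)%E ->
   (\int[tau]_x h x = \int[variation_measure nu]_x h x)%E) ->
  measurable_fun setT f -> (forall x, `|f x| <= M) ->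
  (`|sp_integral nu f|%:E <= \int[tau]_x `|f x|%:E)%E.
Proof.
move=> tauE mf fM; rewrite tauE//; last exact/measurable_EFinP/measurableT_comp.
have {}mf := measurable_cbm mf; move: nuT {tauE}.
rewrite /sp_integral; case: (cbm_measure nu) => [sg|m] /= mT.
- set P := jordan_pos _; set N := jordan_neg _.
  have PT : (P setT < +oo)%E by rewrite ltey_eq fin_num_measure.
  have NT : (N setT < +oo)%E by rewrite ltey_eq fin_num_measure.
  have mfa : measurable_fun setT (fun x : T => (`|f x|)%:E).
    by apply/measurable_EFinP; exact: measurableT_comp.
  rewrite (@eq_measure_integral _ _ _ _ (measure_add P N)); last first.
    by move=> A mA _; rewrite [RHS]measure_addE.
  rewrite ge0_integral_measure_add//.
  have int_le (m : {measure set T -> \bar R}) : (m setT < +oo)%E ->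
      ((`|\int[m]_(x in setT) f x|)%:E <= \int[m]_x (`|f x|)%:E)%E.
    move=> mT'; rewrite (EFin_normr_Rintegral measurableT (bounded_int mT' mf fM)).
    by apply: (le_trans (le_abse_integral m measurableT _)) => //; apply/measurable_EFinP.
  apply: (@le_trans _ _ ((`|\int[P]_(x in setT) f x|)%:E + (`|\int[N]_(x in setT) f x|)%:E)%E).
    by rewrite -EFinD lee_fin ler_normB.
  by apply: leeD; exact: int_le.
- have fi := bounded_int mT mf fM.
  rewrite EFin_normr_Rintegral//; apply: (le_trans (le_abse_integral m measurableT _)) => //.
  by apply/measurable_EFinP.
Qed.

End signed_integral.

(** * Tail estimate and quadrature error *)

Section tail.
Context (R : realType) (X : ptopologicalType) (rho : X -> X -> R)
  (mu : probability (borelType X) R) (lam : nat -> R) (phi : nat -> X -> R)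
  (q k1 k2 k3 k4 : R).
Hypothesis dds : data_defined_space rho mu lam phi q k1 k2 k3 k4.
Local Notation B := (borelType X).
Variables (p : \bar R) (gamma r : R) (S : nat) (c1 c2 : R).
Hypotheses (p1 : (1 <= p)%E) (r0 : 0 < r) (c10 : 0 < c1) (c20 : 0 < c2).
Local Notation sigma := (multop mu lam phi (cutoff S)).
Local Notation norm := (Lpnorm mu p).
Local Notation ip s := (fine (s^-1)%E).
Local Notation ip' s := (fine ((hoelder_conjugate s)^-1)%E).
Hypothesis norm_sigma : forall m (h : B -> R), 1 <= m -> Lp mu p h ->
  (norm (sigma m h) <= c1%:E * norm h)%E.
Hypothesis norm_block : forall e m (h : B -> R), 1 <= m -> Lp mu p h ->
  (norm (multop mu lam phi (block S r e) m h) <= c2%:E * norm h)%E.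
Hypothesis trace_sigma : forall s m (h : B -> R), 1 <= m -> (1 <= s)%E -> Lp mu s h ->
  forall (tau : {finite_measure set B -> \bar R}) C, 0 <= C ->
  (forall y j, tau (qball rho y (2 ^+ j / m)) <= (C * (2 ^+ j) `^ q)%:E)%E ->
  (\int[tau]_x `|sigma m h x|%:E <=
    (c1 * (m `^ q * C) `^ ip s * fine (tau setT) `^ ip' s)%:E * Lpnorm mu s h)%E.
Hypotheses (ip0 : 0 <= ip p) (ip_gamma : q * ip p < gamma).

Let c' : R := 1 + c1 + c2 / (1 - 2 `^ (- r)).

Lemma sigma_const_gt0 : 0 < c'.
Proof.
have h : (1 : R) `^ r < 2 `^ r by rewrite gt0_ltr_powR ?nnegrE ?ltr1n.
rewrite powR1 in h.
by rewrite !addr_gt0// divr_gt0// subr_gt0 powRN invf_lt1 ?powR_gt0.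
Qed.

Lemma q_gt0 : 0 < q. Proof. exact: (dds_q_gt0 dds). Qed.

Lemma gamma_gt0 : 0 < gamma.
Proof. by rewrite (le_lt_trans _ ip_gamma)// mulr_ge0// ltW// q_gt0. Qed.

Lemma Hnorm_fin f : Hspace mu lam phi p gamma r f -> exists2 H : R, 0 <= H &
  Hnorm mu lam phi p gamma r f = H%:E.
Proof.
move=> [fX fH].
have H0 : (0 <= Hnorm mu lam phi p gamma r f)%E.
  rewrite adde_ge0 ?norm_ge0//.
  apply: (@le_trans _ _ ((1 `^ (- gamma))%:E * Kfunctional mu lam phi p r f 1)%E).
    rewrite mule_ge0 ?lee_fin ?powR_ge0//.
    apply: le_ereal_inf_tmp => _ [f1 [g [_ _ ->]]].
    by rewrite adde_ge0 ?norm_ge0// mule_ge0 ?norm_ge0 ?lee_fin ?powR_ge0.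
  by apply: ereal_sup_ubound; exists 1 => //=; rewrite ltr01 lexx.
exists (fine (Hnorm mu lam phi p gamma r f)); first by rewrite fine_ge0.
by rewrite fineK// ge0_fin_numE.
Qed.

Lemma sigmaC m1 m2 f : 0 < m1 -> 0 < m2 ->
  sigma m1 (sigma m2 f) = sigma m2 (sigma m1 f).
Proof.
move=> m10 m20; apply/funext => x; pose M := (freq_count lam m1 + freq_count lam m2)%N.
have h1 k : (M <= k)%N -> m1 <= lam k.
  by move=> /(leq_trans (leq_addr _ _)); exact: (freq_countP dds).
have h2 k : (M <= k)%N -> m2 <= lam k.
  by move=> /(leq_trans (leq_addl _ _)); exact: (freq_countP dds).
rewrite (sigmaE dds S (sigma m2 f) x m10 h1) (sigmaE dds S (sigma m1 f) x m20 h2).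
by apply: eq_bigr => k _; rewrite !(fhat_sigma dds)//; ring.
Qed.

Lemma sigma_measurable m (f : B -> R) : measurable_fun setT (sigma m f : B -> R).
Proof. exact: (multop_measurable dds). Qed.

Lemma integral_normB (tau : {measure set B -> \bar R}) (f g : B -> R) :
  measurable_fun setT f -> measurable_fun setT g ->
  (\int[tau]_x `|f x - g x|%:E <= \int[tau]_x `|f x|%:E + \int[tau]_x `|g x|%:E)%E.
Proof.
move=> mf mg.
have mF : measurable_fun setT (fun x => `|f x|%:E) by exact/measurable_EFinP/measurableT_comp.
have mG : measurable_fun setT (fun x => `|g x|%:E) by exact/measurable_EFinP/measurableT_comp.
rewrite -ge0_integralD//; apply: ge0_le_integral => //.
- exact/measurable_EFinP/measurableT_comp/measurable_funB.
- exact: emeasurable_funD.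
- by move=> x _; rewrite -EFinD lee_fin ler_normB.
Qed.

(** The estimate against [tau] sees only the norm of the function fed to [sigma]; feeding it
    approximation errors instead of [f] brings in the factor [m ^ (- gamma)]. *)
Lemma block_integral m f (tau : {finite_measure set B -> \bar R}) C :
  1 <= m -> Hspace mu lam phi p gamma r f -> 0 <= C ->
  (forall y j, tau (qball rho y (2 ^+ j / m)) <= (C * (2 ^+ j) `^ q)%:E)%E ->
  (\int[tau]_x `|sigma (2 * m) f x - sigma m f x|%:E <=
    (2 * c1 * c' * ((2 * m) `^ q * C) `^ ip p * fine (tau setT) `^ ip' p *
     m `^ (- gamma))%:E * Hnorm mu lam phi p gamma r f)%E.
Proof.
move=> m1 fH C0 tauC; have m0 : 0 < m by exact: lt_le_trans m1.
have M1 : 1 <= 2 * m by lra.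
have M0 : 0 < 2 * m by exact: lt_le_trans M1.
have [H H0 HE] := Hnorm_fin fH; have fp := Xp_Lp (proj1 fH).
have s1 := sigma_Lp dds S p1 f m0; have s2 := sigma_Lp dds S p1 f M0.
have [d1 _] := LpB p1 fp s1; have [d2 _] := LpB p1 fp s2.
(* Since the operators commute, approximation errors can replace [f]. *)
have -> : (fun x => `|sigma (2 * m) f x - sigma m f x|%:E) =
   (fun x => `|sigma (2 * m) (f \- sigma m f)%R x - sigma m (f \- sigma (2 * m) f)%R x|%:E).
  apply/funext => x; rewrite (sigmaB dds S p1 _ fp s1) (sigmaB dds S p1 _ fp s2)/=.
  by rewrite (sigmaC f m0 M0); congr (`|_|%:E); ring.
apply: (le_trans (integral_normB tau _ _)); rewrite ?HE; try exact: sigma_measurable.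
pose U := ((2 * m) `^ q * C) `^ ip p; pose t := fine (tau setT) `^ ip' p.
have U0 : 0 <= U by exact: powR_ge0.
have t0 : 0 <= t by exact: powR_ge0.
have q0 := q_gt0; have g0 := gamma_gt0; have k0 := sigma_const_gt0.
have bound h V : Lp mu p (h : B -> R) -> V <= U ->
    (norm h <= (c' * m `^ (- gamma))%:E * H%:E)%E ->
    ((c1 * V * t)%:E * norm h <= (c1 * c' * U * t * m `^ (- gamma) * H)%:E)%E.
  move=> hp VU; have [a aE a0] : exists2 a : R, norm h = a%:E & 0 <= a.
    by exists (fine (norm h)); [exact: Lp_norm_fin|rewrite fine_ge0// norm_ge0].
  rewrite aE -!EFinM !lee_fin => ah.
  apply: (@le_trans _ _ (c1 * U * t * a)).
    by apply: ler_wpM2r => //; apply: ler_wpM2r => //; apply: ler_wpM2l => //; exact: ltW.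
  rewrite [leRHS](_ : _ = c1 * U * t * (c' * m `^ (- gamma) * H)); last by ring.
  apply: ler_wpM2l => //; apply: mulr_ge0 => //; apply: mulr_ge0 => //; exact: ltW.
have e1 := sigma_error dds p1 r0 c10 c20 norm_sigma norm_block m1 fH.
have e2 := sigma_error dds p1 r0 c10 c20 norm_sigma norm_block M1 fH.
rewrite HE -/c' in e1 e2.
have tauC2 y j : (tau (qball rho y (2 ^+ j / (2 * m))) <= (C * (2 ^+ j) `^ q)%:E)%E.
  apply: le_trans (tauC y j); apply: le_measure; rewrite ?inE; try exact: (measurable_qball dds).
  move=> z /=; rewrite /qball /= => /le_trans; apply.
  by rewrite ler_wpM2l ?exprn_ge0// lef_pV2 ?posrE//; lra.
have t1 := trace_sigma M1 p1 d1 C0 tauC2.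
have t2 := trace_sigma m1 p1 d2 C0 tauC.
apply: (le_trans (leeD t1 t2)).
have b1 := bound _ _ d1 (lexx U) e1.
have b2 := bound _ ((m `^ q * C) `^ ip p) d2.
have mM : m `^ q <= (2 * m) `^ q.
  by apply: ge0_ler_powR; rewrite ?nnegrE ?(ltW M0) ?(ltW m0) ?(ltW q0)//; lra.
apply: (le_trans (leeD b1 (b2 _ _))).
- apply: ge0_ler_powR; rewrite ?nnegrE ?mulr_ge0 ?powR_ge0//.
  exact: ler_wpM2r.
- apply: (le_trans e2); rewrite lee_wpmul2r ?lee_fin// ?lee_fin ler_wpM2l ?(ltW k0)// !powRN lef_pV2 ?posrE ?powR_gt0//.
  by rewrite ge0_ler_powR ?nnegrE ?(ltW M0) ?(ltW m0) ?(ltW g0)//; lra.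
rewrite -/U -/t -EFinD -EFinM lee_fin le_eqVlt; apply/orP; left; apply/eqP; ring.
Qed.

(** Doubling the scale costs [2 ^ (q / p)] in the estimate against [tau] and gains [2 ^ (- gamma)]
    in the error. *)
Let theta : R := 2 `^ (q * ip p - gamma).

Definition tail_const : R := 2 * c1 * c' * 2 `^ (q * ip p) / (1 - theta).

Lemma theta01 : 0 < theta < 1.
Proof.
rewrite powR_gt0//= /theta.
have h : (1 : R) `^ (gamma - q * ip p) < 2 `^ (gamma - q * ip p).
  by rewrite gt0_ltr_powR ?nnegrE ?ltr1n ?subr_gt0.
rewrite powR1 in h; rewrite -opprB powRN invf_lt1 ?powR_gt0//.
Qed.

Lemma tail_const_gt0 : 0 < tail_const.
Proof.
have /andP[_ t1] := theta01; have c'0 := sigma_const_gt0.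
by rewrite divr_gt0 ?subr_gt0// !mulr_gt0 ?powR_gt0.
Qed.

(** The block from [2 ^ J n] to [2 ^ J.+1 n] contributes a multiple of [theta ^ J], so the bound is
    independent of the number [J] of blocks. *)
Lemma tail_integral (n : R) (f : X -> R) (tau : {finite_measure set B -> \bar R}) (G : R) (J : nat) :
  1 <= n -> Hspace mu lam phi p gamma r f -> 0 <= G ->
  (forall y s, n^-1 <= s -> (tau (qball rho y s) <= (G * s `^ q)%:E)%E) ->
  (\int[tau]_x `|sigma (2 ^+ J * n) f x - sigma n f x|%:E <=
    (tail_const * G `^ ip p * fine (tau setT) `^ ip' p * n `^ (- gamma))%:E *
    Hnorm mu lam phi p gamma r f)%E.
Proof.
move=> n1 fH G0 tauG; have n0 : 0 < n by exact: lt_le_trans n1.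
have [H H0 HE] := Hnorm_fin fH; rewrite HE.
have /andP[t0 t1] := theta01; have q0 := q_gt0; have c'0 := sigma_const_gt0.
pose W := 2 * c1 * c' * 2 `^ (q * ip p) * G `^ ip p * fine (tau setT) `^ ip' p *
  n `^ (- gamma) * H.
have W0 : 0 <= W by rewrite !mulr_ge0 ?powR_ge0// ltW.
suff : (\int[tau]_x `|sigma (2 ^+ J * n) f x - sigma n f x|%:E <=
   (W * ((1 - theta ^+ J) / (1 - theta)))%:E)%E.
  move/le_trans; apply; rewrite -EFinM lee_fin /tail_const.
  rewrite [leRHS](_ : _ = W * (1 / (1 - theta))); last by rewrite /W; ring.
  rewrite ler_wpM2l// ler_wpM2r ?invr_ge0 ?subr_ge0 ?(ltW t1)//.
  by rewrite gerBl exprn_ge0// ltW.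
elim: J => [|J IH].
  rewrite expr0 mul1r expr0 subrr mul0r mulr0.
  under eq_integral do rewrite subrr normr0.
  by rewrite integral0.
set m := 2 ^+ J * n.
have m0 : 0 < m by rewrite mulr_gt0 ?exprn_gt0.
have m1 : 1 <= m by rewrite mulr_ege1// exprn_ege1// ler1n.
have nm : n <= m by rewrite ler_peMl ?(ltW n0)// exprn_ege1// ler1n.
rewrite exprS -mulrA -/m.
have -> : (fun x => `|sigma (2 * m) f x - sigma n f x|%:E) =
  (fun x => `|(sigma (2 * m) f x - sigma m f x) - (sigma n f x - sigma m f x)|%:E).
  by apply/funext => x; congr (`|_|%:E); ring.
apply: (le_trans (@integral_normB tau (fun x => sigma (2 * m) f x - sigma m f x)
  (fun x => sigma n f x - sigma m f x) _ _));
  try exact: (measurable_funB (sigma_measurable _ _) (sigma_measurable _ _)).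
under [X in (_ + X)%E]eq_integral do rewrite distrC.
(* Radii [2 ^ j / m] may be below [1 / n], where nothing is assumed, so the ball is first enlarged
   to radius [2 ^ j / n]. *)
have tauC y j : (tau (qball rho y (2 ^+ j / m)) <= (G * n `^ (- q) * (2 ^+ j) `^ q)%:E)%E.
  have nj : n^-1 <= 2 ^+ j / n by rewrite ler_peMl ?invr_ge0 ?(ltW n0)// exprn_ege1// ler1n.
  apply: (@le_trans _ _ (tau (qball rho y (2 ^+ j / n)))).
    apply: le_measure; rewrite ?inE; try exact: (measurable_qball dds).
    move=> z /=; rewrite /qball /= => /le_trans; apply.
    by rewrite ler_wpM2l ?exprn_ge0// lef_pV2 ?posrE.
  apply: (le_trans (tauG y _ nj)); rewrite lee_fin -mulrA ler_wpM2l//.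
  rewrite powRM ?exprn_ge0 ?invr_ge0 ?(ltW n0)// mulrC -(powR_inv1 (ltW n0)).
  by rewrite -powRrM mulN1r.
have GC0 : 0 <= G * n `^ (- q) by rewrite mulr_ge0 ?powR_ge0.
have := block_integral m1 fH GC0 tauC; rewrite HE => b.
apply: (le_trans (leeD b IH)); rewrite -EFinM -EFinD lee_fin.
have -> : ((2 * m) `^ q * (G * n `^ (- q))) `^ ip p =
    2 `^ (q * ip p) * (2 ^+ J) `^ (q * ip p) * G `^ ip p.
  rewrite /m (powRM _ _ (ltW m0))// (powRM _ _ (ltW n0)) ?exprn_ge0//.
  rewrite [X in X `^ _](_ : _ = 2 `^ q * (2 ^+ J) `^ q * G); last first.
    rewrite powRN; field; rewrite gt_eqF ?powR_gt0//.
  rewrite (powRM _ _ G0) ?mulr_ge0 ?powR_ge0// powRM ?powR_ge0//.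
  by rewrite -!powRrM.
have -> : m `^ (- gamma) = (2 ^+ J) `^ (- gamma) * n `^ (- gamma).
  by rewrite powRM ?exprn_ge0 ?(ltW n0).
have tJ : (2 ^+ J) `^ (q * ip p) * (2 ^+ J) `^ (- gamma) = theta ^+ J.
  rewrite -powRD; last by apply/implyP => _; rewrite gt_eqF ?exprn_gt0.
  have e2 : (2 : R) ^+ J = 2 `^ J%:R by rewrite powR_mulrn.
  have et : theta ^+ J = theta `^ J%:R by rewrite powR_mulrn// ltW.
  by rewrite e2 et /theta -!powRrM mulrC.
rewrite [X in X + _](_ : _ = W * theta ^+ J); last by rewrite -tJ /W; ring.
rewrite -mulrDr ler_wpM2l// exprS le_eqVlt; apply/orP; left; apply/eqP.
field; rewrite subr_eq0 gt_eqF//.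
Qed.

(** A bound at every point, from the estimate against a Dirac mass with infinite exponent, for which
    the growth constant [C] enters with power 0. *)
Lemma sigma_le m (h : B -> R) N : 1 <= m -> measurable_fun setT h -> 0 <= N ->
  (forall x, `|h x| <= N) -> forall x, `|sigma m h x| <= c1 * N.
Proof.
move=> m1 mh N0 hN x; have pinf : (1 <= +oo :> \bar R)%E by rewrite leey.
have [hp hpN] := Lp_bounded mu pinf N0 mh hN.
have q0 := q_gt0.
have qh y j : (\d_(x : B) (qball rho y (2 ^+ j / m)) <= (1 * (2 ^+ j) `^ q)%:E)%E.
  rewrite diracE lee_fin mul1r.
  apply: (@le_trans _ _ 1); first by case: (_ \in _).
  have : (1 : R) `^ q <= (2 ^+ j) `^ q.
    by rewrite ge0_ler_powR ?nnegrE ?exprn_ge0 ?(ltW q0)// exprn_ege1// ler1n.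
  by rewrite powR1.
have := trace_sigma m1 pinf hp ler01 qh.
rewrite integral_dirac//; last first.
  by apply/measurable_EFinP; apply: measurableT_comp => //; exact: sigma_measurable.
rewrite !diracE !in_setT mul1e invey hoelder_conjugatey inve1/= powRr0.
rewrite indicE in_setT powR1 !mulr1 => h1; rewrite -lee_fin EFinM.
by apply: (le_trans h1); rewrite lee_wpmul2l// lee_fin ltW.
Qed.

(* A Dirac mass satisfies the growth condition at scale [n^-1] with the constant
   [n `^ q]. *)
Lemma tail_sup n f J x : 1 <= n -> Hspace mu lam phi p gamma r f ->
  (`|sigma (2 ^+ J * n) f x - sigma n f x|%:E <=
    (tail_const * n `^ (q * ip p - gamma))%:E * Hnorm mu lam phi p gamma r f)%E.
Proof.
move=> n1 fH; have n0 : 0 < n by exact: lt_le_trans n1.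
have q0 := q_gt0.
have qh y s : n^-1 <= s -> (\d_(x : B) (qball rho y s) <= (n `^ q * s `^ q)%:E)%E.
  move=> ns; rewrite diracE lee_fin.
  apply: (@le_trans _ _ 1); first by case: (_ \in _).
  have s0 : 0 <= s by rewrite (le_trans _ ns)// invr_ge0 ltW.
  rewrite -powRM ?(ltW n0)//.
  have : (1 : R) `^ q <= (n * s) `^ q.
    rewrite ge0_ler_powR ?nnegrE ?mulr_ge0 ?(ltW q0) ?(ltW n0)//.
    by rewrite mulrC -ler_pdivrMr// mul1r.
  by rewrite powR1.
have := tail_integral J n1 fH (powR_ge0 _ _) qh.
rewrite integral_dirac//; last first.
  apply/measurable_EFinP; apply: measurableT_comp => //.
  by apply: measurable_funB; exact: sigma_measurable.
rewrite !diracE !in_setT mul1e/= indicE in_setT powR1 mulr1 => /le_trans; apply.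
rewrite -mulrA -powRrM -powRD//.
by apply/implyP => _; rewrite gt_eqF.
Qed.

Lemma tail_small f e : Hspace mu lam phi p gamma r f -> 0 < e ->
  exists K, forall J x, (K <= J)%N -> `|sigma (2 ^+ J) f x - sigma (2 ^+ K) f x| <= e.
Proof.
move=> fH e0; have [H H0 HE] := Hnorm_fin fH.
set a := gamma - q * ip p; have a0 : 0 < a by rewrite subr_gt0.
(* Once [(2 ^ K) ^ a >= b] the tail is at most [tail_const H / b], which is below [e]; the summand 1
   keeps [b] positive when [H] is 0. *)
set b := 1 + tail_const * H / e; have tc0 := tail_const_gt0.
have b1 : 1 <= b by rewrite lerDl divr_ge0 ?(ltW e0)// mulr_ge0// ltW.
have b0 : 0 < b by exact: lt_le_trans b1.
have [K hK] := expr2n_large (b `^ a^-1).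
exists K => J x KJ.
have K1 : 1 <= (2 : R) ^+ K by rewrite exprn_ege1// ler1n.
have := tail_sup (J - K) x K1 fH.
rewrite -exprD subnK// HE -EFinM lee_fin => /le_trans; apply.
have bK : b <= (2 ^+ K) `^ a.
  have -> : b = (b `^ a^-1) `^ a by rewrite -powRrM mulVf ?gt_eqF// powRr1// ltW.
  by apply: ge0_ler_powR; rewrite ?nnegrE ?exprn_ge0 ?powR_ge0 ?(ltW a0).
rewrite -opprB -/a powRN.
apply: (@le_trans _ _ (tail_const * b^-1 * H)).
  by rewrite ler_wpM2r// ler_wpM2l ?(ltW tc0)// lef_pV2 ?posrE ?powR_gt0 ?exprn_gt0//.
rewrite mulrAC ler_pdivrMr// /b mulrDr mulr1 mulrCA divff ?gt_eqF// mulr1.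
by rewrite lerDr ltW.
Qed.

(** * Continuous versions *)

Lemma continuous_approx (g : X -> R) :
  (forall e, 0 < e -> exists2 P : X -> R, continuous P & forall x, `|g x - P x| <= e) ->
  continuous g.
Proof.
move=> gP x; apply/cvgrPdist_le => e e0; have e3 : 0 < e / 3 by rewrite divr_gt0.
have [P cP gPe] := gP _ e3.
have /cvgrPdist_le/(_ _ e3) := cP x; apply: filterS => y Pxy.
have := gPe x; have := gPe y; move: Pxy; rewrite !ler_norml; lra.
Qed.

Lemma Pi_continuous n P : Pi lam phi n P -> continuous P.
Proof.
move=> /PiE[M [a ->]]; elim: M => [|M IH] x.
  by under eq_fun do rewrite big_ord0; exact: cvg_cst.
under eq_fun do rewrite big_ord_recr; apply: cvgD; first exact: IH.
by apply: cvgM; [exact: cvg_cst|exact: (dds_phi_continuous dds)].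
Qed.

(** The sequence [sigma (2 ^+ J) f] is uniformly Cauchy by [tail_small]. Its limit is continuous and
    equals [f] almost everywhere, because the same sequence converges to [f] in [L^p]. *)
Lemma continuous_version_exists f : Hspace mu lam phi p gamma r f ->
  is_continuous_version mu lam phi f (continuous_version mu lam phi f).
Proof.
move=> fH; rewrite /continuous_version; case: xgetP => [_ ->//|no].
exfalso; pose g x := limn (fun J => sigma (2 ^+ J) f x).
have gK e : 0 < e -> exists K, forall J x, (K <= J)%N -> `|g x - sigma (2 ^+ J) f x| <= e.
  move=> e0; have e2 : 0 < e / 2 by rewrite divr_gt0.
  have [K hK] := tail_small fH e2; exists K => J x KJ.
  have cv : cvgn (fun J => sigma (2 ^+ J) f x).
    apply/cauchy_cvgP/cauchy_exP => d d0; have d2 : 0 < d / 2 by rewrite divr_gt0.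
    have [K' hK'] := tail_small fH d2; exists (sigma (2 ^+ K') f x).
    exists K' => // i K'i; rewrite /ball/= distrC (le_lt_trans (hK' i x K'i))//.
    by rewrite ltr_pdivrMr// ltr_pMr// ltr1n.
  have near1 : \forall j \near \oo, sigma (2 ^+ j) f x <= sigma (2 ^+ K) f x + e / 2.
    by exists K => // j Kj; have := hK j x Kj; rewrite ler_norml; lra.
  have near2 : \forall j \near \oo, sigma (2 ^+ K) f x - e / 2 <= sigma (2 ^+ j) f x.
    by exists K => // j Kj; have := hK j x Kj; rewrite ler_norml; lra.
  have g1 : g x <= sigma (2 ^+ K) f x + e / 2 by exact: limr_le cv near1.
  have g2 : sigma (2 ^+ K) f x - e / 2 <= g x by exact: limr_ge cv near2.
  have := hK J x KJ; rewrite !ler_norml; lra.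
have gP e : 0 < e -> exists2 P, diffusion_polynomial lam phi P & forall x, `|g x - P x| <= e.
  move=> e0; have [K hK] := gK _ e0; exists (sigma (2 ^+ K) f); last by move=> x; exact: hK.
  by exists (2 ^+ K); exact: (Pi_sigma dds).
have cg : continuous g.
  apply: continuous_approx => e /gP[P [n Pn] gPe]; exists P => //; exact: Pi_continuous Pn.
have mg : measurable_fun setT (g : B -> R) := continuous_borel cg.
have fp := Xp_Lp (proj1 fH).
apply: (no g); split => //.
have sp J := sigma_Lp dds S p1 f (exprn_gt0 J (ltr0n R 2)).
have mfg : measurable_fun setT (EFin \o (f \- g)%R : B -> \bar R).
  by apply/measurable_EFinP/measurable_funB => //; exact: (proj1 fp).
have ng : norm (f \- g)%R = 0%E.
  apply/eqP; rewrite eq_le norm_ge0 andbT; apply/lee_addgt0Pr => e e0; rewrite add0e.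
  have e2 : 0 < e / 2 by rewrite divr_gt0.
  have [m0 _ hm0] := sigma_approx dds p1 c10 norm_sigma (proj1 fH) e2.
  have [K hK] := gK _ e2; have [K' hK'] := expr2n_large m0.
  pose J := (K + K')%N.
  have mJ : m0 <= 2 ^+ J.
    by rewrite (le_trans hK')// /J exprD ler_peMl ?exprn_ge0// exprn_ege1// ler1n.
  have msg : measurable_fun setT (sigma (2 ^+ J) f \- g : B -> R).
    by apply: measurable_funB => //; exact: sigma_measurable.
  have [_ hb] := Lp_bounded mu p1 (ltW e2) msg (fun x => le_trans
    (eq_ind_r (fun z => z <= `|g x - sigma (2 ^+ J) f x|) (lexx _) (distrC _ _))
    (hK J x (leq_addr _ _))).
  have -> : (f \- g)%R = ((f \- sigma (2 ^+ J) f) \+ (sigma (2 ^+ J) f \- g))%R.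
    by apply/funext => x /=; ring.
  have [d1 _] := LpB p1 fp (sp J).
  apply: (le_trans (eminkowski mu (proj1 d1) msg p1)).
  rewrite [e]splitr EFinD; apply: leeD => //; exact: hm0.
have p0 : (0 < p)%E by rewrite (lt_le_trans lte01).
have := Lnorm_eq0_eq0 mfg p0 ng; apply: filterS => x /= h.
by have /eqP := h I; rewrite eqe subr_eq0 => /eqP.
Qed.

Section version.
Variables (f V : X -> R).
Hypotheses (fH : Hspace mu lam phi p gamma r f)
  (fV : is_continuous_version mu lam phi f V).

Lemma version_measurable : measurable_fun setT (V : B -> R).
Proof. by apply: continuous_borel; case: fV. Qed.

Lemma version_bounded : exists2 N, 0 <= N & forall x, `|V x| <= N.
Proof.
have [_ /(_ _ ltr01)[P [n /PiE[M [a ->]]] VP] _] := fV.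
have [N N0 hN] := sum_phi_bounded dds M a; exists (N + 1); first by rewrite addr_ge0.
by move=> x; have := VP x; have := hN x; rewrite !ler_norml; lra.
Qed.

Lemma sigma_version m : sigma m V = sigma m f.
Proof.
have [_ _ ae] := fV; apply/funext => x; rewrite /multop; apply: eq_bigr => k _.
by rewrite (fhat_ae_eq dds k (Lp_integrable p1 (Xp_Lp (proj1 fH))) version_measurable ae).
Qed.

(** The version [V] is an arbitrary choice, not the limit built above, so convergence to it is
    proved anew: for large [m] the error is that of [V - P], with [P] uniformly close to [V], and
    [sigma_le] bounds it everywhere. *)
Lemma sigma_version_cvg e : 0 < e -> exists2 m0 : R, 1 <= m0 &
  forall m x, m0 <= m -> `|V x - sigma m f x| <= e.
Proof.
move=> e0; have e'0 : 0 < e / (1 + c1) by rewrite divr_gt0// addr_gt0.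
have [_ /(_ _ e'0)[P [n Pn] VP] _] := fV.
have [m0 m01 mP] := sigma_Pi dds S Pn; exists m0 => // m x mm0.
have m1 : 1 <= m by exact: le_trans mm0.
have mPB : measurable_fun setT (P : B -> R) := continuous_borel (Pi_continuous Pn).
have [N N0 VN] := version_bounded.
have [Vp _] := Lp_bounded mu p1 N0 version_measurable VN.
have mD : measurable_fun setT (V \- P : B -> R).
  by apply: measurable_funB => //; exact: version_measurable.
have := sigma_le m1 mD (ltW e'0) VP x.
rewrite (sigmaB dds S p1 _ Vp (Pi_Lp dds p1 Pn)) (mP _ mm0) sigma_version/= => h.
have := VP x; move: h; rewrite -[in X in _ -> _ -> is_true X](@divfK _ (1 + c1) _ e) ?gt_eqF ?addr_gt0//.
set d := e / _; rewrite !ler_norml mulrDr mulr1 [d * c1]mulrC; lra.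
Qed.

Lemma version_tail (n : R) (tau : {finite_measure set B -> \bar R}) (G : R) :
  1 <= n -> 0 <= G ->
  (forall y s, n^-1 <= s -> (tau (qball rho y s) <= (G * s `^ q)%:E)%E) ->
  (\int[tau]_x `|V x - sigma n f x|%:E <=
    (tail_const * G `^ ip p * fine (tau setT) `^ ip' p * n `^ (- gamma))%:E *
    Hnorm mu lam phi p gamma r f)%E.
Proof.
move=> n1 G0 tauG; apply/lee_addgt0Pr => e e0.
have n0 : 0 < n by exact: lt_le_trans n1.
pose t := fine (tau setT); have t0 : 0 <= t by rewrite fine_ge0.
(* A uniform error of this size integrates to at most [e], also when the mass [t] is 0. *)
have e1 : 0 < e / (1 + t) by rewrite divr_gt0// ltr_pwDl.
have [m0 _ hm0] := sigma_version_cvg e1; have [J hJ] := expr2n_large m0.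
have mJ : m0 <= 2 ^+ J * n by rewrite (le_trans hJ)// ler_peMr// exprn_ge0.
have mV := version_measurable.
have -> : (fun x => `|V x - sigma n f x|%:E) = (fun x =>
   `|(V x - sigma (2 ^+ J * n) f x) - (sigma n f x - sigma (2 ^+ J * n) f x)|%:E).
  by apply/funext => x; congr (`|_|%:E); ring.
apply: (le_trans (@integral_normB tau (fun x => V x - sigma (2 ^+ J * n) f x)
  (fun x => sigma n f x - sigma (2 ^+ J * n) f x) _ _)).
- by apply: measurable_funB => //; exact: sigma_measurable.
- by apply: measurable_funB; exact: sigma_measurable.
rewrite addeC; apply: leeD.
  under eq_integral do rewrite distrC.
  exact: tail_integral.
apply: (@le_trans _ _ ((e / (1 + t))%:E * tau setT)%E).
  rewrite -integral_cst//; apply: ge0_le_integral => //.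
  - apply/measurable_EFinP; apply: measurableT_comp => //.
    by apply: measurable_funB => //; exact: sigma_measurable.
  - by move=> x _; rewrite lee_fin hm0.
rewrite (_ : tau setT = t%:E); last by rewrite fineK// fin_num_measure.
rewrite -EFinM lee_fin mulrAC ler_pdivrMr ?ltr_pwDl//.
by rewrite ler_wpM2l ?(ltW e0)// lerDr.
Qed.

End version.

Let tc := tail_const.

Lemma regular_norm_bound (n : R) (nu : complete_borel_measure R X) : 1 <= n ->
  d_regular rho q n^-1 nu -> (variation_measure nu setT < +oo)%E ->
  (forall A : set B, measurable A -> (variation_measure nu A <= variation_measure nu setT)%E) ->
  0 <= regular_norm rho q n^-1 nu /\ forall x,
  (variation_measure nu (qball rho x n^-1) <=
    (regular_norm rho q n^-1 nu * n^-1 `^ q)%:E)%E.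
Proof.
move=> n1 nur nuT mono; have n0 : 0 < n by exact: lt_le_trans n1.
have dq : 0 < n^-1 `^ q by rewrite powR_gt0 ?invr_gt0.
have lb x : fine (variation_measure nu (qball rho x n^-1)) / n^-1 `^ q <=
    regular_norm rho q n^-1 nu /\
    variation_measure nu (qball rho x n^-1) =
    (fine (variation_measure nu (qball rho x n^-1)))%:E.
  have fin : variation_measure nu (qball rho x n^-1) \is a fin_num.
    rewrite ge0_fin_numE//; apply: le_lt_trans nuT; apply: mono.
    exact: (measurable_qball dds).
  split; last by rewrite fineK.
  apply: lb_le_inf => // C /(_ x); rewrite -(fineK fin) lee_fin => h.
  by rewrite ler_pdivrMr.
split=> [|x]; last by have [h ->] := lb x; rewrite lee_fin -ler_pdivrMr.
have [h _] := lb point; apply: le_trans h.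
by rewrite divr_ge0 ?(ltW dq)// fine_ge0.
Qed.

(** The integral is the coefficient of index 0, which the cutoff leaves unchanged because [lam 0] is
    0. *)
Lemma integral_sigma (n : R) (f : B -> R) : 0 < n ->
  \int[mu]_(x in setT) f x = \int[mu]_(x in setT) sigma n f x.
Proof.
move=> n0; have phi0 (h : X -> R) : fhat mu phi h 0 = \int[mu]_(x in setT) h x.
  by rewrite /fhat; under eq_Rintegral do rewrite (dds_phi0 dds) mulr1.
rewrite -!phi0 (fhat_sigma dds S f 0 n0) (dds_lam0 dds) cutoff_eq1 ?mul1r//.
by rewrite ler_expR lerN2 expr0n/= mul0r.
Qed.

Lemma quadrature_error cg (n : R) (nu : complete_borel_measure R X) (A : R) f : 0 < cg ->
  (forall (tau : {measure set B -> \bar R}) (d C : R), 0 < d <= 1 -> 0 <= C ->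
   (forall x, tau (qball rho x d) <= (C * d `^ q)%:E)%E ->
   forall x s, d <= s -> (tau (qball rho x s) <= (cg * C * s `^ q)%:E)%E) ->
  1 <= n -> d_regular rho q n^-1 nu -> (variation_measure nu setT < +oo)%E -> 0 < A ->
  (forall P : X -> R, Pi lam phi n P ->
    (`|\int[mu]_(x in setT) P x - sp_integral nu P|%:E <=
      A%:E * Hnorm mu lam phi p gamma r P / (n `^ gamma)%:E)%E) ->
  Hspace mu lam phi p gamma r f ->
  (`|\int[mu]_(x in setT) f x - sp_integral nu (continuous_version mu lam phi f)|%:E <=
    ((c1 + tc * cg `^ ip p) * (A + regular_norm rho q n^-1 nu `^ ip p
                * fine (variation_measure nu setT) `^ ip' p))%:E
      * Hnorm mu lam phi p gamma r f / (n `^ gamma)%:E)%E.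
Proof.
move=> cg0 growth n1 nur nuT A0 PA fH; have n0 : 0 < n by exact: lt_le_trans n1.
have tc0 : 0 < tc := tail_const_gt0.
have [H H0 HE] := Hnorm_fin fH.
have fV := continuous_version_exists fH.
set V := continuous_version mu lam phi f in fV *.
have [tau [tauE tauI]] := borel_trace_exists (@cbm_borel _ _ nu) nuT.
have mono (D : set B) : measurable D ->
    (variation_measure nu D <= variation_measure nu setT)%E.
  by move=> mD; rewrite -!tauE; apply: le_measure; rewrite ?inE.
have [N0 Nb] := regular_norm_bound n1 nur nuT mono.
set N := regular_norm rho q n^-1 nu in N0 Nb *.
have d01 : 0 < n^-1 <= 1 by rewrite invr_gt0 n0 invf_le1.
have tauN x : (tau (qball rho x n^-1) <= (N * n^-1 `^ q)%:E)%E by rewrite tauE.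
have tail := version_tail fH fV n1 (mulr_ge0 (ltW cg0) N0) (growth tau _ _ d01 N0 tauN).
rewrite -/tc tauE HE in tail.
set t := fine (variation_measure nu setT) `^ ip' p in tail *.
have t0 : 0 <= t by exact: powR_ge0.
have mV := version_measurable fV.
have [N1 N10 VN] := version_bounded fV.
have ms : measurable_fun setT (sigma n f : B -> R) := sigma_measurable n f.
have [N2 N20 sN] : exists2 N2, 0 <= N2 & forall x, `|sigma n f x| <= N2.
  exact: (sum_phi_bounded dds (freq_count lam n) (fun k =>
    cutoff S (expR (- (lam k ^+ 2 * n ^- 2))) * fhat mu phi f k)).
have VM x : `|V x| <= N1 + N2 by rewrite (le_trans (VN x))// lerDl.
have sM x : `|sigma n f x| <= N1 + N2 by rewrite (le_trans (sN x))// lerDr.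
have VsM x : `|V x - sigma n f x| <= (N1 + N2) + (N1 + N2).
  by rewrite (le_trans (ler_normB _ _))// lerD.
have mVs : measurable_fun setT (fun x : B => V x - sigma n f x : R) := measurable_funB mV ms.
have spd := le_trans (sp_integral_le nuT tauI mVs VsM) tail.
rewrite (sp_integralB nuT mV ms VM sM) in spd.
have Hs := Hnorm_sigma dds r p1 c10 norm_sigma gamma n1 (proj1 fH).
have Ps := PA _ (Pi_sigma dds S f n0).
have ng : 0 < n `^ gamma by rewrite powR_gt0.
rewrite -(integral_sigma f n0) in Ps; rewrite HE in Hs.
have {}Ps : (`|\int[mu]_(x in setT) f x - sp_integral nu (sigma n f)|%:E <=
    (A * (c1 * H) / n `^ gamma)%:E)%E.
  apply: (le_trans Ps); rewrite inver gt_eqF// !EFinM.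
  rewrite lee_wpmul2r ?lee_fin ?invr_ge0 ?(ltW ng)// lee_wpmul2l ?lee_fin ?(ltW A0)//.
rewrite HE inver gt_eqF// -!EFinM lee_fin.
rewrite -EFinM in spd; rewrite !lee_fin in Ps spd.
(* The first difference is the quadrature error of [sigma n f], a member of [Pi_n]; the second is
   the integral of [V - sigma n f] against [nu]. *)
rewrite [X in `|X|](_ : _ = (\int[mu]_(x in setT) f x - sp_integral nu (sigma n f)) -
  (sp_integral nu V - sp_integral nu (sigma n f))); last by ring.
apply: (le_trans (ler_normB _ _)); apply: (le_trans (lerD Ps spd)).
rewrite powRN (powRM _ (ltW cg0) N0).
set W := N `^ ip p; set g := cg `^ ip p.
have W0 : 0 <= W by exact: powR_ge0.
have g0 : 0 <= g by exact: powR_ge0.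
rewrite [leLHS](_ : _ = (c1 * A + tc * g * (W * t)) * (H / n `^ gamma)); last by ring.
rewrite -[leRHS]mulrA ler_wpM2r ?divr_ge0 ?(ltW ng)//.
have e1 : 0 <= c1 * (W * t) := mulr_ge0 (ltW c10) (mulr_ge0 W0 t0).
have e2 : 0 <= tc * g * A := mulr_ge0 (mulr_ge0 (ltW tc0) g0) (ltW A0).
rewrite -subr_ge0 [leRHS](_ : _ = c1 * (W * t) + tc * g * A) ?addr_ge0//; ring.
Qed.

End tail.

Theorem theorem2 (R : realType) (X : ptopologicalType) (rho : X -> X -> R)
    (mu : probability (borelType X) R) (q k1 k2 k3 k4 : R)
    (p : \bar R) (gamma r : R) :
  (1 <= p)%E -> (q%:E / p < gamma%:E)%E -> gamma < r ->
  exists c : R, 0 < c /\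
  forall (lam : nat -> R) (phi : nat -> X -> R),
  data_defined_space rho mu lam phi q k1 k2 k3 k4 ->
  forall (n : R) (nu : complete_borel_measure R X) (A : R),
  1 <= n ->
  d_regular rho q n^-1 nu ->
  (variation_measure nu setT < +oo)%E ->
  0 < A ->
  (forall P : X -> R, Pi lam phi n P ->
    (`|\int[mu]_(x in setT) P x - sp_integral nu P|%:E <=
      A%:E * Hnorm mu lam phi p gamma r P / (n `^ gamma)%:E)%E) ->
  forall f : X -> R, Hspace mu lam phi p gamma r f ->
    (`|\int[mu]_(x in setT) f x
       - sp_integral nu (continuous_version mu lam phi f)|%:E <=
      (c * (A + regular_norm rho q n^-1 nu `^ fine (p^-1)%E
                * fine (variation_measure nu setT)
                    `^ fine ((hoelder_conjugate p)^-1)%E))%:E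
      * Hnorm mu lam phi p gamma r f / (n `^ gamma)%:E)%E.

Proof.
move=> p1 qp gr.
(* The constant must be fixed before [lam] and [phi], yet the signs of the parameters and the
   diameter bound are consequences of having a system. If no system exists the claim is vacuous;
   otherwise one system supplies these facts, which concern only [rho] and the numbers, for all
   others. *)
have [[lam0 [phi0 dds0]]|none] := pselect (exists lam phi,
  data_defined_space rho mu lam phi q k1 k2 k3 k4); last first.
  by exists 1; split=> // lam phi ?; exfalso; apply: none; exists lam, phi.
have q0 := dds_q_gt0 dds0; have k20 := dds_k2_gt0 dds0.
have k30 := dds_k3_gt0 dds0; have k40 := dds_k4_gt0 dds0.
have [D D0 hD] := bounded_diameter dds0.
have [ip0 ip_gamma] : 0 <= fine (p^-1)%E /\ q * fine (p^-1)%E < gamma.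
  case: p p1 qp => [s s1|_|//]; last by rewrite invey mule0/= mulr0 lte_fin.
  rewrite lee_fin in s1; have s0 : 0 < s by exact: lt_le_trans s1.
  by rewrite inver gt_eqF// -EFinM lte_fin/= invr_ge0 ltW.
have r0 : 0 < r.
  by rewrite (le_lt_trans _ (lt_trans ip_gamma gr))// mulr_ge0// ltW.
(* The decay order needed by [integral_decay]; cutoffs and blocks are therefore built with [s + s]
   derivatives. *)
set s := Num.bound (q + 1).
have qs : q + 1 <= s%:R by rewrite ltW// archi_boundP// addr_ge0// ltW.
have sc : smooth (s + s) `]-1, 2[%classic (fun _ : unit => @cutoff R (s + s)).
  by apply: (@smooth_cutoff _ _ _ _ 2) => u; rewrite /= in_itv/= ler_norml => /andP[]; lra.
have [c1 c10 sigmaP] := multop_bounds k1 D0 k20 k30 k40 qs sc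
  (fun _ u => @cutoff_eq0 R (s + s) u).
have [c2 c20 blockP] := multop_bounds k1 D0 k20 k30 k40 qs (@smooth_block R (s + s) r)
  (fun e u => @block_eq0 R (s + s) r e u).
have [cg cg0 growth] := regular_growth q (dds_k1_ge1 dds0) k20 k30 k40.
exists (c1 + tail_const q p gamma r c1 c2 * cg `^ fine (p^-1)%E); split.
  by rewrite addr_gt0// mulr_gt0 ?powR_gt0// (tail_const_gt0 r0 c10 c20 ip_gamma).
move=> lam phi dds n nu A n1 nur nuT A0 PA f fH.
apply: (quadrature_error dds p1 r0 c10 c20 _ _ _ ip0 ip_gamma cg0 _ n1 nur nuT A0 PA fH).
- move=> m h m1 hp; exact: (proj1 (sigmaP _ _ _ _ _ dds hD tt m h p m1 p1 hp)).
- move=> e m h m1 hp; exact: (proj1 (blockP _ _ _ _ _ dds hD e m h p m1 p1 hp)).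
- move=> t m h m1 t1 hp; exact: (proj2 (sigmaP _ _ _ _ _ dds hD tt m h t m1 t1 hp)).
- exact: growth dds.
Qed.
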